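(* Let $r,k,n$ be positive integers, let $0\le d\le r$, and let $\lambda,\mu$ be partitions of $n$ such that the module $W^\mu_{\mathcal{A}_{r-d,k-1}(n)}$ exists (is non-zero). Then the multiplicity of $W^\mu_{\mathcal{A}_{r-d,k-1}(n)}$ in $W^\lambda_{\mathcal{A}_{r,k}(n)}$, restricted to $\mathcal{A}_{r-d,k-1}(n)$ along the inclusion $\phi:\mathcal{A}_{r-d,k-1}(n)\hookrightarrow\mathcal{A}_{r,k}(n)$, is equal to $$\dim\mathrm{Hom}_{\mathbb{C}S_n}\!\left(W^\lambda_{\mathbb{C}S_n},\,W^\mu_{\mathbb{C}S_n}\otimes\mathcal{P}^d(V_{n,\{k\}})\right)=\sum_{\alpha}\sum_{\tau^{(\ast)}}c^{\mu}_{\tau^{(1)}\tau^{(2)}\cdots\tau^{(d+1)}}\,c^{\lambda}_{\tau^{(1)}\tau^{(2)}\cdots\tau^{(d+1)}},$$ where the first sum is over sequences of non-negative integers $\alpha=(\alpha_1,\dots,\alpha_{d+1})$ such that $\sum_{i=1}^{d+1}(i-1)\alpha_i=d$ and $\sum_{i=1}^{d+1}\alpha_i=n$, and the second is over sequences $\tau^{(\ast)}=(\tau^{(1)},\dots,\tau^{(d+1)})$ where, for each $1\le i\le d+1$, $\tau^{(i)}$ is a partition of $\alpha_i$.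
   Context: For a finite set $S$ of positive integers, $\mathcal{P}^s(V_{n,S})$ is the space of homogeneous polynomials of degree $s$ over $\mathbb{C}$ in the commuting variables $x_{ij}$, $1\le i\le n$, $j\in S$ (so $\mathcal{P}^0=\mathbb{C}$, and $\mathcal{P}^s(V_{n,\emptyset})=0$ for $s>0$); $\mathcal{P}^s(V_{n,m})=\mathcal{P}^s(V_{n,\{1,\dots,m\}})$. The symmetric group $S_n$ acts by $\sigma\cdot x_{i_1j_1}\cdots x_{i_sj_s}=x_{\sigma(i_1)j_1}\cdots x_{\sigma(i_s)j_s}$. $\mathcal{A}_{s,m}(n)=\mathrm{End}_{\mathbb{C}S_n}(\mathcal{P}^s(V_{n,m}))$. For a partition $\lambda$ of $n$, $W^\lambda_{\mathbb{C}S_n}$ is the irreducible $\mathbb{C}S_n$-module indexed by $\lambda$, and $W^\lambda_{\mathcal{A}_{s,m}(n)}:=\mathrm{Hom}_{\mathbb{C}S_n}(W^\lambda_{\mathbb{C}S_n},\mathcal{P}^s(V_{n,m}))$, an $\mathcal{A}_{s,m}(n)$-module by post-composition, irreducible when non-zero. **The inclusion $\phi$.** There is an $S_n$-equivariant decomposition (by degree $d$ in the variables $x_{ik}$) $$\mathcal{P}^r(V_{n,\{1,\dots,k\}})\cong\bigoplus_{d=0}^r\mathcal{P}^{r-d}(V_{n,\{1,\dots,k-1\}})\otimes\mathcal{P}^d(V_{n,\{k\}}),$$ with $S_n$ acting diagonally on the tensor products; it induces $\phi:\mathcal{A}_{r-d,k-1}(n)\hookrightarrow\mathcal{A}_{r,k}(n)$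 (not unit-preserving in general), in which an element of $\mathcal{A}_{r-d,k-1}(n)$ acts on the first tensor factor of the $d$-th summand, by the identity on the second factor, and by zero on the other summands. On orbit bases it reads $\phi(O_\pi)=\sum_\nu O_\nu$, as follows. Let $[m]=\{1,\dots,m\}$ and $[\bar m]=\{\bar1,\dots,\bar m\}$. $\Pi_{s,m,n}$ is the set of multisets of at most $n$ non-empty multisets (blocks) with entries in $[m]\cup[\bar m]$, containing in total $s$ entries from $[m]$ and $s$ from $[\bar m]$. An ordered pair of degree-$s$ monomials $(M,M')$ in the $x_{ij}$ ($i\le n$, $j\le m$) determines an element of $\Pi_{s,m,n}$: for each $i$, the block with colour $i$ contains one $j$ for each factor $x_{ij}$ of $M$ and one $\bar j$ for each factor $x_{ij}$ of $M'$ (empty blocks discarded). For $\pi\in\Pi_{s,m,n}$, $O_\pi$ is the operator sending each monomial $M$ to the sum of all monomials $M'$ such that $(M,M')$ determines $\pi$; the $O_\pi$ form a basis of $\mathcal{A}_{s,m}(n)$. The sum for $\phi(O_\pi)$ is over $\nu\in\Pi_{r,k,n}$ whose restriction to entries in $[k-1]\cup[\overline{k-1}]$ is $\pi$ (discarding empty blocks) and whose restriction to entries in $\{k,\bar k\}$ has $d$ entries $k$ and $d$ entries $\bar k$ and is self-symmetric, i.e. each of its blocks contains as many $k$'s as $\bar k$'s. **Littlewood–Richardson coefficients.** $c^\nu_{\tau^{(1)}\cdots\tau^{(m)}}$ is defined by $s_{\tau^{(1)}}\cdots s_{\tau^{(m)}}=\sum_\nu c^\nu_{\tau^{(1)}\cdots\tau^{(m)}}s_\nu$,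 where $s_\nu$ are Schur functions. *)

(* Defs.v *)
From HB Require Import structures.
From mathcomp Require Import all_boot all_order all_algebra all_fingroup.
From mathcomp Require Import all_character.
From mathcomp Require Import reals complex mpoly.
From Stdlib Require Import ClassicalEpsilon.

Set Implicit Arguments.
Unset Strict Implicit.
Unset Printing Implicit Defensive.

Import GroupScope GRing.Theory.
Local Open Scope ring_scope.

Definition is_part_of (n : nat) (s : seq nat) : bool :=
  [&& sorted geq s, 0%N \notin s & sumn s == n].

Record intpart (n : nat) :=
  IntPart { parts :> seq nat; partsP : is_part_of n parts }.

Notation "''P_' n" := (intpart n) (at level 8, n at level 2, format "''P_' n").

Section IntPartFinite.
Variable n : nat.

HB.instance Definition _ := [isSub for @parts n].
HB.instance Definition _ := [Countable of 'P_n by <:].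

Definition part_code (p : 'P_n) : n.-tuple 'I_n.+1 :=
  [tuple inord (nth 0%N p i) | i < n].

Definition part_decode (t : n.-tuple 'I_n.+1) : option 'P_n :=
  insub [seq x <- map val t | x != 0%N].

Lemma part_codeK : pcancel part_code part_decode.
Proof.
case=> s sP; rewrite /part_decode.
suff -> : [seq x <- map val (part_code (IntPart sP)) | x != 0%N] = s.
  by rewrite insubT.
have /and3P [_ s0 /eqP sn] := sP.
have le_nth i : (nth 0%N s i <= n)%N.
  rewrite -sn; elim: (s) i => [|a u IH] [|i] //=; first exact: leq_addr.
  exact: leq_trans (IH i) (leq_addl _ _).
have ->: map val (part_code (IntPart sP)) = mkseq (nth 0%N s) n.
  rewrite /part_code /= -map_comp /mkseq -val_enum_ord -map_comp.
  by apply: eq_map => i /=; rewrite inordK // ltnS.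
have szs : (size s <= n)%N.
  rewrite -sn; elim: (s) s0 => [|a u IH] //=.
  rewrite inE negb_or eq_sym => /andP [a0 /IH leu].
  by rewrite -add1n leq_add // lt0n.
rewrite -(subnKC szs) /mkseq iotaD map_cat filter_cat add0n.
rewrite -/(mkseq _ _) mkseq_nth.
have /all_filterP -> : all (fun x => x != 0%N) s.
  by apply/allP => x xs; apply: contraNneq s0 => <-.
rewrite [X in _ ++ X](_ : _ = [::]) ?cats0 //.
apply/eqP; rewrite -(negbK (_ == _)) -has_filter -all_predC.
rewrite all_map; apply/allP => i; rewrite mem_iota => /andP [szi _] /=.
by rewrite nth_default.
Qed.

HB.instance Definition _ : isFinite 'P_n := PCanIsFinite part_codeK.

End IntPartFinite.

Section Hom.
Variables (F : fieldType) (gT : finGroupType) (G : {group gT}).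
Variables (n1 n2 : nat).
Variables (rG1 : mx_representation F G n1) (rG2 : mx_representation F G n2).

(* Linear maps are matrices acting on row vectors from the right, as everywhere
   in [mxrepresentation]; composition is thus read from left to right. *)
Definition homG : {vspace 'M[F]_(n1, n2)} :=
  (\bigcap_(g in G) lker (linfun (mulmx (rG1 g) \- mulmxr (rG2 g))))%VS.

Lemma mem_homG (f : 'M[F]_(n1, n2)) :
  reflect {in G, forall g, rG1 g *m f = f *m rG2 g} (f \in homG).
Proof.
rewrite memvE; apply: (iffP subv_bigcapP) => h g gG.
  by have := h g gG; rewrite -memvE memv_ker lfunE /= subr_eq0 => /eqP.
by rewrite -memvE memv_ker lfunE /= subr_eq0; apply/eqP/h.
Qed.

End Hom.

Section Specht.
Variables (F : fieldType) (n : nat) (lam : 'P_n).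

(* Row and column of the entry i in the tableau of shape lam filled with
   0, 1, ..., n-1 row after row. *)
Definition tab_row (i : 'I_n) : nat := reshape_index lam i.
Definition tab_col (i : 'I_n) : nat := reshape_offset lam i.

Definition row_group : {set 'S_n} :=
  [set p : 'S_n | [forall i, tab_row (p i) == tab_row i]].
Definition col_group : {set 'S_n} :=
  [set q : 'S_n | [forall i, tab_col (q i) == tab_col i]].

(* The product q * p of [perm] is "q, then p", i.e. p o q: this is the Young
   symmetrizer (sum of the p) o (signed sum of the q), and the right
   [regular_repr]-module it generates is, with composition written in the
   usual order, the left ideal of F[S_n] generated by it. *)
Definition young_symmetrizer : 'rV[F]_#|[set: 'S_n]| :=
  \sum_(p in row_group) \sum_(q in col_group)
    (-1) ^+ odd_perm q *: delta_mx 0 (gring_index [set: 'S_n] (q * p)%g).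

Definition specht :=
  submod_repr (cyclic_mx_module (regular_repr F [set: 'S_n]) young_symmetrizer).

End Specht.

Section Polynomials.
Variables (F : fieldType) (n k : nat).

(* The variable x_{i,j+1} is 'X_(enum_rank (i, j)), for i : 'I_n, j : 'I_k. *)
Local Notation nvar := #|{: 'I_n * 'I_k}|.

Definition var_act (s : 'S_n) (t : 'I_nvar) : 'I_nvar :=
  let ij := enum_val t in enum_rank (s ij.1, ij.2).

Definition poly_act (s : 'S_n) (p : {mpoly F[nvar]}) : {mpoly F[nvar]} :=
  p \mPo [tuple 'X_(var_act s t) | t < nvar].

(* The monomials of degree s in the variables x_{ij} with j in S: a basis of
   P^s(V_{n,S}), for S a subset of {1, ..., k}. *)
Definition monomials (S : {set 'I_k}) (s : nat) : {set 'X_{1..nvar < s.+1}} :=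
  [set m : 'X_{1..nvar < s.+1} | (mdeg m == s) &&
     [forall t : 'I_nvar, (m t != 0%N) ==> ((enum_val t).2 \in S)]].

Definition mon (S : {set 'I_k}) (s : nat) (a : 'I_#|monomials S s|) :
  'X_{1..nvar} := bmnm (enum_val a).

Section Action.
Variables (S : {set 'I_k}) (s : nat).

Definition pol_mx (g : 'S_n) : 'M[F]_#|monomials S s| :=
  \matrix_(a, b) (poly_act g 'X_[mon a])@_(mon b).

Definition mon_act (g : 'S_n) (m : 'X_{1..nvar}) : 'X_{1..nvar} :=
  [multinom m (var_act g^-1 t) | t < nvar].

Lemma var_actM (g h : 'S_n) t : var_act (g * h) t = var_act h (var_act g t).
Proof. by rewrite /var_act enum_rankK /= permM. Qed.

Lemma var_act1 t : var_act 1 t = t.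
Proof. by rewrite /var_act perm1 -surjective_pairing enum_valK. Qed.

Lemma var_actK (g : 'S_n) : cancel (var_act g) (var_act g^-1).
Proof. by move=> t; rewrite -var_actM mulgV var_act1. Qed.

Lemma var_actVK (g : 'S_n) : cancel (var_act g^-1) (var_act g).
Proof. by move=> t; rewrite -var_actM mulVg var_act1. Qed.

Lemma poly_actX g m : poly_act g 'X_[m] = 'X_[mon_act g m].
Proof.
rewrite /poly_act comp_mpolyX mpolyXE_id.
rewrite [RHS](reindex_inj (can_inj (var_actK g))) /=.
by apply: eq_bigr => t _; rewrite tnth_mktuple mnmE var_actK.
Qed.

Lemma mdeg_mon_act g m : mdeg (mon_act g m) = mdeg m.
Proof.
rewrite !mdegE (reindex_inj (can_inj (var_actK g))) /=.
by apply: eq_bigr => t _; rewrite mnmE var_actK.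
Qed.

Lemma mon_actP g (a : 'I_#|monomials S s|) :
  {b : 'I_#|monomials S s| | mon b = mon_act g (mon a)}.
Proof.
have := enum_valP a; rewrite inE => /andP [dega /forallP suppa].
have lt : (mdeg (mon_act g (mon a)) < s.+1)%N.
  by rewrite mdeg_mon_act (eqP dega).
have mS : BMultinom lt \in monomials S s.
  rewrite inE /= mdeg_mon_act dega /=; apply/forallP => t.
  by have := suppa (var_act g^-1 t); rewrite mnmE /var_act enum_rankK.
by exists (enum_rank_in mS (BMultinom lt)); rewrite /mon enum_rankK_in.
Qed.

Lemma mon_actM g h m : mon_act (g * h) m = mon_act h (mon_act g m).
Proof. by apply/mnmP => t; rewrite !mnmE invMg var_actM. Qed.

Lemma pol_mx_repr : mx_repr [set: 'S_n] pol_mx.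
Proof.
have enum_val_eq (a b : 'I_#|monomials S s|) :
    (mon a == mon b) = (a == b).
  by rewrite -bmeqP (inj_eq enum_val_inj).
split=> [|g h _ _]; apply/matrixP => a c; rewrite !mxE poly_actX mcoeffX.
  have -> : mon_act 1 (mon a) = mon a.
    by apply/mnmP => t; rewrite mnmE invg1 var_act1.
  by rewrite enum_val_eq.
have [b bE] := mon_actP g a.
rewrite (bigD1 b) //= !mxE !poly_actX !mcoeffX -bE eqxx mul1r.
rewrite big1 ?addr0 => [|b' b'b]; first by rewrite mon_actM -bE.
by rewrite !mxE poly_actX mcoeffX -bE enum_val_eq eq_sym (negPf b'b) mul0r.
Qed.

(* P^s(V_{n,S}), in coordinates with respect to the monomials. *)
Definition pol_repr : mx_representation F [set: 'S_n] #|monomials S s| :=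
  MxRepresentation pol_mx_repr.

Definition cent_alg : {vspace 'M[F]_#|monomials S s|} := homG pol_repr pol_repr.

Definition cent_module (lam : 'P_n) := homG (specht F lam) pol_repr.

Definition post_comp (p : nat) (a : 'M[F]_#|monomials S s|)
  (f : 'M[F]_(p, #|monomials S s|)) : 'M[F]_(p, #|monomials S s|) := f *m a.

End Action.

(* The colours {1, ..., m} and {c}; the colour j+1 is represented by j. *)
Definition colours_upto (m : nat) : {set 'I_k} := [set j : 'I_k | (j.+1 <= m)%N].
Definition colour (c : nat) : {set 'I_k} := [set j : 'I_k | j.+1 == c].

(* Matrix of q |-> q * y, from P^s(V_{n,S}) to P^r(V_{n,T}), for a monomial y. *)
Definition mulmon_mx (S T : {set 'I_k}) (s r : nat) (y : 'X_{1..nvar}) :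
    'M[F]_(#|monomials S s|, #|monomials T r|) :=
  \matrix_(a, b) ('X_[mon a] * 'X_[y])@_(mon b).

(* For each monomial y of degree d in the x_{ik}, [mulmon_mx] embeds
   P^{r-d}(V_{n,k-1}) (x) y in P^r(V_{n,k}), and its transpose is the projection
   onto this summand along the other monomials.  Hence [phi a] sends q * y to
   a(q) * y when y has degree d, and vanishes on the other summands. *)
Definition phi (r d : nat)
    (a : 'M[F]_#|monomials (colours_upto k.-1) (r - d)|) :
    'M[F]_#|monomials (colours_upto k) r| :=
  \sum_(y in monomials (colour k) d)
    (mulmon_mx (colours_upto k.-1) (colours_upto k) (r - d) r y)^T *m a
      *m mulmon_mx (colours_upto k.-1) (colours_upto k) (r - d) r y.

Lemma mulmon_mxK (r d : nat) (y z : 'X_{1..nvar < d.+1}) :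
    (d <= r)%N -> y \in monomials (colour k) d -> z \in monomials (colour k) d ->
  mulmon_mx (colours_upto k.-1) (colours_upto k) (r - d) r y *m
    (mulmon_mx (colours_upto k.-1) (colours_upto k) (r - d) r z)^T = (y == z)%:R%:M.
Proof.
move=> ledr; rewrite !inE => /andP [/eqP degy /forallP suppy].
move=> /andP [_ /forallP suppz].
have suppP (a : 'I_#|monomials (colours_upto k.-1) (r - d)|) t :
    mon a t != 0%N -> ((enum_val t).2 < k.-1)%N.
  have := enum_valP a; rewrite inE => /andP [_ /forallP /(_ t) /implyP h] /h.
  by rewrite inE.
apply/matrixP => a b; rewrite !mxE.
have lt : (mdeg (mon a + y)%MM < r.+1)%N.
  have := enum_valP a; rewrite inE mdegD degy => /andP [/eqP -> _].
  by rewrite subnK.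
have cT : BMultinom lt \in monomials (colours_upto k) r.
  rewrite inE /= mdegD degy; have := enum_valP a; rewrite inE => /andP [/eqP -> _].
  by rewrite subnK // eqxx; apply/forallP => t; rewrite inE ltn_ord implybT.
pose c0 := enum_rank_in cT (BMultinom lt).
have c0E : mon c0 = (mon a + y)%MM by rewrite /mon enum_rankK_in.
rewrite (bigD1 c0) //= big1 ?addr0 => [|c c0c]; last first.
  rewrite !mxE -!mpolyXD mcoeffX -c0E.
  have /negPf -> : mon c0 != mon c; last by rewrite mul0r.
  by apply: contra c0c => /eqP /val_inj /enum_val_inj ->.
rewrite !mxE -!mpolyXD !mcoeffX c0E eqxx mul1r.
have [<-|neq] := eqVneq y z.
  rewrite eqm_add2r (_ : (mon b == mon a) = (a == b)).
    by rewrite mulr1n.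
  by rewrite eq_sym /mon -bmeqP (inj_eq enum_val_inj).
rewrite mul0rn; case: eqP => // /esym e; case/negP: neq; apply/eqP/val_inj/mnmP => t.
have := congr1 (fun m : 'X_{1..nvar} => m t) e; rewrite !mnmDE /=.
have := suppy t; have := suppz t; have := suppP a t; have := suppP b t.
rewrite !inE.
have [kt|kt] := boolP ((enum_val t).2.+1 == k).
  have -> : ((enum_val t).2 < k.-1)%N = false.
    by apply: contraTF kt; rewrite ltn_predRL neq_ltn => ->.
  case: (mon a t) => [|u] h1; last by move=> /(_ isT).
  by case: (mon b t) h1 => [|u] h1; [rewrite !add0n | have := h1 isT].
by move=> _ _; rewrite !implybF !negbK => /eqP -> /eqP ->.
Qed.

Lemma mulmon_phi (r d : nat) a (y : 'X_{1..nvar < d.+1}) :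
    (d <= r)%N -> y \in monomials (colour k) d ->
  mulmon_mx (colours_upto k.-1) (colours_upto k) (r - d) r y *m phi a =
    a *m mulmon_mx (colours_upto k.-1) (colours_upto k) (r - d) r y.
Proof.
move=> ledr yd; rewrite /phi mulmx_sumr (bigD1 y) //= !mulmxA mulmon_mxK // eqxx.
rewrite mul1mx big1 ?addr0 // => z /andP [zd zy].
by rewrite !mulmxA mulmon_mxK // eq_sym (negPf zy) -scalemx1 scale0r !mul0mx.
Qed.

End Polynomials.

Arguments phi {F n k} r d a.

Section Multiplicity.
Variables (F : fieldType) (E : vectType F) (A : {vspace E}).

Definition submodule (V : vectType F) (act : E -> V -> V) (U : {vspace V}) : Prop :=
  forall a u, a \in A -> u \in U -> act a u \in U.

Definition module_iso (V1 V2 : vectType F) (act1 : E -> V1 -> V1)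
    (act2 : E -> V2 -> V2) (U1 : {vspace V1}) (U2 : {vspace V2}) : Prop :=
  exists f : 'Hom(V1, V2),
    [/\ (f @: U1 = U2)%VS, (lker f :&: U1 = 0)%VS
      & forall a u, a \in A -> u \in U1 -> f (act1 a u) = act2 a (f u)].

(* U is the direct sum of m submodules isomorphic to W and of a submodule
   without any submodule isomorphic to W.  This also makes sense when A does
   not act unitally on U. *)
Definition multiplicity_is (V1 V2 : vectType F) (act1 : E -> V1 -> V1)
    (act2 : E -> V2 -> V2) (W : {vspace V1}) (U : {vspace V2}) (m : nat) : Prop :=
  exists (X : 'I_m -> {vspace V2}) (Y : {vspace V2}),
    [/\ (\sum_i X i + Y)%VS = U,
        directv (\sum_i X i + Y),
        forall i, submodule act2 (X i) /\ module_iso act1 act2 W (X i),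
        submodule act2 Y
      & forall Z : {vspace V2},
          (Z <= Y)%VS -> submodule act2 Z -> ~ module_iso act1 act2 W Z].

End Multiplicity.

Definition cell (sh : seq nat) : finType :=
  {i : 'I_(size sh) & 'I_(nth 0%N sh i)}.

Definition semistandard (N : nat) (sh : seq nat) (T : {ffun cell sh -> 'I_N}) : bool :=
  [forall c : cell sh, forall c' : cell sh,
     ((tag c == tag c') && (tagged c < tagged c')%N ==> (T c <= T c')%N) &&
     ((tagged c == tagged c' :> nat) && (tag c < tag c')%N ==> (T c < T c')%N)].

Definition schur (N : nat) (sh : seq nat) : {mpoly int[N]} :=
  \sum_(T : {ffun cell sh -> 'I_N} | semistandard T) \prod_(c : cell sh) 'X_(T c).

(* An identity between symmetric functions is a family of identities in N
   variables, for all N.  The first clause is the convention that s_nu does not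
   occur when |nu| differs from the degree (or when nu is not a partition). *)
Definition LR_expansion (m : nat) (t : 'I_m -> seq nat) (c : seq nat -> int) : Prop :=
  let deg := (\sum_(i < m) sumn (t i))%N in
  (forall nu, ~~ is_part_of deg nu -> c nu = 0) /\
  (forall N, \prod_(i < m) schur N (t i) = \sum_(nu : 'P_deg) c nu *: schur N nu).

Definition LR_coef (m : nat) (t : 'I_m -> seq nat) (nu : seq nat) : int :=
  epsilon (inhabits (fun _ : seq nat => 0 : int)) (LR_expansion t) nu.

(* Main.v *)
(* Put F = R[i], P = P^(r-d)(V_(n,k-1)) and Q = P^d(V_(n,{k})).

   Multiplicity.  End(S^mu) = F, so there are w1 : S^mu -> P and rho1 : P -> S^mu
   whose composite is the identity of S^mu; the other composite eps is a primitive
   idempotent of the centralizer algebra A of P with W^mu eps = F w1.  Hence the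
   multiplicity of W^mu in an A-module U is dim U eps, even when A does not act
   unitally.  For U = Hom(S^lam, P^r) this is the trace of the Young idempotent
   of lam on the image of phi(eps), and tr(g phi(eps)) = tr_(S^mu)(g) tr_Q(g), so it
   is dim Hom(S^lam, S^mu (x) Q).

   Littlewood-Richardson side.  The local rule for horizontal strips gives Pieri's
   rule, hence Cauchy's identity and integral expansions of products of Schur
   functions.  Frobenius' formula p_g = sum_lam chi_lam(g) s_lam is then forced:
   expanding the permutation characters pi_mu by the Kostka matrix defines psi_lam
   with p_g = sum_lam psi_lam(g) s_lam, and these are orthonormal by Burnside's
   lemma and Cauchy's identity; on the other hand chi_lam has norm 1, and Young
   symmetrizers give <chi_lam, pi_lam> = 1 and <chi_lam, pi_mu> = 0 unless lam
   dominates mu, so that <chi_lam, psi_lam> = 1 and chi_lam = psi_lam.  Finally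
   sum_(lam,mu) h_(lam,mu) s_lam(X) s_mu(Y) is the coefficient of t^d in
   h_n(x_i y_j t^l) = sum_alpha prod_l t^(l alpha_l) h_(alpha_l)(XY), and each
   h_a(XY) is expanded by Cauchy's identity. *)

Require Import Defs.
From HB Require Import structures.
From mathcomp Require Import all_boot all_order all_algebra all_fingroup.
From mathcomp Require Import all_character.
From mathcomp Require Import reals complex mpoly.
From mathcomp Require Import zify ring.
From Stdlib Require Import ClassicalEpsilon.

Set Implicit Arguments.
Unset Strict Implicit.
Unset Printing Implicit Defensive.

Import GRing.Theory.
Local Open Scope ring_scope.

(** * Partitions and horizontal strips *)

Notation "s `_[ i ]" := (nth 0%N s i) (at level 3, i at level 2, format "s `_[ i ]").

(** [LR_coef] is an epsilon choice, so it can be computed with only after a single integral family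
    of coefficients is shown to serve every number N of variables. Schur polynomials are therefore
    evaluated at arbitrary sequences in arbitrary commutative rings, and expansions are stated
    uniformly in the ring, the sequence and N. The tableau sum is accordingly rewritten as a
    recursion on N, to which Pieri's rule and ring morphisms apply directly. Identities between
    class functions are read off in a polynomial ring in two alphabets X and Y, where the products
    s_lam(X) s_mu(Y) are linearly independent. The comparison of chi_lam with psi_lam takes place
    over the rationals, where a vanishing sum of squares has vanishing terms; the passage to R[i] is
    possible because Young symmetrizers have integer coefficients, and in characteristic 0 a
    dimension is recovered from its image in the field. That the endomorphisms of a Specht module
    are scalars comes from the same computation as the norm of chi_lam. *)

Lemma is_part_ofP n s :
  reflect [/\ sorted geq s, 0%N \notin s & sumn s = n] (is_part_of n s).
Proof. by apply: (iffP and3P) => -[? ? /eqP]. Qed.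

Lemma sumn_part n (p : 'P_n) : sumn p = n.
Proof. by have /is_part_ofP[] := partsP p. Qed.

Lemma nth_geq_sorted s i j : sorted geq s -> (i <= j)%N -> (s`_[j] <= s`_[i])%N.
Proof.
move=> sorts leij; have [szj|ltj] := leqP (size s) j; first by rewrite nth_default.
have tr : transitive geq by move=> x y z /= yx zx; apply: leq_trans zx yx.
by apply: (sorted_leq_nth tr leqnn 0%N sorts) => //; rewrite inE ?(leq_ltn_trans leij).
Qed.

Lemma part_noninc n (p : 'P_n) i j : (i <= j)%N -> (p`_[j] <= p`_[i])%N.
Proof. by apply: nth_geq_sorted; have /is_part_ofP[] := partsP p. Qed.

Lemma nth_eq0_part (s : seq nat) i :
  0%N \notin s -> (s`_[i] == 0%N) = (size s <= i)%N.
Proof.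
move=> s0; have [szi|lti] := leqP (size s) i; first by rewrite nth_default ?eqxx.
by apply: contraNF s0 => /eqP <-; apply: mem_nth.
Qed.

Lemma part_ext (s t : seq nat) : 0%N \notin s -> 0%N \notin t ->
  (forall i, s`_[i] = t`_[i]) -> s = t.
Proof.
move=> s0 t0 eq_st; have eqsz : size s = size t.
  apply/eqP; rewrite eqn_leq; apply/andP; split.
    by rewrite -nth_eq0_part // eq_st nth_eq0_part.
  by rewrite -nth_eq0_part // -eq_st nth_eq0_part.
by apply: (@eq_from_nth _ 0%N).
Qed.

Lemma notin0_part n (p : 'P_n) : 0%N \notin (p : seq nat).
Proof. by have /is_part_ofP[] := partsP p. Qed.

Lemma intpart_ext n (p q : 'P_n) : (forall i, p`_[i] = q`_[i]) -> p = q.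
Proof. by move=> h; apply/val_inj/part_ext => //; apply: notin0_part. Qed.

Lemma leq_size_sumn (s : seq nat) : 0%N \notin s -> (size s <= sumn s)%N.
Proof.
elim: s => //= a s IH; rewrite inE negb_or => /andP[a0 /IH].
by move: a0; lia.
Qed.

Lemma size_part n (p : 'P_n) : (size p <= n)%N.
Proof. by rewrite -{2}(sumn_part p) leq_size_sumn ?notin0_part. Qed.

Lemma sumn_nth (s : seq nat) L :
  (size s <= L)%N -> sumn s = (\sum_(0 <= i < L) s`_[i])%N.
Proof.
move=> szL; rewrite sumnE (big_nth 0%N) (big_cat_nat _ szL) //= [X in (_ + X)%N]big1_seq ?addn0 //.
by move=> i /=; rewrite mem_index_iota => /andP[szi _]; rewrite nth_default.
Qed.

Lemma sum_part_nth n (p : 'P_n) L :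
  (n <= L)%N -> (\sum_(0 <= i < L) p`_[i])%N = n.
Proof. by move=> nL; rewrite -sumn_nth ?sumn_part // (leq_trans (size_part p)). Qed.

(** A partition of n has at most n parts, so the first n values suffice; filtering drops the zeros,
    which come last when f is nonincreasing. *)
Definition part_fun_seq (n : nat) (f : nat -> nat) :=
  [seq x <- mkseq f n | x != 0%N].

Definition part_default n : 'P_n.
Proof.
exists (nseq n 1%N); apply/and3P; split.
- by case: n => //= n; elim: n => //=.
- by rewrite mem_nseq andbF.
- by rewrite sumn_nseq mul1n.
Defined.

Definition part_of n (f : nat -> nat) : 'P_n :=
  insubd (part_default n) (part_fun_seq n f).

Lemma nth_part_fun_seq n f i : {homo f : i j / (i <= j)%N >-> (j <= i)%N} ->
  (forall j, (n <= j)%N -> f j = 0%N) -> (part_fun_seq n f)`_[i] = f i.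
Proof.
(* The zeros of a nonincreasing f form a final segment; m is where it starts. *)
move=> fdec f0; have [m [fm mlt]] : exists m, (forall j, (m <= j)%N -> f j = 0%N) /\
    (forall j, (j < m)%N -> f j != 0%N).
  elim: n f0 => [|n IH] f0; first by exists 0%N; split => //.
  have [fn0|fn0] := eqVneq (f n) 0%N.
    apply: IH => j nj; apply/eqP; rewrite -leqn0 -fn0; exact: fdec.
  exists n.+1; split => // j jn; apply: contra_neq fn0 => fj0; apply/eqP.
  by rewrite -leqn0 -fj0 fdec.
have mn : part_fun_seq n f = mkseq f (minn m n).
  rewrite /part_fun_seq /mkseq -{1}(subnKC (geq_minr m n)) iotaD map_cat filter_cat.
  rewrite [X in _ ++ X](_ : _ = [::]) ?cats0; last first.
    apply/eqP; rewrite -(negbK (_ == _)) -has_filter -all_predC all_map.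
    apply/allP => j; rewrite mem_iota /= => jj; rewrite negbK fm ?eqxx //.
    move: jj; lia.
  apply/all_filterP; rewrite all_map; apply/allP => j; rewrite mem_iota /= => jj.
  by apply: mlt; move: jj; lia.
rewrite mn; have [lti|gei] := ltnP i (minn m n); first by rewrite nth_mkseq.
rewrite nth_default ?size_mkseq //; move: gei; rewrite geq_min => /orP[] h.
  by rewrite fm.
by rewrite f0.
Qed.

Lemma part_fun_seqP n f L : {homo f : i j / (i <= j)%N >-> (j <= i)%N} ->
  (forall j, (L <= j)%N -> f j = 0%N) -> (\sum_(0 <= i < L) f i)%N = n ->
  is_part_of n (part_fun_seq n f) /\ (forall i, (part_fun_seq n f)`_[i] = f i).
Proof.
move=> fdec f0 fn.
(* A nonzero value at some j >= n would make all j+1 values up to j positive, and their sum would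
   exceed n. *)
have fn0 j : (n <= j)%N -> f j = 0%N.
  move=> nj; apply/eqP; rewrite -leqn0 leqNgt; apply/negP => fj.
  have jL : (j < L)%N by rewrite ltnNge; apply/negP => /f0 h; rewrite h in fj.
  suff : (n < n)%N by rewrite ltnn.
  rewrite -{2}fn (big_cat_nat _ jL) //=.
  apply: (@leq_trans (\sum_(0 <= i < j.+1) f i)%N); last exact: leq_addr.
  apply: (@leq_trans (\sum_(0 <= i < j.+1) 1)%N); first by rewrite sum_nat_const_nat; lia.
  rewrite !big_nat; apply: leq_sum => i /andP[_ ij]; exact: (leq_trans fj (fdec i j ij)).
have nthf i := nth_part_fun_seq i fdec fn0.
split => //; apply/is_part_ofP; split.
- apply/(sortedP 0%N) => i _; rewrite !nthf /=; exact: fdec.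
- by rewrite mem_filter.
have sz : (size (part_fun_seq n f) <= maxn n L)%N.
  rewrite size_filter (leq_trans (count_size _ _)) // size_mkseq; lia.
rewrite (sumn_nth sz) (eq_bigr f) => [|i _]; last exact: nthf.
rewrite (big_cat_nat (n := L)) ?leq_maxr //= fn [X in (_ + X)%N]big1_seq ?addn0 //.
by move=> i /=; rewrite mem_index_iota => /andP[/f0].
Qed.

Lemma nth_part_of n f L : {homo f : i j / (i <= j)%N >-> (j <= i)%N} ->
  (forall j, (L <= j)%N -> f j = 0%N) -> (\sum_(0 <= i < L) f i)%N = n ->
  forall i, (part_of n f)`_[i] = f i.
Proof.
move=> fdec f0 fn i; have [pP h] := part_fun_seqP fdec f0 fn.
by rewrite /part_of [X in nth _ X](insubdK _ pP).
Qed.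

(* A single finite type for partitions of varying size, so that sums over strips
   need no casts between the types 'P_n. *)
Definition bpart (B : nat) := {j : 'I_B.+1 & 'P_j}.
HB.instance Definition _ B := Finite.on (bpart B).
Definition bparts B (p : bpart B) : seq nat := parts (tagged p).
Coercion bparts : bpart >-> list.

Lemma bpart_ext B (p q : bpart B) : (forall i, (bparts p)`_[i] = (bparts q)`_[i]) -> p = q.
Proof.
case: p q => [j p] [j' q] /= h; rewrite /bparts /= in h.
have e : parts p = parts q by apply: part_ext => //; apply: notin0_part.
have ej : j = j' by apply/val_inj; rewrite /= -(sumn_part p) -(sumn_part q) e.
by case: j' / ej q e {h} => q /val_inj ->.
Qed.

Lemma bpartP B (p : bpart B) : is_part_of (sumn (bparts p)) (bparts p).
Proof.
have /is_part_ofP[h1 h2 _] := partsP (tagged p).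
by apply/is_part_ofP; split.
Qed.

Lemma sumn_bpart B (p : bpart B) : (sumn (bparts p) <= B)%N.
Proof. by rewrite sumn_part -ltnS. Qed.

Lemma bpart_nth0 B (p : bpart B) i : (B <= i)%N -> (bparts p)`_[i] = 0%N.
Proof.
move=> Bi; apply: nth_default; apply: leq_trans (size_part _) _.
by rewrite (leq_trans _ Bi) // -ltnS.
Qed.

Lemma bpart_noninc B (p : bpart B) i j :
  (i <= j)%N -> ((bparts p)`_[j] <= (bparts p)`_[i])%N.
Proof. exact: part_noninc. Qed.

Lemma sum_bpart_nth B (p : bpart B) L :
  (B <= L)%N -> (\sum_(0 <= i < L) (bparts p)`_[i])%N = sumn (bparts p).
Proof.
move=> BL; rewrite -sumn_nth // (leq_trans (size_part _)) //.
by apply: leq_trans BL; rewrite -ltnS.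
Qed.

Definition bpart_of B n (f : nat -> nat) : bpart B :=
  existT (fun j : 'I_B.+1 => 'P_j) (inord n) (part_of (inord n : 'I_B.+1) f).

Lemma nth_bpart_of B n f L : (n <= B)%N ->
  {homo f : i j / (i <= j)%N >-> (j <= i)%N} ->
  (forall j, (L <= j)%N -> f j = 0%N) -> (\sum_(0 <= i < L) f i)%N = n ->
  forall i, (bparts (bpart_of B n f))`_[i] = f i.
Proof.
move=> nB fdec f0 fn i; apply: (nth_part_of (L := L)) => //=.
by rewrite inordK.
Qed.

Lemma sumn_bpart_of B n f : (n <= B)%N -> sumn (bparts (bpart_of B n f)) = n.
Proof. by move=> nB; rewrite sumn_part /= inordK. Qed.

(** Interlacing of the parts: lam/mu is a horizontal strip, with mu the inner shape. Beyond both
    sizes all parts vanish, so a finite check is enough. *)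
Definition hstrip (mu lam : seq nat) : bool :=
  all (fun i => (lam`_[i.+1] <= mu`_[i] <= lam`_[i])%N)
      (iota 0 (maxn (size lam) (size mu))).

Lemma hstripP mu lam :
  reflect (forall i, (lam`_[i.+1] <= mu`_[i] /\ mu`_[i] <= lam`_[i])%N) (hstrip mu lam).
Proof.
apply: (iffP allP) => [h i|h i _]; last by apply/andP.
have [lti|gei] := ltnP i (maxn (size lam) (size mu)).
  by apply/andP/h; rewrite mem_iota.
rewrite geq_max in gei; case/andP: gei => ? ?.
by rewrite !nth_default // ltnW.
Qed.

Lemma hstrip_sumn B (mu lam : bpart B) : hstrip mu lam -> (sumn mu <= sumn lam)%N.
Proof.
move/hstripP => h; rewrite -!(sum_bpart_nth _ (leqnn B)).
by apply: leq_sum => i _; case: (h i).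
Qed.

(** * The local rule: shapes above and below a given pair of partitions *)

Section LocalRule.
Variables (B M : nat) (mu nu : bpart B).
Hypothesis MB : (M <= B)%N.

Local Notation mn i := (minn mu`_[i] nu`_[i]).
Local Notation mx i := (maxn mu`_[i] nu`_[i]).

Let up (lam : bpart B) := [&& sumn lam == M, hstrip mu lam & hstrip nu lam].
(** The inequality is what the reversal leaves of lam_0 >= max(mu_0, nu_0): the excess of lam_0 over
    this maximum becomes M + |ka| - |mu| - |nu|. *)
Let down (ka : bpart B) :=
  [&& hstrip ka mu, hstrip ka nu & (sumn mu + sumn nu <= M + sumn ka)%N].

Let downf (lam : bpart B) i := (mn i + mx i.+1 - lam`_[i.+1])%N.
Let upf (ka : bpart B) i :=
  if i is i'.+1 then (mn i' + mx i'.+1 - ka`_[i'])%N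
  else (mx 0 + (M + sumn ka - (sumn mu + sumn nu)))%N.
Let downs (lam : bpart B) := (sumn mu + sumn nu + lam`_[0] - mx 0 - M)%N.
Let godown lam := bpart_of B (downs lam) (downf lam).
Let goup ka := bpart_of B M (upf ka).

(** Minimum and maximum at the same index add up to mu_i + nu_i; shifting the maxima by one leaves
    [mx 0] over. *)
Let summnmx : (\sum_(0 <= i < B.+1) (mn i + mx i.+1) + mx 0 = sumn mu + sumn nu)%N.
Proof.
rewrite -!(sum_bpart_nth _ (leqnSn B)) -big_split /= big_split /=.
rewrite -addnA (addnC _ (mx 0)) -(big_nat_recl _ _ (fun i => mx i)) //= -?big_split /=.
rewrite (big_nat_recr B.+1) //= !(bpart_nth0 _ (leqnSn B)) maxnn addn0 -big_split /=.
by apply: eq_bigr => i _; lia.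
Qed.

Let sumM (lam : bpart B) : sumn lam == M ->
  M = (lam`_[0] + \sum_(0 <= i < B.+1) lam`_[i.+1])%N.
Proof. by move/eqP <-; rewrite -(sum_bpart_nth _ (leqW (leqnSn B))) big_nat_recl. Qed.

Let downP lam : up lam -> (downs lam <= B)%N /\
  (forall i, (godown lam)`_[i] = downf lam i).
Proof.
move=> /and3P[/sumM lamM /hstripP hmu /hstripP hnu].
have key : (\sum_(0 <= i < B.+1) downf lam i + (M - lam`_[0]) + mx 0
             = sumn mu + sumn nu)%N.
  rewrite -summnmx lamM addKn; congr (_ + _)%N.
  rewrite -big_split /=; apply: eq_bigr => i _; rewrite /downf subnK //.
  have := hmu i; have := hnu i; lia.
have lam0 : (lam`_[0] <= M)%N by rewrite lamM leq_addr.
have downsE : (\sum_(0 <= i < B.+1) downf lam i = downs lam)%N by rewrite /downs; lia.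
have szB : (downs lam <= B)%N.
  rewrite -downsE; apply: leq_trans (sumn_bpart mu).
  rewrite -(sum_bpart_nth _ (leqnSn B)); apply: leq_sum => i _; rewrite /downf.
  have := hmu i; have := hnu i; have := hmu i.+1; have := hnu i.+1; lia.
split => //; apply: (nth_bpart_of (L := B.+1)) => // [|j Bj].
  apply: homo_leq => // [y x z xy yz|i]; first exact: leq_trans yz xy.
  rewrite /downf; have := hmu i; have := hnu i; have := hmu i.+1; have := hnu i.+1.
  have := hmu i.+2; have := hnu i.+2; lia.
by rewrite /downf !bpart_nth0 //; lia.
Qed.

Let upP ka : down ka -> forall i, (goup ka)`_[i] = upf ka i.
Proof.
move=> /and3P[/hstripP hmu /hstripP hnu le].
apply: (nth_bpart_of (L := B.+2)) => // [|j Bj|].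
- apply: homo_leq => // [y x z xy yz|i]; first exact: leq_trans yz xy.
  rewrite /upf; case: i => [|i]; have := hmu 0%N; have := hnu 0%N.
    lia.
  have := hmu i; have := hnu i; have := hmu i.+1; have := hnu i.+1; lia.
- by case: j Bj => // j Bj; rewrite /upf !bpart_nth0 //; lia.
rewrite big_nat_recl //=.
have key : (\sum_(0 <= i < B.+1) upf ka i.+1 + sumn ka + mx 0 = sumn mu + sumn nu)%N.
  rewrite -summnmx; congr (_ + _)%N; rewrite -(sum_bpart_nth _ (leqnSn B)).
  rewrite -big_split /=; apply: eq_bigr => i _; rewrite subnK //.
  have := hmu i; have := hnu i; lia.
move: key le => /=; lia.
Qed.

Let upK ka : down ka -> up (goup ka) /\ godown (goup ka) = ka.
Proof.
move=> hd; have nthu := upP hd; move: hd => /and3P[/hstripP hmu /hstripP hnu le].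
have hup : up (goup ka).
  apply/and3P; split; first by rewrite sumn_bpart_of.
    apply/hstripP => i; rewrite !nthu /upf; case: i => [|i].
      have := hmu 0%N; have := hnu 0%N; lia.
    have := hmu i; have := hnu i; have := hmu i.+1; have := hnu i.+1; lia.
  apply/hstripP => i; rewrite !nthu /upf; case: i => [|i].
    have := hmu 0%N; have := hnu 0%N; lia.
  have := hmu i; have := hnu i; have := hmu i.+1; have := hnu i.+1; lia.
split => //; apply: bpart_ext => i.
have [_ ->] := downP hup; rewrite /downf nthu /upf.
have := hmu i; have := hnu i; have := hmu i.+1; have := hnu i.+1; lia.
Qed.

Let downK lam : up lam -> down (godown lam) /\ goup (godown lam) = lam.
Proof.
move=> hu; have [szB nthd] := downP hu.
move: hu => /and3P[/sumM lamM /hstripP hmu /hstripP hnu].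
have lam0 : (lam`_[0] <= M)%N by rewrite lamM leq_addr.
have mx0 : (mx 0 <= lam`_[0])%N by have := hmu 0%N; have := hnu 0%N; lia.
have key : (sumn mu + sumn nu + lam`_[0] >= mx 0 + M)%N.
  rewrite -summnmx.
  suff : (M - lam`_[0] <= \sum_(0 <= i < B.+1) (mn i + mx i.+1))%N by lia.
  rewrite lamM addKn; apply: leq_sum => i _; have := hmu i; have := hnu i; lia.
have hdown : down (godown lam).
  apply/and3P; split.
  - apply/hstripP => i; rewrite !nthd /downf.
    have := hmu i; have := hnu i; have := hmu i.+1; have := hnu i.+1; lia.
  - apply/hstripP => i; rewrite !nthd /downf.
    have := hmu i; have := hnu i; have := hmu i.+1; have := hnu i.+1; lia.
  - rewrite sumn_bpart_of // /downs; lia.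
split => //; apply: bpart_ext => i; rewrite upP //.
rewrite /upf; case: i => [|i].
  rewrite sumn_bpart_of // /downs; lia.
rewrite nthd /downf; have := hmu i; have := hnu i; lia.
Qed.

(* Each part lam_(i+1) and each part ka_i varies in the same interval, from
   max(mu_(i+1), nu_(i+1)) to min(mu_i, nu_i), which we reverse; lam_0 is free
   above max(mu_0, nu_0). *)
Lemma local_rule :
  #|[pred lam : bpart B | [&& sumn lam == M, hstrip mu lam & hstrip nu lam]]| =
  #|[pred ka : bpart B | [&& hstrip ka mu, hstrip ka nu
                         & (sumn mu + sumn nu <= M + sumn ka)%N]]|.
Proof.
rewrite -!sum1_card (reindex_onto goup godown) /=; last first.
  by move=> lam /downK[_ ->].
apply: eq_bigl => ka; apply/andP/idP => [[hu /eqP <-]|hd].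
  by have [] := downK hu.
by have [h1 h2] := upK hd; split=> //; apply/eqP.
Qed.

End LocalRule.

(** * Pieri's rule and Cauchy's identity *)

Section CoefProd.
Variable A : comNzRingType.

Lemma coef_prod_eq (I : Type) (s : seq I) (Q Q' : I -> {poly A}) n :
  (forall i j, (j <= n)%N -> (Q i)`_j = (Q' i)`_j) ->
  forall j, (j <= n)%N -> (\prod_(i <- s) Q i)`_j = (\prod_(i <- s) Q' i)`_j.
Proof.
move=> QQ'; elim: s => [|i s IH] j jn; first by rewrite !big_nil.
rewrite !big_cons !coefM; apply: eq_bigr => k _.
by rewrite QQ' ?IH // ?(leq_trans (leq_subr _ _)) // (leq_trans _ jn) // -ltnS.
Qed.

Lemma coef_prod (I : finType) (Q : I -> {poly A}) n :
  (\prod_i Q i)`_n =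
  \sum_(m : {ffun I -> 'I_n.+1} | (\sum_i m i == n)%N) \prod_i (Q i)`_(m i).
Proof.
(* Degrees above n cannot contribute, so each factor is cut off at degree n and the product
   distributes over finitely many exponents. *)
rewrite (coef_prod_eq (Q' := fun i => \sum_(j < n.+1) (Q i)`_j *: 'X^j) _ _ (leqnn n)).
  rewrite bigA_distr_bigA coef_sum [RHS]big_mkcond; apply: eq_bigr => m _ /=.
  rewrite (eq_bigr (fun i => ((Q i)`_(m i))%:P * 'X^(m i))) => [|i _]; last by rewrite mul_polyC.
  rewrite big_split /= -(big_morph _ (fun a b : A => polyCM a b) (erefl _)).
  rewrite prodrXr coefCM coefXn eq_sym.
  by case: eqP => _; rewrite ?mulr1 ?mulr0.
move=> i j jn; rewrite coef_sum (bigD1 (Ordinal (n := n.+1) (m := j) jn)) //=.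
rewrite coefZ coefXn eqxx mulr1 big1 ?addr0 // => k kj.
rewrite coefZ coefXn; case: eqP => [e|_]; rewrite ?mulr0 //.
by case/negP: kj; apply/eqP/val_inj.
Qed.

End CoefProd.

Section Homogeneous.
Variable A : comNzRingType.

(** The complete homogeneous symmetric polynomial h_n at the family z. Exponents are bounded by n so
    that they range over a finite type. *)
Definition hom_fam (I : finType) (z : I -> A) (n : nat) : A :=
  \sum_(m : {ffun I -> 'I_n.+1} | (\sum_i m i == n)%N) \prod_i z i ^+ m i.

(** The series 1/(1 - a t) cut off after degree B, hence correct in every degree up to B. *)
Definition geo B (a : A) : {poly A} := \poly_(j < B.+1) a ^+ j.

Lemma hom_famE B I z n : (n <= B)%N -> @hom_fam I z n = (\prod_i geo B (z i))`_n.
Proof.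
move=> nB; rewrite coef_prod; apply: eq_bigr => m _; apply: eq_bigr => i _.
by rewrite coef_poly ltnS (leq_trans _ nB) // -ltnS.
Qed.

Lemma hom_famZ I (c : A) z n : @hom_fam I (fun i => z i * c) n = hom_fam z n * c ^+ n.
Proof.
rewrite /hom_fam mulr_suml; apply: eq_bigr => m /eqP mn.
under eq_bigr do rewrite exprMn.
by rewrite big_split prodrXr mn.
Qed.

Variable B : nat.
Implicit Types (x y : nat -> A) (N r : nat).

(** The branching rule: in a semistandard tableau the cells with the largest value form a horizontal
    strip, whose size is the exponent of the last variable. *)
Fixpoint schurx x N (lam : seq nat) : A :=
  if N is N'.+1 then
    \sum_(mu : bpart B | hstrip mu lam) schurx x N' mu * x N' ^+ (sumn lam - sumn mu)
  else (sumn lam == 0%N)%:R.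

Fixpoint homx x N r : A :=
  if N is N'.+1 then \sum_(j < r.+1) homx x N' (r - j) * x N' ^+ j else (r == 0%N)%:R.

Lemma homxE x N r : (r <= B)%N -> homx x N r = (\prod_(i < N) geo B (x i))`_r.
Proof.
elim: N r => [|N IH] r rB; first by rewrite big_ord0 coef1.
rewrite big_ord_recr /= coefMr; apply: eq_bigr => j _.
rewrite IH ?(leq_trans (leq_subr _ _)) // coef_poly ltnS.
by rewrite (leq_trans _ rB) // -ltnS.
Qed.

Lemma sumn0_bpart (lam mu : bpart B) : sumn lam = 0%N -> sumn mu = 0%N -> lam = mu.
Proof.
move=> l0 m0; apply: bpart_ext => i.
have nth0 (p : bpart B) : sumn p = 0%N -> p`_[i] = 0%N.
  move=> p0; apply/eqP; rewrite -leqn0 -[X in (_ <= X)%N]p0.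
  rewrite -(sum_bpart_nth p (leq_addr i.+1 B)).
  by rewrite big_mkord (bigD1 (Ordinal (leq_addl B i.+1))) //=; exact: leq_addr.
by rewrite !nth0.
Qed.

(** Induction on N. When the last variable is split off on the right, the coefficient of s_nu x_N^(M
    - |nu|) counts the lam of size M above both mu and nu. On the left it is split off both factors,
    and by induction the coefficient counts the ka below both. [local_rule] equates the two
    counts. *)
Lemma pieri x N r (mu : bpart B) : (sumn mu + r <= B)%N ->
  homx x N r * schurx x N mu =
  \sum_(lam : bpart B | hstrip mu lam && (sumn lam == sumn mu + r)%N) schurx x N lam.
Proof.
elim: N r mu => [|N IH] r mu murB /=.
  have [-> | r0] := eqVneq r 0%N; last first.
    rewrite mul0r big1 // => lam /andP[_ /eqP ->].
    by rewrite addn_eq0 (negPf r0) andbF.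
  rewrite mul1r addn0; have [mu0|mu0] := eqVneq (sumn mu) 0%N; last first.
    by rewrite big1 // => lam /andP[_ /eqP ->]; rewrite (negPf mu0).
  rewrite (big_pred1 mu) ?mu0 // => lam /=; apply/andP/eqP => [[_ /eqP l0]|->].
    exact: sumn0_bpart.
  split; last by rewrite mu0.
  apply/hstripP => i; split => //; exact: bpart_noninc.
set M := (sumn mu + r)%N.
transitivity (\sum_(nu : bpart B) (schurx x N nu * x N ^+ (M - sumn nu)) *+
  #|[pred ka : bpart B | [&& hstrip ka mu, hstrip ka nu
                         & (sumn mu + sumn nu <= M + sumn ka)%N]]|); last first.
  rewrite (exchange_big_dep xpredT) //=; apply: eq_bigr => nu _.
  rewrite -(local_rule _ _ murB) -sumr_const; apply: esym; apply: eq_big => [lam|lam].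
    by rewrite inE; do 2!case: (hstrip _ lam); rewrite ?andbT ?andbF.
  by case/andP=> /andP[_ /eqP ->].
rewrite big_distrl /=.
transitivity (\sum_(ka : bpart B | hstrip ka mu) \sum_(nu : bpart B |
   hstrip ka nu && (sumn mu + sumn nu <= M + sumn ka)%N)
   schurx x N nu * x N ^+ (M - sumn nu)); last first.
  rewrite (exchange_big_dep xpredT) //=; apply: eq_bigr => nu _.
  by rewrite -sumr_const; apply: eq_bigl => ka; rewrite inE andbA.
under eq_bigr do rewrite big_distrr /=.
rewrite exchange_big /=; apply: eq_bigr => ka kamu; have lekamu := hstrip_sumn kamu.
transitivity (\sum_(a < r.+1) \sum_(nu : bpart B |
    hstrip ka nu && (sumn nu == sumn ka + (r - a))%N) schurx x N nu * x N ^+ (M - sumn nu)).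
  apply: eq_bigr => a _; have ar : (a <= r)%N by rewrite -ltnS.
  rewrite mulrACA -exprD IH; last by move: murB; rewrite /M; lia.
  rewrite big_distrl /=; apply: eq_bigr => nu /andP[kanu /eqP ->].
  by congr (_ * _ ^+ _); rewrite /M; lia.
rewrite (exchange_big_dep (fun nu : bpart B => hstrip ka nu && (sumn mu + sumn nu <= M + sumn ka)%N)) /=.
  apply: eq_bigr => nu /andP[kanu le]; have lekanu := hstrip_sumn kanu.
  (* The power a of the last variable taken from h_r is forced by |nu| = |ka| + (r - a); the
     inequality of the local rule says that it is nonnegative. *)
  rewrite (big_pred1 (inord (sumn ka + r - sumn nu))) // => a /=; rewrite kanu /=.
  have ar : (a <= r)%N by rewrite -ltnS.
  rewrite -val_eqE /= inordK; first by apply/eqP/eqP; move: le; rewrite /M; lia.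
  by move: le; rewrite /M; lia.
move=> a nu _ /andP[-> /eqP ->] /=; rewrite /M; lia.
Qed.

(** Induction on M. Branching removes the last y-variable from s_lam(y); Pieri's rule, read
    backwards, sums s_lam(x) over the strips lam/ka to h(x) s_ka(x). With its power of y_M, this
    h(x) is a coefficient of the new factor prod_i 1/(1 - x_i y_M t). *)
Theorem cauchy x y N M n : (n <= B)%N ->
  \sum_(lam : bpart B | sumn lam == n) schurx x N lam * schurx y M lam =
  hom_fam (fun ij : 'I_N * 'I_M => x ij.1 * y ij.2) n.
Proof.
move=> nB; rewrite (hom_famE _ nB) -(pair_big xpredT xpredT (fun (i : 'I_N) (j : 'I_M) => geo B (x i * y j))) /=.
rewrite exchange_big /=; elim: M n nB => [|M IH] n nB.
  rewrite big_ord0 coef1 /=.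
  under eq_bigr => lam /eqP -> do [].
  have [n0|n0] := eqVneq n 0%N; last by rewrite big1 // => *; rewrite mulr0.
  under eq_bigr do rewrite mulr1.
  have p0s : sumn (bpart_of B 0 (fun=> 0%N)) = 0%N by rewrite sumn_bpart_of.
  rewrite (big_pred1 (bpart_of B 0 (fun=> 0%N))) => [|lam /=]; last first.
    apply/eqP/eqP => [|->]; rewrite n0 // => l0; exact: sumn0_bpart.
  elim: N => [|N IH] /=; first by rewrite p0s.
  rewrite (big_pred1 (bpart_of B 0 (fun=> 0%N))) ?subnn ?mulr1 // => ka.
  apply/idP/eqP => [/hstrip_sumn|->]; rewrite ?p0s.
    by rewrite leqn0 => /eqP ?; apply: sumn0_bpart.
  by apply/hstripP => i; split=> //; apply: bpart_noninc.
rewrite big_ord_recr /= coefM.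
transitivity (\sum_(ka : bpart B | (sumn ka <= n)%N) schurx x N ka * schurx y M ka *
   (homx (fun i => x i * y M) N (n - sumn ka))).
  under eq_bigr do rewrite big_distrr /=.
  rewrite (exchange_big_dep (fun ka : bpart B => (sumn ka <= n)%N)) /=; last first.
    by move=> lam ka /eqP <- /hstrip_sumn.
  apply: eq_bigr => ka kan.
  have hE : homx (fun i => x i * y M) N (n - sumn ka) =
            homx x N (n - sumn ka) * y M ^+ (n - sumn ka).
    rewrite !homxE ?(leq_trans (leq_subr _ _)) // -!hom_famE ?(leq_trans (leq_subr _ _)) //.
    exact: hom_famZ.
  rewrite hE mulrACA -[in RHS](mulrC (homx _ _ _)) pieri ?subnKC //.
  rewrite big_distrl /=; apply: eq_big => [lam|lam /andP[/eqP -> _]]; first by rewrite andbC.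
  by [].
rewrite (eq_bigr (fun j : 'I_n.+1 => \sum_(ka : bpart B | sumn ka == j)
    schurx x N ka * schurx y M ka * homx (fun i => x i * y M) N (n - j))); last first.
  move=> j _; rewrite -big_distrl /= IH ?(leq_trans _ nB) -1?ltnS // homxE //.
  by rewrite (leq_trans (leq_subr _ _)).
rewrite (exchange_big_dep (fun ka : bpart B => (sumn ka <= n)%N)) /=; last first.
  by move=> j ka _ /eqP ->; rewrite -ltnS.
apply: eq_bigr => ka kan; rewrite (big_pred1 (inord (sumn ka))) ?inordK //.
by move=> j /=; rewrite -val_eqE /= inordK // eq_sym.
Qed.

End Homogeneous.

(** * Schur polynomials by horizontal strips *)

Section Cells.
Variable sh : seq nat.

Lemma cell_size i j : (j < sh`_[i])%N -> (i < size sh)%N.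
Proof. by move=> ji; rewrite ltnNge; apply: contraL ji => /(nth_default 0%N) ->. Qed.

Definition mkcell i j (ji : (j < sh`_[i])%N) : cell sh :=
  existT (fun i : 'I_(size sh) => 'I_(sh`_[i])) (Ordinal (cell_size ji)) (Ordinal ji).

Lemma cell_ext (c c' : cell sh) :
  tag c = tag c' :> nat -> tagged c = tagged c' :> nat -> c = c'.
Proof.
case: c c' => [i j] [i' j'] /= /val_inj e; case: i' / e j' => j' /= /val_inj ->.
by [].
Qed.

Lemma cellP (c : cell sh) : (tagged c < sh`_[tag c])%N.
Proof. exact: ltn_ord. Qed.

Lemma card_cell : #|{: cell sh}| = sumn sh.
Proof.
rewrite card_tagged sumnE big_map big_enum /= sumnE (big_nth 0%N) big_mkord.
by apply: eq_bigr => i _; rewrite card_ord.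
Qed.

Lemma semistandardP N (T : {ffun cell sh -> 'I_N}) (sorts : sorted geq sh) :
  reflect ((forall i j j' (h : (j < sh`_[i])%N) (h' : (j' < sh`_[i])%N), (j <= j')%N ->
              (T (mkcell h) <= T (mkcell h'))%N) /\
           (forall i i' j (h : (j < sh`_[i])%N) (h' : (j < sh`_[i'])%N), (i < i')%N ->
              (T (mkcell h) < T (mkcell h'))%N))
    (semistandard T).
Proof.
apply: (iffP forallP) => [H|[Hr Hc] c].
  split=> [i j j' h h'|i i' j h h' ii'].
    rewrite leq_eqVlt => /orP[/eqP e|jj'].
      by rewrite (_ : mkcell h = mkcell h') //; apply: cell_ext.
    have /andP[/implyP + _] := forallP (H (mkcell h)) (mkcell h').
    by apply; rewrite -val_eqE /= eqxx.
  have /andP[_ /implyP] := forallP (H (mkcell h)) (mkcell h').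
  by apply; rewrite /= eqxx.
have mkE (c0 : cell sh) : c0 = mkcell (cellP c0) by apply: cell_ext.
apply/forallP => c'; apply/andP; split; apply/implyP => /andP[/eqP e lt].
  have h' : (tagged c' < sh`_[tag c])%N by rewrite e cellP.
  rewrite (mkE c) (_ : c' = mkcell h'); last by apply: cell_ext; rewrite //= e.
  by apply: Hr; apply: ltnW.
have h' : (tagged c < sh`_[tag c'])%N by rewrite e cellP.
rewrite (mkE c) (_ : c' = mkcell h'); last by apply: cell_ext; rewrite //= e.
exact: Hc.
Qed.

End Cells.

Section SchurRec.
Variables (A : comNzRingType) (x : nat -> A) (B M : nat).

(** The alphabet 'I_M.+1 is fixed and the entries are bounded by N, so that the recursion on N does
    not change the type of the tableaux. *)
Definition schurT N (sh : seq nat) : A :=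
  \sum_(T : {ffun cell sh -> 'I_M.+1} | semistandard T && [forall c, (T c < N)%N])
     \prod_c x (T c).

Section Step.
Variables (N : nat) (NM : (N < M.+1)%N) (sh : bpart B).

Let shs : sorted geq sh.
Proof. by have /is_part_ofP[] := bpartP sh. Qed.

Section Inner.
Variable T : {ffun cell sh -> 'I_M.+1}.

Definition below i j := [exists c : cell sh, [&& tag c == i :> nat, tagged c == j :> nat & (T c < N)%N]].

Lemma belowE i j (h : (j < sh`_[i])%N) : below i j = (T (mkcell h) < N)%N.
Proof.
apply/existsP/idP => [[c /and3P[/eqP ci /eqP cj]]|lt].
  by rewrite (_ : c = mkcell h) //; apply: cell_ext.
by exists (mkcell h); rewrite !eqxx.
Qed.

Lemma below_shape i j : below i j -> (j < sh`_[i])%N.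
Proof. by move/existsP => [c /and3P[/eqP <- /eqP <- _]]; apply: cellP. Qed.

(** Rows increase weakly, so the entries below N form an initial segment of row i; this is its
    length. *)
Definition inner_row i := find (fun j => ~~ below i j) (iota 0 B.+1).

Hypothesis sstT : semistandard T.
Hypothesis leT : forall c, (T c <= N)%N.

Lemma below_inner_row i j : below i j = (j < inner_row i)%N.
Proof.
have [Hr Hc] := semistandardP _ shs sstT.
have shB : (sh`_[i] <= B)%N.
  apply: leq_trans (sumn_bpart sh).
  rewrite -(sum_bpart_nth sh (leq_addr i.+1 B)) big_mkord.
  by rewrite (bigD1 (Ordinal (leq_addl B i.+1))) //=; apply: leq_addr.
apply/idP/idP => [bij|lt].
  rewrite ltnNge; apply/negP => le.
  have hh : has (fun j => ~~ below i j) (iota 0 B.+1).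
    rewrite has_find (leq_ltn_trans le) // size_iota ltnS.
    by apply: leq_trans (ltnW (below_shape bij)) shB.
  have := nth_find 0%N hh; rewrite nth_iota; last by move: hh; rewrite has_find size_iota.
  rewrite add0n -/(inner_row i) => /negP; apply.
  have h := below_shape bij; have h' := leq_ltn_trans le h.
  by rewrite (belowE h'); rewrite (belowE h) in bij; apply: leq_ltn_trans bij; apply: Hr.
have ltB : (j < B.+1)%N.
  by apply: leq_trans lt _; rewrite -[X in (_ <= X)%N](size_iota 0 B.+1) find_size.
by have := before_find 0%N lt; rewrite nth_iota // add0n => /negbFE.
Qed.

Lemma inner_row_le i : (inner_row i <= sh`_[i])%N.
Proof.
rewrite leqNgt; apply/negP => lt; rewrite -below_inner_row in lt.
by have := below_shape lt; rewrite ltnn.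
Qed.

(** An entry of row i+1 is at most N, so by strictness in columns the entry above it is smaller than
    N. *)
Lemma inner_row_ge i : (sh`_[i.+1] <= inner_row i)%N.
Proof.
have [Hr Hc] := semistandardP _ shs sstT.
case e: (sh`_[i.+1]) => [|j] //; have h : (j < sh`_[i.+1])%N by rewrite e.
rewrite -below_inner_row; have h' := leq_trans h (bpart_noninc sh (leqnSn i)).
by rewrite (belowE h'); apply: leq_trans (leT (mkcell h)); apply: Hc.
Qed.

Definition inner_size := (\sum_(0 <= i < B) inner_row i)%N.

Definition inner : bpart B := bpart_of B inner_size inner_row.

Lemma nth_inner i : inner`_[i] = inner_row i.
Proof.
apply: (nth_bpart_of (L := B)) => [||j Bj|//].
- apply: leq_trans (sumn_bpart sh); rewrite -(sum_bpart_nth sh (leqnn B)).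
  by apply: leq_sum => k _; apply: inner_row_le.
- apply: homo_leq => // [y u z uy zy|k']; first exact: leq_trans zy uy.
  exact: leq_trans (inner_row_le _) (inner_row_ge _).
- by apply/eqP; rewrite -leqn0 -(bpart_nth0 sh Bj) inner_row_le.
Qed.

Lemma hstrip_inner : hstrip inner sh.
Proof. by apply/hstripP => i; rewrite nth_inner inner_row_le inner_row_ge. Qed.

Lemma inner_ltE c : (T c < N)%N = (tagged c < inner`_[tag c])%N.
Proof.
rewrite nth_inner -below_inner_row (belowE (cellP c)).
by congr (T _ < _)%N; apply: cell_ext.
Qed.

Lemma innerE (mu : bpart B) : hstrip mu sh ->
  (forall c, (T c < N)%N = (tagged c < mu`_[tag c])%N) -> inner = mu.
Proof.
move=> /hstripP hs h; apply: bpart_ext => i; rewrite nth_inner.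
have key j : (j < inner_row i)%N = (j < mu`_[i])%N.
  rewrite -below_inner_row; have [lt|ge] := ltnP j (sh`_[i]).
    by rewrite (belowE lt) h.
  have [_ le] := hs i; rewrite [RHS]ltnNge (leq_trans le ge) /=.
  by apply/negbTE/negP => b; have := below_shape b; rewrite ltnNge ge.
apply/eqP; rewrite eqn_leq; apply/andP; split.
  by rewrite leqNgt key ltnn.
by rewrite leqNgt -key ltnn.
Qed.

End Inner.

Section Extend.
Variables (mu : bpart B) (musub : hstrip mu sh).

Let mus : sorted geq mu.
Proof. by have /is_part_ofP[] := bpartP mu. Qed.

Let le_mu i : (mu`_[i] <= sh`_[i])%N.
Proof. by have /hstripP/(_ i)[] := musub. Qed.

Definition cell_emb (c : cell mu) : cell sh :=
  mkcell (leq_trans (cellP c) (le_mu (tag c))).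

Definition tab_extend (T : {ffun cell mu -> 'I_M.+1}) : {ffun cell sh -> 'I_M.+1} :=
  [ffun c : cell sh => if ltnP (tagged c) (mu`_[tag c]) is LtnNotGeq h then T (mkcell h) else inord N].

Definition tab_restrict (T : {ffun cell sh -> 'I_M.+1}) : {ffun cell mu -> 'I_M.+1} :=
  [ffun c : cell mu => T (cell_emb c)].

Lemma tab_extend_in T i j (h : (j < mu`_[i])%N) (h' : (j < sh`_[i])%N) :
  tab_extend T (mkcell h') = T (mkcell h).
Proof.
rewrite ffunE; case: ltnP => [h0|]; first by congr (T _); apply: cell_ext.
by rewrite /= leqNgt h.
Qed.

Lemma tab_extend_out T (c : cell sh) : (mu`_[tag c] <= tagged c)%N -> tab_extend T c = inord N.
Proof. by move=> le; rewrite ffunE; case: ltnP => // h; have := h; rewrite ltnNge le. Qed.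

Lemma tab_extendK : cancel tab_extend tab_restrict.
Proof.
move=> T; apply/ffunP => c; rewrite ffunE (tab_extend_in _ (cellP c)).
by congr (T _); apply: cell_ext.
Qed.

Lemma prod_tab_extend T :
  \prod_c x (tab_extend T c) = \prod_c x (T c) * x N ^+ (sumn sh - sumn mu).
Proof.
have embI : injective cell_emb.
  by move=> c c' e; apply: cell_ext; [have := congr1 (fun c : cell sh => tag c : nat) e
    | have := congr1 (fun c : cell sh => tagged c : nat) e].
rewrite (bigID (fun c : cell sh => tagged c < mu`_[tag c])%N) /=.
have memE (c : cell sh) : (tagged c < mu`_[tag c])%N = (c \in codom cell_emb).
  apply/idP/codomP => [lt|[c' ->]]; last exact: cellP.
  by exists (mkcell lt); apply: cell_ext.
congr (_ * _).
  under eq_bigl do rewrite memE.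
  rewrite -big_uniq /=; last by rewrite map_inj_uniq ?enum_uniq.
  rewrite big_map big_enum /=; apply: eq_bigr => c _.
  rewrite (tab_extend_in _ (cellP c)); congr (x (T _)); exact: cell_ext.
rewrite (eq_bigr (fun=> x N)) => [|c]; last first.
  by rewrite -leqNgt => /tab_extend_out ->; rewrite inordK.
rewrite prodr_const; congr (_ ^+ _).
have e : #|[pred c in codom cell_emb]| = sumn mu.
  by rewrite -(card_cell mu) -(card_codom embI); apply: eq_card.
rewrite -(card_cell sh) -(cardC [pred c in codom cell_emb]) e addKn.
by apply: eq_card => c; rewrite !inE -memE.
Qed.

Lemma tab_extendP T (T' := tab_extend T) :
  (semistandard T' && [forall c, (T' c < N.+1)%N]) && (inner T' == mu) =
  semistandard T && [forall c, (T c < N)%N].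
Proof.
apply/idP/idP => [/andP[/andP[sst /forallP le] /eqP e]|/andP[sst /forallP lt]].
  have [Hr Hc] := semistandardP _ shs sst.
  apply/andP; split.
    apply/(semistandardP _ mus); split=> [i j j' h h' jj'|i i' j h h' ii'].
      rewrite -(tab_extend_in T h (leq_trans h (le_mu _))).
      by rewrite -(tab_extend_in T h' (leq_trans h' (le_mu _))); apply: Hr.
    rewrite -(tab_extend_in T h (leq_trans h (le_mu _))).
    by rewrite -(tab_extend_in T h' (leq_trans h' (le_mu _))); apply: Hc.
  apply/forallP => c; have -> : c = mkcell (cellP c) by apply: cell_ext.
  rewrite -(tab_extend_in T (cellP c) (leq_trans (cellP c) (le_mu _))).
  by rewrite (inner_ltE sst) // e; apply: (cellP c).
have [Hr Hc] := semistandardP _ mus sst.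
have sst' : semistandard T'.
  apply/(semistandardP _ shs); split=> [i j j' h h' jj'|i i' j h h' ii'].
    have [lt'|ge'] := ltnP j' mu`_[i].
      by rewrite (tab_extend_in T (leq_ltn_trans jj' lt')) (tab_extend_in T lt'); apply: Hr.
    rewrite [T' (mkcell h')]tab_extend_out // inordK //.
    have [lt0|ge0] := ltnP j mu`_[i].
      by rewrite (tab_extend_in T lt0) ltnW.
    by rewrite [T' _]tab_extend_out // inordK.
  (* By interlacing, a cell of [sh] with another cell below it already lies in [mu], so no column
     receives the value N twice. *)
  have lt0 : (j < mu`_[i])%N.
    have /hstripP/(_ i)[le _] := musub; apply: leq_trans le.
    exact: leq_trans h' (bpart_noninc sh ii').
  have [lt'|ge'] := ltnP j mu`_[i'].
    by rewrite (tab_extend_in T lt0) (tab_extend_in T lt'); apply: Hc.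
  by rewrite [T' (mkcell h')]tab_extend_out // inordK // (tab_extend_in T lt0).
have leT' c : (T' c <= N)%N.
  have [h|h] := ltnP (tagged c) mu`_[tag c]; last by rewrite [T' _]tab_extend_out // inordK.
  rewrite (_ : c = mkcell (cellP c)); last by apply: cell_ext.
  by rewrite (tab_extend_in T h) ltnW.
rewrite sst' /=; apply/andP; split; first by apply/forallP.
apply/eqP/innerE => // c.
have [h|h] := ltnP (tagged c) mu`_[tag c]; last by rewrite [T' _]tab_extend_out // inordK // ltnn.
rewrite (_ : c = mkcell (cellP c)); last by apply: cell_ext.
by rewrite (tab_extend_in T h) lt.
Qed.

Lemma tab_restrictK T : semistandard T && [forall c, (T c < N.+1)%N] ->
  inner T = mu -> tab_extend (tab_restrict T) = T.
Proof.
case/andP=> sst /forallP le e; apply/ffunP => c.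
have [h|h] := ltnP (tagged c) mu`_[tag c].
  have {2}-> : c = mkcell (cellP c) by apply: cell_ext.
  rewrite {1}(_ : c = mkcell (cellP c)); last by apply: cell_ext.
  by rewrite (tab_extend_in _ h) ffunE; congr (T _); apply: cell_ext.
rewrite tab_extend_out //; apply/val_inj; rewrite /= inordK //.
apply/eqP; rewrite eqn_leq; apply/andP; split; last exact: le.
by rewrite leqNgt (inner_ltE sst) // e -leqNgt.
Qed.

End Extend.

(** Tableaux are grouped by the shape of their entries below N; [tab_extend] restores them by
    filling the strip with N. *)
Lemma schurT_rec : schurT N.+1 sh =
  \sum_(mu : bpart B | hstrip mu sh) schurT N mu * x N ^+ (sumn sh - sumn mu).
Proof.
rewrite /schurT (partition_big inner (fun mu : bpart B => hstrip mu sh)) /=; last first.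
  by move=> T /andP[sst /forallP le]; apply: hstrip_inner.
apply: eq_bigr => mu musub; rewrite big_distrl /=.
rewrite (reindex_onto (@tab_extend mu) (tab_restrict musub)) /=; last first.
  by move=> T /andP[h /eqP e]; apply: tab_restrictK.
apply: eq_big => [T|T _]; last exact: prod_tab_extend.
by rewrite tab_extendK eqxx andbT tab_extendP.
Qed.

End Step.

Lemma schurTE N (lam : bpart B) : (N <= M.+1)%N -> schurT N lam = schurx B x N lam.
Proof.
elim: N lam => [|N IH] lam NM /=; last first.
  by rewrite schurT_rec //; apply: eq_bigr => mu _; rewrite IH // ltnW.
rewrite -card_cell /schurT; have [l0|l0] := eqVneq #|{: cell lam}| 0%N.
  have none (c : cell lam) : False by have := card0_eq l0 c; rewrite inE.
  rewrite (big_pred1 [ffun=> ord0]) => [|T /=].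
    by rewrite big1 // => c; case: (none c).
  transitivity true; first by apply/andP; split; apply/forallP => c; case: (none c).
  by apply/esym/eqP/ffunP => c; case: (none c).
rewrite big_pred0 // => T; apply/negbTE; rewrite negb_and; apply/orP; right.
have /card_gt0P[c _] : (0 < #|{: cell lam}|)%N by rewrite lt0n.
by apply/forallPn; exists c.
Qed.

End SchurRec.

Lemma schur_evalE (A : comNzRingType) (x : nat -> A) N B (lam : bpart B) :
  \sum_(T : {ffun cell lam -> 'I_N} | semistandard T) \prod_c x (T c) = schurx B x N lam.
Proof.
(* [schurT] uses a nonempty alphabet, so N = 0 is treated apart. *)
case: N => [|M]; last first.
  rewrite -(schurTE x lam (leqnn M.+1)); apply: eq_bigl => T.
  by rewrite [X in _ && X](_ : _ = true) ?andbT //; apply/forallP.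
rewrite /= -card_cell; have [l0|l0] := eqVneq #|{: cell lam}| 0%N.
  have none (c : cell lam) : False by have := card0_eq l0 c; rewrite inE.
  have T0 : {ffun cell lam -> 'I_0} := [ffun c => match none c with end].
  rewrite (big_pred1 T0) => [|T /=]; first by rewrite big1 // => c; case: (none c).
  transitivity true; first by apply/forallP => c; case: (none c).
  by apply/esym/eqP/ffunP => c; case: (none c).
rewrite big1 // => T _; have /card_gt0P[c _] : (0 < #|{: cell lam}|)%N by rewrite lt0n.
by case: (T c).
Qed.

(** * Littlewood-Richardson expansions *)

Definition to_bpart B n (nB : (n <= B)%N) (p : 'P_n) : bpart B :=
  existT (fun j : 'I_B.+1 => 'P_j) (Ordinal (nB : (n < B.+1)%N)) p.

Lemma big_bpart (A : nmodType) B n (nB : (n <= B)%N) (G : bpart B -> A) :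
  \sum_(lam : bpart B | sumn lam == n) G lam = \sum_(p : 'P_n) G (to_bpart nB p).
Proof.
have sP (lam : bpart B) : is_part_of n lam -> sumn lam == n.
  by case/is_part_ofP => _ _ /eqP.
rewrite (reindex_onto (to_bpart nB) (fun lam : bpart B => insubd (part_default n) (lam : seq nat))) /=.
  apply: eq_bigl => p; rewrite sumn_part eqxx /=; apply/eqP/val_inj.
  by rewrite insubdK //; apply: (partsP p).
move=> lam /eqP lamn; apply: bpart_ext => i.
by rewrite /bparts /= [X in nth _ X](insubdK _ _) // -topredE /= -lamn bpartP.
Qed.

Section Expansion.
Variable B : nat.

Definition poly_family := forall (A : comNzRingType) (x : nat -> A) (N : nat), A.

(** The coefficients are chosen before the ring, the variables and N; this uniformity is what
    [LR_expansion] asks of them. *)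
Definition expands (d : nat) (f : poly_family) :=
  exists c : bpart B -> int, forall (A : comNzRingType) (x : nat -> A) (N : nat),
    f A x N = \sum_(lam : bpart B | sumn lam == d) schurx B x N lam *~ c lam.

Lemma expands_schur (lam : bpart B) :
  expands (sumn lam) (fun A x N => schurx B x N lam).
Proof.
exists (fun mu => (mu == lam)%:Z) => A x N.
rewrite (bigD1 lam) //= eqxx mulr1z big1 ?addr0 // => mu /andP[_ /negPf ->].
exact: mulr0z.
Qed.

Lemma expands_eq d f g : (forall A x N, f A x N = g A x N) -> expands d f -> expands d g.
Proof. by move=> fg [c cE]; exists c => A x N; rewrite -fg. Qed.

Lemma expands_sub d f g : expands d f -> expands d g ->
  expands d (fun A x N => f A x N - g A x N).
Proof.
move=> [c cE] [c' cE']; exists (fun lam => c lam - c' lam) => A x N.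
rewrite cE cE' -sumrB; apply: eq_bigr => lam _; by rewrite mulrzBr.
Qed.

Lemma expands_sum d (I : finType) (P : pred I) (f : I -> poly_family) :
  (forall i, P i -> expands d (f i)) -> expands d (fun A x N => \sum_(i | P i) f i A x N).
Proof.
move=> h; have /fin_all_exists[c cE] i : exists c : bpart B -> int, P i ->
    forall (A : comNzRingType) (x : nat -> A) (N : nat),
    f i A x N = \sum_(lam : bpart B | sumn lam == d) schurx B x N lam *~ c lam.
  by case Pi: (P i); [have [c cE] := h i Pi; exists c | exists (fun=> 0)].
exists (fun lam => \sum_(i | P i) c i lam) => A x N.
rewrite (eq_bigr _ (fun i Pi => cE i Pi A x N)) exchange_big /=.
apply: eq_bigr => lam _; elim/big_rec2: _ => [|i u v _ ->]; first by rewrite mulr0z.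
by rewrite mulrzDr.
Qed.

Lemma expands_scale d (k : int) f : expands d f -> expands d (fun A x N => f A x N *~ k).
Proof.
move=> [c cE]; exists (fun lam => c lam * k) => A x N; rewrite cE.
by rewrite mulrz_suml; apply: eq_bigr => lam _; rewrite mulrzA.
Qed.

Lemma expands_homx d r f : (d + r <= B)%N -> expands d f ->
  expands (d + r) (fun A x N => homx x N r * f A x N).
Proof.
move=> drB [c cE].
apply: (@expands_eq _ (fun A x N => \sum_(mu : bpart B | sumn mu == d)
   (\sum_(lam : bpart B | hstrip mu lam && (sumn lam == d + r)%N)
      schurx B x N lam) *~ c mu)).
  move=> A x N; rewrite cE mulr_sumr; apply: eq_bigr => mu /eqP mud.
  by rewrite mulrzAr pieri mud.
apply: expands_sum => mu _; apply: expands_scale; apply: expands_sum => lam.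
by case/andP => _ /eqP <-; apply: expands_schur.
Qed.

Lemma schurx0 (A : comNzRingType) (x : nat -> A) N (lam : bpart B) :
  sumn lam = 0%N -> schurx B x N lam = 1.
Proof.
elim: N lam => [|N IH] lam l0 /=; first by rewrite l0.
rewrite (big_pred1 lam) => [|mu]; first by rewrite IH // subnn mulr1.
apply/idP/eqP => [/hstrip_sumn|->]; last first.
  by apply/hstripP => i; split=> //; apply: bpart_noninc.
by rewrite l0 leqn0 => /eqP m0; apply: sumn0_bpart.
Qed.

(** Deleting the last row and moving boxes to earlier rows both lower this weight, on which the next
    induction runs. *)
Let weight (lam : bpart B) := (\sum_(0 <= i < B) i.+1 * lam`_[i])%N.

(* With mu obtained from tau by deleting the last row, of length r, Pieri's rule
   for h_r s_mu gives s_tau plus terms with boxes moved to earlier rows. *)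
Lemma expands_mul (tau : bpart B) d f : (d + sumn tau <= B)%N -> expands d f ->
  expands (d + sumn tau) (fun A x N => schurx B x N tau * f A x N).
Proof.
have [w] := ubnP (weight tau); elim: w tau d f => // w IH tau d f lew dB ef.
have [t0|t0] := eqVneq (sumn tau) 0%N.
  rewrite t0 addn0; apply: expands_eq ef => A x N; by rewrite schurx0 ?mul1r.
have sz : (0 < size tau)%N by case: (bparts tau) t0.
set l := (size tau).-1; have lsz : size tau = l.+1 by rewrite /l prednK.
set r := tau`_[l].
have tau0 : 0%N \notin (tau : seq nat) by have /is_part_ofP[] := bpartP tau.
have r0 : (0 < r)%N by rewrite lt0n nth_eq0_part // lsz ltnn.
have lB : (l < B)%N.
  rewrite ltnNge; apply/negP => Bl; move: r0; by rewrite /r (bpart_nth0 tau Bl).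
have nth_l i : (l < i)%N -> tau`_[i] = 0%N by move=> li; rewrite nth_default // lsz.
have sum_split (lam : bpart B) : (forall i, (l < i)%N -> lam`_[i] = 0%N) ->
    sumn lam = (\sum_(0 <= i < l) lam`_[i] + lam`_[l])%N.
  move=> h; rewrite -(sum_bpart_nth lam (leqnn B)) (big_cat_nat _ lB) //= big_nat_recr //=.
  rewrite [X in (_ + X)%N]big1_seq ?addn0 // => i /=; rewrite mem_index_iota => /andP[/h].
  by [].
set f_mu := fun i => if (i < l)%N then tau`_[i] else 0%N.
set mu := bpart_of B (sumn tau - r) f_mu.
have szmu : (sumn tau - r <= B)%N by rewrite (leq_trans (leq_subr _ _)) // sumn_bpart.
have nth_mu i : mu`_[i] = f_mu i.
  apply: (nth_bpart_of (L := l)) => //.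
  - apply: homo_leq => // [a b c ab cb|j]; first exact: leq_trans cb ab.
    rewrite /f_mu; have := bpart_noninc tau (leqnSn j).
    by case: ltnP => // h1; rewrite (ltnW h1).
  - by move=> j lj; rewrite /f_mu ltnNge lj.
  rewrite (sum_split tau nth_l) -/r addnK !big_nat; apply: eq_bigr => k /andP[_ kl].
  by rewrite /f_mu kl.
have rle : (r <= sumn tau)%N by rewrite (sum_split tau nth_l) leq_addl.
have smu : sumn mu = (sumn tau - r)%N by rewrite sumn_bpart_of.
have hmutau : hstrip mu tau.
  apply/hstripP => i; rewrite nth_mu /f_mu; case: ltnP => li.
    by split=> //; apply: bpart_noninc.
  by rewrite nth_l.
have emu : expands (d + sumn mu) (fun A x N => schurx B x N mu * f A x N).
  apply: IH => //; last by rewrite smu; move: dB rle; lia.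
  rewrite -ltnS (leq_trans _ lew) // ltnS /weight.
  rewrite !big_mkord (bigD1 (Ordinal lB)) //= [X in (_ < X)%N](bigD1 (Ordinal lB)) //=.
  rewrite nth_mu /f_mu ltnn muln0 add0n -/r -addn1 addnC leq_add //.
    by rewrite muln_gt0.
  by apply: leq_sum => i _; rewrite leq_mul2l nth_mu /f_mu; case: ifP => _; rewrite ?leqnn ?leq0n orbT.
apply: (@expands_eq _ (fun A x N => homx x N r * (schurx B x N mu * f A x N) -
   \sum_(lam : bpart B | (hstrip mu lam && (sumn lam == sumn tau)) && (lam != tau))
      schurx B x N lam * f A x N)).
  move=> A x N; rewrite mulrA pieri smu subnK ?sumn_bpart //.
  rewrite (bigD1 tau) /=; last by rewrite hmutau eqxx.
  by rewrite mulrDl mulr_suml addrK.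
apply: expands_sub.
  have -> : (d + sumn tau = d + sumn mu + r)%N by rewrite smu; move: rle; lia.
  by apply: expands_homx => //; rewrite smu; move: dB rle; lia.
suff key (lam : bpart B) : hstrip mu lam -> sumn lam = sumn tau -> lam != tau ->
    expands (d + sumn tau) (fun A x N => schurx B x N lam * f A x N).
  by apply: expands_sum => lam /andP[/andP[h /eqP s]]; apply: key.
move=> hmulam slam lamtau; rewrite -slam; apply: IH; rewrite ?slam //.
rewrite -ltnS (leq_trans _ lew) // ltnS.
have lam_ge i : (i < l)%N -> (tau`_[i] <= lam`_[i])%N.
  by move=> il; have /hstripP/(_ i)[_] := hmulam; rewrite nth_mu /f_mu il.
have lam_0 i : (l < i)%N -> lam`_[i] = 0%N.
  case: i => // i li; have /hstripP/(_ i)[+ _] := hmulam.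
  by rewrite nth_mu /f_mu (ltnNge i) (li : (l <= i)%N) leqn0 => /eqP.
(* The sizes agree and rows beyond l are empty, so if lam equalled tau in all rows before l, it
   would equal tau in row l as well. *)
have [i il lti] : exists2 i, (i < l)%N & (tau`_[i] < lam`_[i])%N.
  have [/existsP[j lt]|no] := boolP [exists j : 'I_l, (tau`_[j] < lam`_[j])%N].
    by exists j.
  exfalso; case/negP: lamtau; apply/eqP/bpart_ext.
  have eqi i : (i < l)%N -> lam`_[i] = tau`_[i].
    move=> il; apply/eqP; rewrite eqn_leq lam_ge // andbT leqNgt.
    by apply: contra no => lt; apply/existsP; exists (Ordinal il).
  move=> i; have [il|] := ltnP i l; first exact: eqi.
  rewrite leq_eqVlt => /orP[/eqP <-|li]; last by rewrite lam_0 ?nth_l.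
  apply: (@addnI (\sum_(0 <= i < l) tau`_[i])%N).
  rewrite -(sum_split tau nth_l) -slam (sum_split lam lam_0); congr (_ + _)%N.
  by rewrite !big_nat; apply: eq_bigr => j /andP[_ /eqi].
(* Among partitions of equal size with at most l+1 rows, a smaller weight means a larger sum of (l -
   j) la_j, and these sums can be compared row by row. *)
have wE (la : bpart B) : (forall i, (l < i)%N -> la`_[i] = 0%N) ->
    (weight la + \sum_(j < B) (l - j) * la`_[j] = l.+1 * sumn la)%N.
  move=> h; rewrite -(sum_bpart_nth la (leqnn B)) /weight !big_mkord -big_split /=.
  rewrite big_distrr /=; apply: eq_bigr => j _; rewrite -mulnDl.
  have [lj|jl] := ltnP l j; first by rewrite h // !muln0.
  by congr (_ * _)%N; rewrite addSn subnKC.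
suff : (\sum_(j < B) (l - j) * tau`_[j] < \sum_(j < B) (l - j) * lam`_[j])%N.
  have := wE lam lam_0; have := wE tau nth_l; rewrite slam; lia.
have iB : (i < B)%N := ltn_trans il lB.
rewrite (bigD1 (Ordinal iB)) //= [X in (_ < X)%N](bigD1 (Ordinal iB)) //=.
rewrite -addSn leq_add //; first by rewrite ltn_mul2l subn_gt0 il lti.
apply: leq_sum => j _; rewrite leq_mul2l; have [jl|lj] := ltnP j l.
  by rewrite lam_ge ?orbT.
by move: lj; rewrite -subn_eq0 => ->.
Qed.

End Expansion.

Lemma expands_prod m (a : 'I_m -> nat) (t : forall i, 'P_(a i)) B
    (aB : forall i, (a i <= B)%N) : (\sum_(i < m) a i <= B)%N ->
  expands B (\sum_(i < m) a i)
    (fun A x N => \prod_(i < m) schurx B x N (to_bpart (aB i) (t i))).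
Proof.
elim: m a t aB => [|m IH] a t aB sB.
  rewrite big_ord0; pose p := bpart_of B 0 (fun=> 0%N).
  have p0 : sumn p = 0%N by rewrite sumn_bpart_of.
  rewrite -{1}p0; apply: expands_eq (expands_schur p) => A x N.
  by rewrite big_ord0 schurx0.
have e : (\sum_(i < m.+1) a i = \sum_(i < m) a (lift ord0 i) + a ord0)%N.
  by rewrite big_ord_recl addnC.
have st : sumn (to_bpart (aB ord0) (t ord0)) = a ord0 by apply: sumn_part.
rewrite e in sB *; rewrite -st.
apply: expands_eq (expands_mul _ (IH _ (fun i => t (lift ord0 i)) (fun i => aB (lift ord0 i)) _)).
- by move=> A x N; rewrite [RHS]big_ord_recl.
- by rewrite st.
- by rewrite (leq_trans _ sB) // leq_addr.
Qed.

(** The variables as a sequence indexed by all natural numbers, with default 0, as [schurx]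
    expects. *)
Definition mvar (A : comNzRingType) n (i : nat) : {mpoly A[n]} :=
  if insub i is Some j then 'X_(j : 'I_n) else 0.

Lemma mvarE (A : comNzRingType) n (i : 'I_n) : mvar A n i = 'X_i.
Proof. by rewrite /mvar valK. Qed.

Lemma schurE N B n (nB : (n <= B)%N) (p : 'P_n) :
  schur N p = schurx B (mvar int N) N (to_bpart nB p).
Proof.
rewrite -schur_evalE /schur; apply: eq_bigr => T _; apply: eq_bigr => c _.
by rewrite mvarE.
Qed.

Lemma LR_coefP m (a : 'I_m -> nat) (t : forall i, 'P_(a i)) :
  LR_expansion (fun i => parts (t i)) (LR_coef (fun i => parts (t i))).
Proof.
suff h : exists c, LR_expansion (fun i => parts (t i)) c.
  exact: (epsilon_spec (inhabits (fun _ : seq nat => 0 : int)) _ h).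
set deg := (\sum_(i < m) sumn (t i))%N.
have degE : (\sum_(i < m) a i = deg)%N by apply: eq_bigr => i _; rewrite sumn_part.
have aB i : (a i <= deg)%N by rewrite -degE (bigD1 i) //=; apply: leq_addr.
have sB : (\sum_(i < m) a i <= deg)%N by rewrite degE.
have [c cE] := expands_prod t aB sB.
(* The value 0 off the partitions of [deg] secures the first clause of [LR_expansion]. *)
pose c' (nu : seq nat) : int :=
  if insub nu is Some p then c (to_bpart (leqnn deg) p) else 0.
exists c'; split => [nu nuP|N]; first by rewrite /c' insubN.
transitivity (\prod_(i < m) schurx deg (mvar int N) N (to_bpart (aB i) (t i))).
  by apply: eq_bigr => i _; rewrite -schurE.
rewrite cE degE (big_bpart (leqnn deg)); apply: eq_bigr => p _.
by rewrite -schurE /c' [insub _]valK -scaler_int intz.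
Qed.

Section LREval.
Variables (A : comNzRingType) (x : nat -> A) (N : nat).

Lemma schur_mmap B n (nB : (n <= B)%N) (p : 'P_n) :
  mmap intr (fun i : 'I_N => x i) (schur N p) = schurx B x N (to_bpart nB p).
Proof.
rewrite -schur_evalE rmorph_sum; apply: eq_bigr => T _ /=.
by rewrite rmorph_prod; apply: eq_bigr => c _ /=; rewrite mmapX mmap1U.
Qed.

(** The integral identity in N variables is pushed through the evaluation morphism 'X_i |-> x i. *)
Lemma LR_schurx B m (a : 'I_m -> nat) (t : forall i, 'P_(a i)) (aB : forall i, (a i <= B)%N)
    n (nB : (n <= B)%N) : (\sum_(i < m) a i)%N = n ->
  \prod_(i < m) schurx B x N (to_bpart (aB i) (t i)) =
  \sum_(nu : 'P_n) schurx B x N (to_bpart nB nu) *~ LR_coef (fun i => parts (t i)) nu.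
Proof.
move=> sa; have [_ /(_ N)] := LR_coefP t.
have -> : (\sum_(i < m) sumn (t i) = n)%N.
  by rewrite -sa; apply: eq_bigr => i _; rewrite sumn_part.
move/(congr1 (mmap intr (fun i : 'I_N => x i))); rewrite rmorph_prod rmorph_sum /= => e.
transitivity (\prod_(i < m) mmap intr (fun i : 'I_N => x i) (schur N (t i))).
  by apply: eq_bigr => i _; rewrite -schur_mmap.
rewrite e; apply: eq_bigr => nu _.
by rewrite mmapZ (schur_mmap nB) -mulrzl.
Qed.

End LREval.

(** * Kostka matrices and symmetry *)

Section Triangular.
Variables (T : finType) (rk : T -> nat) (R : comNzRingType) (K : T -> T -> R).
Hypothesis K1 : forall x, K x x = 1.
Hypothesis Ktri : forall y x, K y x != 0 -> y = x \/ (rk y < rk x)%N.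
Variable V : lmodType R.

Lemma tri_sum (v : T -> V) x :
  \sum_y K y x *: v y = v x + \sum_(y | (rk y < rk x)%N) K y x *: v y.
Proof.
rewrite (bigD1 x) //= K1 scale1r; congr (_ + _).
rewrite [LHS]big_mkcond [RHS]big_mkcond; apply: eq_bigr => y _.
have [->|yx] := eqVneq y x; first by rewrite ltnn.
have [K0|/Ktri[e|->//]] := eqVneq (K y x) 0; first by rewrite K0 scale0r if_same.
by rewrite e eqxx in yx.
Qed.

(** The diagonal is 1, so v is built rank by rank without division, each value being corrected by
    those of smaller rank. *)
Lemma tri_solve (b : T -> V) : exists v : T -> V, forall x, b x = \sum_y K y x *: v y.
Proof.
suff h k : exists v : T -> V, forall x, (rk x < k)%N -> b x = \sum_y K y x *: v y.
  have [v vE] := h (\max_x rk x).+1; exists v => x; apply: vE.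
  by rewrite ltnS leq_bigmax.
elim: k => [|k [v vE]]; first by exists (fun=> 0).
exists (fun y => if rk y == k then b y - \sum_(z | (rk z < rk y)%N) K z y *: v z else v y).
move=> x; rewrite ltnS tri_sum.
rewrite leq_eqVlt => /orP[xk|xk].
  rewrite xk -[LHS](subrK (\sum_(z | (rk z < rk x)%N) K z x *: v z)); congr (_ + _).
  by apply: eq_bigr => y; rewrite (eqP xk) => /ltn_eqF ->.
rewrite (ltn_eqF xk) vE // tri_sum; congr (_ + _); apply: eq_bigr => y yx.
by rewrite (ltn_eqF (ltn_trans yx xk)).
Qed.

Lemma tri_inj (v : T -> V) : (forall x, \sum_y K y x *: v y = 0) -> forall x, v x = 0.
Proof.
move=> h x; have [k] := ubnP (rk x); elim: k x => // k IH x; rewrite ltnS => xk.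
have := h x; rewrite tri_sum big1 ?addr0 // => y yx.
by rewrite IH ?scaler0 // (leq_trans yx).
Qed.

End Triangular.

Section Dominance.
Variable n : nat.
Implicit Types p q : 'P_n.

Definition bp p : bpart n := to_bpart (leqnn n) p.

Definition pmon p : 'X_{1..n} := [multinom p`_[i] | i < n].

(** The total deficit of the partial sums. It decreases strictly as p goes up in dominance order,
    which turns dominance into a numerical rank. *)
Definition dom_rank p := (\sum_(k < n.+1) (n - \sum_(0 <= i < k) p`_[i]))%N.

Lemma dom_rank_lt p q :
  (forall k, \sum_(0 <= i < k) q`_[i] <= \sum_(0 <= i < k) p`_[i])%N ->
  p = q \/ (dom_rank p < dom_rank q)%N.
Proof.
move=> dom.
have le_n (u : 'P_n) k : (\sum_(0 <= i < k) u`_[i] <= n)%N.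
  rewrite -[X in (_ <= X)%N](sum_part_nth u (leq_addl k n)).
  rewrite [X in (_ <= X)%N](big_cat_nat _ (leq_addr n k)) //=; exact: leq_addr.
have [e|] := boolP [forall k : 'I_n.+1, \sum_(0 <= i < k) q`_[i] == \sum_(0 <= i < k) p`_[i]]%N.
  left; apply: intpart_ext => i; have [ni|lt] := leqP n i.
    by rewrite !nth_default // (leq_trans (size_part _)).
  have e1 := forallP e (Ordinal (lt : (i.+1 < n.+1)%N)).
  have e0 := forallP e (Ordinal (ltnW lt : (i < n.+1)%N)).
  move: e1 e0 => /=; rewrite !big_nat_recr //= => /eqP e1 /eqP e0.
  by apply: (@addnI (\sum_(0 <= i < i) p`_[i])%N); rewrite -e1 e0.
case/forallPn => k0 ne; right.
rewrite /dom_rank (bigD1 k0) //= [X in (_ < X)%N](bigD1 k0) //= -addSn leq_add //.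
  have := dom k0; have := le_n p k0; have := le_n q k0; move: ne; lia.
by apply: leq_sum => k _; apply: leq_sub2l.
Qed.

End Dominance.

Section SchurCoef.
Variables (A : comNzRingType) (n : nat).
Local Notation B := n.
Local Notation X := (mvar A n).

Definition psum (m : 'X_{1..n}) k := (\sum_(i < n | (i < k)%N) m i)%N.

Lemma psum_pmon (p : 'P_n) k : psum (pmon p) k = (\sum_(0 <= i < k) p`_[i])%N.
Proof.
rewrite /psum (eq_bigr (fun i : 'I_n => p`_[i])) => [|i _]; last by rewrite mnmE.
rewrite -(big_mkord (fun i => (i < k)%N) (fun i => p`_[i])).
rewrite [RHS](big_nat_widen _ _ (n + k)) ?leq_addl //.
rewrite [RHS](big_cat_nat (n := n)) ?leq_addr //=.
rewrite [X in _ = (_ + X)%N]big1_seq ?addn0 // => i /=.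
rewrite mem_index_iota => /andP[_ /andP[ni _]].
by rewrite nth_default // (leq_trans (size_part p)).
Qed.

Lemma mcoeffMX_neq0 (p : {mpoly A[n]}) u m :
  (p * 'X_[u])@_m != 0 -> exists2 k, m = (u + k)%MM & (p * 'X_[u])@_m = p@_k.
Proof.
rewrite mcoeff_eq0 negbK (perm_mem (msuppMX p u)) => /mapP[k _ ->].
by exists k => //; rewrite mcoeffMX.
Qed.

Lemma schurx_coef_step N (NB : (N < n)%N) (p : {mpoly A[n]}) j m :
  (p * X N ^+ j)@_m != 0 ->
  exists2 k, m = (U_(Ordinal NB) *+ j + k)%MM & (p * X N ^+ j)@_m = p@_k.
Proof. by rewrite (mvarE A (Ordinal NB)) mpolyXn; apply: mcoeffMX_neq0. Qed.

(** Contents of tableaux are dominated by their shape. In the inductive step, the last variable does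
    not enter the first q exponents if q <= N, and the inner shape is contained in lam; if q > N,
    all cells lie in the first q rows, so the bound is the whole degree. *)
Lemma schurx_coef_neq0 N (lam : bpart B) m : (N <= n)%N ->
  (schurx B X N lam)@_m != 0 ->
  [/\ forall i : 'I_n, (N <= i)%N -> m i = 0%N,
      forall i, (N <= i)%N -> lam`_[i] = 0%N,
      forall k, (psum m k <= \sum_(0 <= i < k) lam`_[i])%N & mdeg m = sumn lam].
Proof.
elim: N lam m => [|N IH] lam m NB /=.
  have [l0|l0] := eqVneq (sumn lam) 0%N; last by rewrite mcoeff0 eqxx.
  rewrite mcoeff1; have [-> _|] := eqVneq m 0%MM; last by rewrite eqxx.
  split=> [i _|i _|k|]; last by rewrite mdeg0.
  - by rewrite mnm0E.
  - apply/eqP; rewrite -leqn0 -[X in (_ <= X)%N]l0 -(sum_bpart_nth lam (leq_addr i.+1 B)).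
    by rewrite big_mkord (bigD1 (Ordinal (leq_addl B i.+1))) //= leq_addr.
  - by rewrite /psum big1 // => i _; rewrite mnm0E.
rewrite raddf_sum /= => /eqP ne.
have [mu /andP[musub nz]|none] := pickP (fun mu : bpart B => hstrip mu lam &&
    ((schurx B X N mu * X N ^+ (sumn lam - sumn mu))@_m != 0)); last first.
  case: ne; rewrite big1 // => mu musub; apply/eqP.
  by have := none mu; rewrite musub => /negbFE.
have [k mE e] := schurx_coef_step NB nz; rewrite e in nz.
have [k0 mu0 kdom kdeg] := IH mu k (ltnW NB) nz.
have lesum := hstrip_sumn musub.
have /hstripP hs := musub.
have mdegE : mdeg m = sumn lam.
  by rewrite mE mdegD mdegMn mdeg1 mul1n kdeg subnK.
have mNe (i : 'I_n) : (i < N)%N -> m i = k i.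
  move=> iN; rewrite mE mnmDE mulmnE mnmE (_ : _ == i = false) ?mul0n //.
  by apply/eqP => /(congr1 val) /= e1; rewrite -e1 ltnn in iN.
have lam0 i : (N.+1 <= i)%N -> lam`_[i] = 0%N.
  by case: i => // i Ni; case: (hs i); rewrite (mu0 i) // leqn0 => /eqP.
split=> // [i Ni|q].
  rewrite mE mnmDE mulmnE mnmE k0 ?(ltnW Ni) // (_ : _ == i = false) ?mul0n //.
  by apply/eqP => /(congr1 val) /= e1; rewrite -e1 ltnn in Ni.
have [qN|Nq] := leqP q N.
  rewrite /psum (eq_bigr k) => [|i iq]; last by rewrite mNe // (leq_trans iq).
  by apply: leq_trans (kdom q) _; apply: leq_sum => i _; case: (hs i).
have -> : (\sum_(0 <= i < q) lam`_[i] = mdeg m)%N.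
  rewrite mdegE -(sum_bpart_nth lam (leq_addr q B)) [RHS](big_cat_nat _ (leq_addl B q)) //=.
  rewrite [X in _ = (_ + X)%N]big1_seq ?addn0 // => i /=.
  by rewrite mem_index_iota => /andP[qi _]; rewrite lam0 // (leq_trans Nq).
by rewrite (mpoly.mdegE m) /psum [X in (_ <= X)%N](bigID (fun i : 'I_n => (i < q)%N)) /= leq_addr.
Qed.
End SchurCoef.

Section SchurBasis.
Variables (A : comNzRingType) (n : nat).
Local Notation X := (mvar A n).

(** Comparing the exponents of the last variable gives |lam| - |ka| = lam_N for every contributing
    ka. As ka is contained in lam and has at most N rows, it is lam without its row N. *)
Lemma schurx_coef_diag N (lam : bpart n) : (N <= n)%N ->
  (forall i, (N <= i)%N -> lam`_[i] = 0%N) ->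
  (schurx n X N lam)@_[multinom lam`_[i] | i < n] = 1.
Proof.
elim: N lam => [|N IH] lam Nn lam0 /=.
  have l0 : sumn lam = 0%N.
    by rewrite -(sum_bpart_nth lam (leqnn n)) big1 // => i _; rewrite lam0.
  rewrite l0 eqxx mcoeff1; case: eqP => // - []; apply/mnmP => i.
  by rewrite mnmE mnm0E lam0.
set f := fun i => if (i < N)%N then lam`_[i] else 0%N.
set mu := bpart_of n (sumn lam - lam`_[N]) f.
have sz : (sumn lam - lam`_[N] <= n)%N by rewrite (leq_trans (leq_subr _ _)) // sumn_bpart.
have slam : sumn lam = (\sum_(0 <= i < N) lam`_[i] + lam`_[N])%N.
  rewrite -(sum_bpart_nth lam (leqnn n)) (big_cat_nat _ Nn) //= big_nat_recr //=.
  rewrite [X in (_ + X)%N]big1_seq ?addn0 // => i /=.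
  by rewrite mem_index_iota => /andP[/lam0].
have nth_mu i : mu`_[i] = f i.
  apply: (nth_bpart_of (L := N)) => //.
  - apply: homo_leq => // [a b c ab cb|j]; first exact: leq_trans cb ab.
    rewrite /f; have := bpart_noninc lam (leqnSn j).
    by case: ltnP => // h1; rewrite (ltnW h1).
  - by move=> j lj; rewrite /f ltnNge lj.
  by rewrite slam addnK !big_nat; apply: eq_bigr => j /andP[_ jN]; rewrite /f jN.
have smu : sumn mu = (sumn lam - lam`_[N])%N by rewrite sumn_bpart_of.
have musub : hstrip mu lam.
  apply/hstripP => i; rewrite nth_mu /f; case: ltnP => Ni.
    by split=> //; apply: bpart_noninc.
  by rewrite lam0.
rewrite (bigD1 mu) //= mcoeffD raddf_sum /= big1 ?addr0.
  have -> : [multinom lam`_[i] | i < n] =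
      (U_(Ordinal Nn) *+ (sumn lam - sumn mu) + [multinom mu`_[i] | i < n])%MM.
    apply/mnmP => i; rewrite mnmDE mulmnE !mnmE smu nth_mu /f subKn; last first.
      by rewrite slam leq_addl.
    rewrite -val_eqE /=; have [iN|Ni|<-] := ltngtP i N; rewrite ?mul0n ?mul1n ?addn0 //.
    by rewrite lam0.
  rewrite (mvarE A (Ordinal Nn)) mpolyXn mcoeffMX IH ?(ltnW Nn) // => i Ni.
  by rewrite nth_mu /f ltnNge Ni.
move=> ka /andP[kasub kamu]; apply/eqP; apply: contraNT kamu => nz.
have [k mE e] := schurx_coef_step Nn nz; rewrite e in nz.
have [k0 ka0 kdom kdeg] := schurx_coef_neq0 (ltnW Nn) nz.
have := congr1 (fun m : 'X_{1..n} => m (Ordinal Nn)) mE.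
rewrite /= mnmDE mulmnE !mnmE eqxx mul1n k0 // addn0 => lamN0.
have lamN : lam`_[N] = (sumn lam - sumn ka)%N := lamN0.
have ska : sumn ka = (\sum_(0 <= i < N) lam`_[i])%N.
  by have := hstrip_sumn kasub; move: lamN slam; lia.
have skaE : sumn ka = (\sum_(0 <= i < N) ka`_[i])%N.
  rewrite -(sum_bpart_nth ka (leqnn n)) (big_cat_nat _ (ltnW Nn)) //=.
  rewrite [X in (_ + X)%N]big1_seq ?addn0 // => i /=.
  by rewrite mem_index_iota => /andP[/ka0].
have /hstripP hs := kasub.
apply/eqP/bpart_ext => i; rewrite nth_mu /f; case: ltnP => [iN|/ka0 //].
apply/eqP; rewrite eqn_leq (proj2 (hs i)) /= leqNgt; apply/negP => lt.
have : (\sum_(0 <= i < N) ka`_[i] < \sum_(0 <= i < N) lam`_[i])%N.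
  rewrite !big_mkord (bigD1 (Ordinal iN)) //= [X in (_ < X)%N](bigD1 (Ordinal iN)) //=.
  by rewrite -addSn leq_add //; apply: leq_sum => j _; case: (hs j).
by rewrite -ska skaE ltnn.
Qed.

Definition schur_basis (p : 'P_n) : {mpoly A[n]} := schurx n X n (bp p).

Definition kostka (p : 'P_n) (m : 'X_{1..n}) : A := (schur_basis p)@_m.

Lemma kostka_diag p : kostka p (pmon p) = 1.
Proof.
apply: (schurx_coef_diag (lam := bp p) (leqnn n)) => i ni.
by rewrite nth_default // (leq_trans (size_part p)).
Qed.

Lemma kostka_tri p q : kostka p (pmon q) != 0 -> p = q \/ (dom_rank p < dom_rank q)%N.
Proof.
move/(schurx_coef_neq0 (leqnn n)) => [_ _ dom _]; apply: dom_rank_lt => k.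
by rewrite -psum_pmon; apply: dom.
Qed.

Lemma kostka_deg p m : kostka p m != 0 -> mdeg m = n.
Proof. by move/(schurx_coef_neq0 (leqnn n)) => [_ _ _ ->]; apply: sumn_part. Qed.

Lemma schur_basis_free (a : 'P_n -> A) :
  \sum_p a p *: schur_basis p = 0 -> forall p, a p = 0.
Proof.
move=> h; apply: (tri_inj kostka_diag kostka_tri (V := A^o)) => q.
have := congr1 (fun f : {mpoly A[n]} => f@_(pmon q)) h.
rewrite /= mcoeff0 raddf_sum /= => {2}<-; apply: eq_bigr => p _.
by rewrite mcoeffZ mulrC.
Qed.

End SchurBasis.

Lemma schurx_rmorph (A A' : comNzRingType) (f : {rmorphism A -> A'}) x B N lam :
  f (schurx B x N lam) = schurx B (fun i => f (x i)) N lam.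
Proof.
elim: N lam => [|N IH] lam /=; first by rewrite rmorph_nat.
by rewrite rmorph_sum; apply: eq_bigr => mu _; rewrite rmorphM rmorphXn IH.
Qed.

Lemma eq_hom_fam (A : comNzRingType) (I : finType) (z w : I -> A) k :
  z =1 w -> hom_fam z k = hom_fam w k.
Proof.
by move=> zw; apply: eq_bigr => m _; apply: eq_bigr => i _; rewrite zw.
Qed.

Lemma hom_fam_perm (A : comNzRingType) n (x y : 'I_n -> A) (s : 'S_n) :
  hom_fam (fun ij : 'I_n * 'I_n => x (s ij.1) * y ij.2) n =
  hom_fam (fun ij : 'I_n * 'I_n => x ij.1 * y ij.2) n.
Proof.
rewrite !(hom_famE _ (leqnn n)); congr (fun q : {poly A} => q`_n).
rewrite -(pair_big xpredT xpredT (fun i j : 'I_n => geo n (x (s i) * y j))) /=.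
rewrite -(pair_big xpredT xpredT (fun i j : 'I_n => geo n (x i * y j))) /=.
by rewrite [RHS](reindex_inj (@perm_inj _ s)).
Qed.

Section SchurSym.
Variables (A : comNzRingType) (n : nat).
Local Notation A1 := {mpoly A[n]}.

(* Two sets of n variables: X as constants of the outer polynomial ring, Y as its
   variables. *)
Definition varX (i : nat) : {mpoly A1[n]} := (mvar A n i)%:MP.
Definition varY (i : nat) : {mpoly A1[n]} := mvar A1 n i.

Lemma schurx_varX p : schurx n varX n (bp p) = (schur_basis A p)%:MP.
Proof. by rewrite (schurx_rmorph (@mpolyC n A1)). Qed.

(** Freeness is used twice: for the Y-alphabet over the ring of polynomials in X, then for the
    X-alphabet over A. *)
Lemma schurx_XY_free (a : 'P_n -> 'P_n -> A) :
  \sum_p \sum_q (schurx n varX n (bp p) * schurx n varY n (bp q)) * (a p q)%:MP%:MP = 0 ->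
  forall p q, a p q = 0.
Proof.
move=> h p q; rewrite exchange_big /= in h.
have h1 : \sum_q (\sum_p a p q *: schur_basis A p) *: schur_basis A1 q = 0.
  rewrite -[RHS]h; apply: eq_bigr => q' _; rewrite scaler_suml; apply: eq_bigr => p' _.
  rewrite schurx_varX -!mul_mpolyC rmorphM /=; rewrite /schur_basis; ring.
exact: (schur_basis_free (schur_basis_free h1 q)).
Qed.

(** The Cauchy kernel is unchanged by permutations of X, and the s_p(Y) are independent over the
    ring of X, so each coefficient s_p(X) is unchanged too. This takes the place of the Bender-Knuth
    involutions. *)
Lemma schur_basis_sym (p : 'P_n) : schur_basis A p \is symmetric.
Proof.
apply/issymP => s; apply/eqP; rewrite -subr_eq0; apply/eqP; move: p.
apply: (schur_basis_free (A := A1)).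
have E (t : 'S_n) : \sum_p (msym t (schur_basis A p)) *: schur_basis A1 p =
    hom_fam (fun ij : 'I_n * 'I_n => varX ij.1 * varY ij.2) n.
  pose x i : {mpoly A1[n]} := (msym t (mvar A n i))%:MP.
  have xE (i : 'I_n) : varX (t i) = x i.
    rewrite /x /varX !mvarE msymX; congr (('X_[_])%:MP).
    apply/mnmP => j; rewrite !mnmE.
    by congr nat_of_bool; rewrite -[RHS](inj_eq (@perm_inj _ t)) permKV.
  rewrite -(hom_fam_perm varX varY t).
  rewrite (@eq_hom_fam _ _ _ (fun ij : 'I_n * 'I_n => x ij.1 * varY ij.2)) => [|ij]; last first.
    by rewrite -xE.
  rewrite -(cauchy _ _ _ _ (leqnn n)) (big_bpart (leqnn n)); apply: eq_bigr => p _.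
  rewrite -mul_mpolyC; congr (_ * _).
  by rewrite (schurx_rmorph (msym t)) (schurx_rmorph (@mpolyC n A1)).
under eq_bigr do rewrite scalerBl.
rewrite sumrB E (eq_bigr (fun p => msym 1 (schur_basis A p) *: schur_basis A1 p)) => [|p _].
  by rewrite E subrr.
by rewrite msym1m.
Qed.

End SchurSym.

(** * Frobenius' formula *)

Lemma ffun_perm_eq n (I : eqType) (f f0 : 'I_n -> I) :
  (forall i, #|[pred k | f k == i]| = #|[pred k | f0 k == i]|) ->
  exists g : 'S_n, forall k, f k = f0 (g k).
Proof.
move=> h; pose t (u : 'I_n -> I) := [tuple u k | k < n].
have cnt (u : 'I_n -> I) i : count_mem i (t u) = #|[pred k | u k == i]|.
  rewrite -sum1_card -sum1_count /= big_map big_enum_cond /=.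
  by apply: eq_bigl => k; rewrite inE.
have /tuple_permP[g gE] : perm_eq (t f) (t f0).
  by apply/allP => i _ /=; rewrite !cnt h.
exists g => k; have := congr1 (fun s : n.-tuple I => tnth s k) (val_inj gE).
by rewrite !tnth_mktuple.
Qed.

(** Hence a symmetric polynomial of degree n in n variables is determined by its coefficients at the
    monomials [pmon p]. *)
Lemma sort_monomial n (m : 'X_{1..n}) : mdeg m = n ->
  exists (s : 'S_n) (p : 'P_n), [multinom m (s i) | i < n] = pmon p.
Proof.
move=> mn; pose t := sort geq [seq m i | i <- enum 'I_n].
have szt : size t = n by rewrite size_sort size_map size_enum_ord.
have tE : t = mkseq (nth 0%N t) n by rewrite -[X in mkseq _ X]szt mkseq_nth.
have pt : perm_eq t [seq m i | i <- enum 'I_n] by rewrite perm_sort.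
have tsort : sorted geq t by apply: sort_sorted => a b; apply: leq_total.
have [|||h1 h2] := part_fun_seqP (n := n) (f := nth 0%N t) (L := n).
- by move=> i j; apply: nth_geq_sorted.
- by move=> j nj; rewrite nth_default // szt.
- rewrite -(sumn_nth (s := t)) ?szt // -[RHS]mn mdegE sumnE (perm_big _ pt) big_map.
  by rewrite big_enum.
have [s sE] : exists s : 'S_n, forall i : 'I_n, nth 0%N t i = m (s i).
  apply: ffun_perm_eq => x; move/seq.permP: pt => /(_ (pred1 x)).
  rewrite {1}tE /mkseq -val_enum_ord -map_comp => cE.
  have cc (u : 'I_n -> nat) : count (pred1 x) (map u (enum 'I_n)) = #|[pred k | u k == x]|.
    rewrite -sum1_card -sum1_count /= big_map big_enum_cond /=.
    by apply: eq_bigl => k; rewrite inE.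
  by rewrite -!cc -cE.
exists s, (IntPart h1); apply/mnmP => i; rewrite !mnmE -sE.
by rewrite [RHS]h2.
Qed.

Section Invariants.
Variables (n : nat) (A : comNzRingType).

(* For g of cycle type rho, this is the power sum p_rho at the family z. *)
Definition inv_sum (I : finType) (z : I -> A) (g : 'S_n) : A :=
  \sum_(f : {ffun 'I_n -> I} | [forall k, f (g k) == f k]) \prod_k z (f k).

Lemma inv_sumM (I J : finType) (z : I -> A) (w : J -> A) g :
  inv_sum (fun ij : I * J => z ij.1 * w ij.2) g = inv_sum z g * inv_sum w g.
Proof.
rewrite /inv_sum big_distrlr /= pair_big /=.
pose h (f : {ffun 'I_n -> I} * {ffun 'I_n -> J}) := [ffun k => (f.1 k, f.2 k)].
pose h' (f : {ffun 'I_n -> I * J}) := ([ffun k => (f k).1], [ffun k => (f k).2]).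
rewrite (reindex h) /=; last first.
  exists h' => [[f1 f2] _ | f _]; last first.
    by apply/ffunP => k; rewrite !ffunE; case: (f k).
  by congr (_, _); apply/ffunP => k; rewrite !ffunE.
apply: eq_big => [[f1 f2]|[f1 f2] _] /=; last first.
  by rewrite -big_split; apply: eq_bigr => k _; rewrite !ffunE.
apply/forallP/andP => [H|[/forallP H1 /forallP H2] k]; last first.
  by rewrite !ffunE /= (eqP (H1 k)) (eqP (H2 k)).
by split; apply/forallP => k; have := H k; rewrite !ffunE => /eqP[e1 e2]; rewrite ?e1 ?e2.
Qed.

Variable I : finType.
Implicit Type f : {ffun 'I_n -> I}.

Definition content f (i : I) := #|[pred k | f k == i]|.

Lemma sum_content f : (\sum_i content f i = n)%N.
Proof.
rewrite -[RHS](card_ord n) -sum1_card (partition_big f xpredT) //=.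
by apply: eq_bigr => i _; rewrite sum1_card.
Qed.

Lemma prod_content (z : I -> A) f : \prod_k z (f k) = \prod_i z i ^+ content f i.
Proof.
rewrite (partition_big f xpredT) //=; apply: eq_bigr => i _.
by rewrite (eq_bigr (fun=> z i)) => [|k /eqP -> //]; rewrite prodr_const.
Qed.

Lemma content_exists (m : I -> nat) : (\sum_i m i = n)%N ->
  exists f, forall i, content f i = m i.
Proof.
move=> mn; pose s := flatten [seq nseq (m i) i | i <- enum I].
have szs : size s = n.
  rewrite size_flatten /shape -map_comp sumnE big_map big_enum -[RHS]mn.
  by apply: eq_bigr => i _ /=; rewrite size_nseq.
exists (finfun (tnth (tcast szs (in_tuple s)))) => i.
transitivity (count_mem i (tcast szs (in_tuple s))).
  rewrite /content -sum1_card -sum1_count -[in RHS]map_tnth_enum big_map big_enum_cond /=.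
  by apply: eq_bigl => k; rewrite !inE ffunE.
rewrite val_tcast count_flatten -map_comp sumnE big_map big_enum (bigD1 i) //= count_nseq /= eqxx mul1n.
by rewrite big1 ?addn0 // => j ji; rewrite count_nseq /= (negPf ji).
Qed.

(** Orbit counting: writing f as a permuted f0 translates the condition on g into f0 (g k) = f k,
    and then each g belongs to exactly one f. *)
Lemma card_stab_content f0 :
  (\sum_(f | [forall i, content f i == content f0 i])
     #|[pred g : 'S_n | [forall k, f (g k) == f k]]| = n`!)%N.
Proof.
transitivity (\sum_(f | [forall i, content f i == content f0 i])
     #|[pred g : 'S_n | [forall k, f0 (g k) == f k]]|)%N.
  apply: eq_bigr => f /forallP h.
  have [k0 k0E] : exists g : 'S_n, forall k, f k = f0 (g k).
    by apply: ffun_perm_eq => i; have /eqP := h i.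
  rewrite -!sum1_card [RHS](reindex_inj (mulIg k0)) /=; apply: eq_bigl => g.
  by rewrite !inE; apply: eq_forallb => k; rewrite k0E permM.
under eq_bigr do rewrite -sum1_card.
rewrite (exchange_big_dep xpredT) //= -card_Sn -sum1_card.
apply: eq_bigr => g _; rewrite (big_pred1 [ffun k => f0 (g k)]) // => f /=.
apply/andP/eqP => [[_ /forallP h]|->].
  by apply/ffunP => k; rewrite ffunE; have /eqP := h k.
split; last by apply/forallP => k; rewrite ffunE.
apply/forallP => i; apply/eqP; rewrite /content -!sum1_card [RHS](reindex_inj (@perm_inj _ g)).
by apply: eq_bigl => k; rewrite !inE ffunE.
Qed.

(** All maps of a given content contribute the same monomial, and [card_stab_content] says that it
    occurs n! times in all. *)
Lemma burnside (z : I -> A) : \sum_(g : 'S_n) inv_sum z g = hom_fam z n *+ n`!.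
Proof.
rewrite /inv_sum (exchange_big_dep xpredT) //=.
pose c f : {ffun I -> 'I_n.+1} := [ffun i => inord (content f i)].
have leC f i : (content f i < n.+1)%N.
  by rewrite ltnS -[X in (_ <= X)%N](sum_content f) (bigD1 i) //= leq_addr.
have cE f i : c f i = content f i :> nat by rewrite ffunE inordK.
rewrite (partition_big c (fun m : {ffun I -> 'I_n.+1} => (\sum_i m i == n)%N)) /=; last first.
  by move=> f _; rewrite -[X in _ == X](sum_content f); apply/eqP/eq_bigr => i _; rewrite cE.
rewrite /hom_fam -sumrMnl; apply: eq_bigr => m /eqP mn.
have [f0 f0E] := content_exists mn.
have c0 f : (c f == m) = [forall i, content f i == content f0 i].
  apply/eqP/forallP => [e i|h]; first by rewrite f0E -e cE.
  by apply/ffunP => i; apply/val_inj; rewrite /= cE (eqP (h i)) f0E.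
rewrite -(card_stab_content f0) -sumrMnr; apply: eq_big => // f /eqP cfm.
rewrite sumr_const prod_content; congr (_ *+ _).
by apply: eq_bigr => i _; rewrite -cE cfm.
Qed.

End Invariants.

Lemma inv_sum_rmorph n (A A' : comNzRingType) (f : {rmorphism A -> A'}) (I : finType)
    (z : I -> A) (g : 'S_n) : f (inv_sum z g) = inv_sum (fun i => f (z i)) g.
Proof. by rewrite rmorph_sum; apply: eq_bigr => u _; rewrite rmorph_prod. Qed.

Import Order.TTheory Num.Theory.

(** Distributivity in dependent form, because the type of tau_i depends on alpha_i. *)
Lemma prod_sum_dffun (A : comNzRingType) (I : finType) (T_ : I -> finType)
    (F : forall i, T_ i -> A) :
  \prod_i \sum_(j : T_ i) F i j = \sum_(t : {dffun forall i, T_ i}) \prod_i F i (t i).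
Proof.
rewrite [RHS](reindex (@dffun_of_fprod _ T_)) /=; last exact/onW_bij/dffun_of_fprod_bij.
pose P_ i : {ffun T_ i -> A} := [ffun j => F i j].
rewrite (eq_bigr (fun t : fprod T_ => \prod_(i in I) P_ i (t i))) => [|t _]; last first.
  by apply: eq_bigr => i _; rewrite !ffunE.
rewrite big_fprod -(bigA_distr_big_dep _ (fun i j => untag 0 (P_ i) j)); apply: eq_bigr => i _.
by rewrite -(big_tag (fun i => P_ i)); apply: eq_bigr => j _; rewrite ffunE.
Qed.

Lemma morph_scale (A : comNzRingType) (f : {rmorphism rat -> A}) (a b : A) (u v : int)
    (k : nat) : k%:R * ((a *~ u) * (b *~ v)) = a * b * f (k%:R * (v * u)%:~R).
Proof.
rewrite rmorphM rmorph_nat rmorph_int -(mulrzl a) -(mulrzl b) intrM; ring.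
Qed.

Section Frobenius.
Variable n : nat.

Definition psumX (g : 'S_n) : {mpoly rat[n]} := inv_sum (fun i : 'I_n => 'X_i) g.

Definition content_mon (f : {ffun 'I_n -> 'I_n}) : 'X_{1..n} := [multinom content f i | i < n].

Lemma mcoeff_psumX g m :
  (psumX g)@_m = #|[pred f : {ffun 'I_n -> 'I_n} | [forall k, f (g k) == f k]
                     && (content_mon f == m)]|%:R.
Proof.
rewrite raddf_sum -sumr_const /= [in RHS](eq_bigl (fun f : {ffun 'I_n -> 'I_n} =>
  [forall k, f (g k) == f k] && (content_mon f == m))) // [RHS]big_mkcondr /=.
apply: eq_bigr => f _; rewrite (prod_content (fun i : 'I_n => 'X_i)).
rewrite (eq_bigr (fun i => 'X_i ^+ content_mon f i)) => [|i _]; last by rewrite mnmE.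
by rewrite -mpolyXE_id mcoeffX; case: eqP.
Qed.

Lemma psumX_sym g : psumX g \is symmetric.
Proof.
apply/issymP => s; rewrite /psumX (inv_sum_rmorph (msym s)) /inv_sum.
pose h (t : 'S_n) (f : {ffun 'I_n -> 'I_n}) := [ffun k => t (f k)] : {ffun 'I_n -> 'I_n}.
rewrite [RHS](reindex (h s)) /=; last first.
  by exists (h s^-1%g) => f _; apply/ffunP => k; rewrite !ffunE ?permK ?permKV.
apply: eq_big => [f|f _].
  by apply: eq_forallb => k; rewrite !ffunE (inj_eq perm_inj).
apply: eq_bigr => k _; rewrite ffunE msymX; congr 'X_[_].
apply/mnmP => i; rewrite !mnmE.
by congr nat_of_bool; rewrite -[LHS](inj_eq (@perm_inj _ s)) permKV.
Qed.

Lemma psumX_deg g m : (psumX g)@_m != 0 -> mdeg m = n.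
Proof.
rewrite mcoeff_psumX pnatr_eq0 -lt0n => /card_gt0P[f /andP[_ /eqP <-]].
by rewrite mdegE -[RHS](sum_content f); apply: eq_bigr => i _; rewrite mnmE.
Qed.

(** Both sides are symmetric and homogeneous of degree n, so the coefficients at sorted monomials
    decide. *)
Lemma psumX_expand (psi : 'P_n -> 'S_n -> rat) :
  (forall g q, (psumX g)@_(pmon q) = \sum_p kostka rat p (pmon q) * psi p g) ->
  forall g, psumX g = \sum_p psi p g *: schur_basis rat p.
Proof.
move=> h g; apply/mpolyP => m; rewrite [RHS]raddf_sum /=.
have [mn|mn] := eqVneq (mdeg m) n; last first.
  have [->|/psumX_deg e] := eqVneq (psumX g)@_m 0; last by rewrite e eqxx in mn.
  rewrite big1 // => p _; rewrite mcoeffZ.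
  have [->|/kostka_deg e] := eqVneq (schur_basis rat p)@_m 0; first by rewrite mulr0.
  by rewrite e eqxx in mn.
have [s [q sq]] := sort_monomial mn.
rewrite -(msym_coeff m s (psumX_sym g)) sq h; apply: eq_bigr => p _.
by rewrite mcoeffZ mulrC -(msym_coeff m s (schur_basis_sym rat p)) sq.
Qed.

Lemma psumX_eval (psi : 'P_n -> 'S_n -> rat) (A : comNzRingType) (f : {rmorphism rat -> A})
    (x : nat -> A) :
  (forall g, psumX g = \sum_p psi p g *: schur_basis rat p) ->
  forall g, inv_sum (fun i : 'I_n => x i) g = \sum_p f (psi p g) * schurx n x n (bp p).
Proof.
move=> h g; have := congr1 (mmap f (fun i : 'I_n => x i)) (h g).
rewrite (inv_sum_rmorph (mmap f (fun i : 'I_n => x i))) rmorph_sum /= => e.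
transitivity (inv_sum (fun i : 'I_n => mmap f (fun i : 'I_n => x i) 'X_i) g).
  apply: eq_bigr => u _; apply: eq_bigr => k _.
  by rewrite mmapX mmap1U.
rewrite e; apply: eq_bigr => p _; rewrite mmapZ; congr (_ * _).
rewrite (schurx_rmorph (mmap f (fun i : 'I_n => x i))).
rewrite -!(schur_evalE _ n (bp p)); apply: eq_bigr => T _; apply: eq_bigr => c _.
by rewrite /= mvarE mmapX mmap1U.
Qed.

Definition XY (ij : 'I_n * 'I_n) := varX rat n ij.1 * varY rat n ij.2.

Let cst : {rmorphism rat -> {mpoly {mpoly rat[n]}[n]}} := (@mpolyC n _) \o (@mpolyC n _).

Lemma inv_sum_XY (psi : 'P_n -> 'S_n -> rat) g :
  (forall g, psumX g = \sum_p psi p g *: schur_basis rat p) ->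
  inv_sum XY g = \sum_p \sum_q
    (schurx n (varX rat n) n (bp p) * schurx n (varY rat n) n (bp q)) *
    (psi p g * psi q g)%:MP%:MP.
Proof.
move=> h; rewrite (inv_sumM (fun i : 'I_n => varX rat n i) (fun i : 'I_n => varY rat n i)).
rewrite (psumX_eval cst (varX rat n) h) (psumX_eval cst (varY rat n) h) big_distrlr /=.
apply: eq_bigr => p _; apply: eq_bigr => q _; rewrite !rmorphM /=; ring.
Qed.

Lemma hom_XY a (an : (a <= n)%N) : hom_fam XY a = \sum_(p : 'P_a)
  schurx n (varX rat n) n (to_bpart an p) * schurx n (varY rat n) n (to_bpart an p).
Proof. by rewrite /XY -(cauchy (varX rat n) (varY rat n) _ _ an) (big_bpart an). Qed.

(** The sum of p_g(XY) over g is computed twice: from p_g(XY) = p_g(X) p_g(Y), and as n! h_n(XY).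
    The coefficients of s_p(X) s_q(Y) are then compared. *)
Lemma psi_orthonormal (psi : 'P_n -> 'S_n -> rat) :
  (forall g, psumX g = \sum_p psi p g *: schur_basis rat p) ->
  forall p q, \sum_g psi p g * psi q g = (n`! * (p == q))%N%:R.
Proof.
move=> h p q; apply/eqP; rewrite -subr_eq0; apply/eqP; move: p q.
apply: schurx_XY_free.
have E1 : \sum_(g : 'S_n) inv_sum XY g = \sum_p \sum_q
    (schurx n (varX rat n) n (bp p) * schurx n (varY rat n) n (bp q)) *
    (\sum_g psi p g * psi q g)%:MP%:MP.
  rewrite (eq_bigr _ (fun g _ => inv_sum_XY g h)) exchange_big /=; apply: eq_bigr => p _.
  rewrite exchange_big /=; apply: eq_bigr => q _.
  by rewrite -mulr_sumr !rmorph_sum.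
have E2 : \sum_(g : 'S_n) inv_sum XY g = \sum_(p : 'P_n) \sum_(q : 'P_n)
    (schurx n (varX rat n) n (bp p) * schurx n (varY rat n) n (bp q)) *
    ((n`! * (p == q))%N%:R : rat)%:MP%:MP.
  rewrite burnside (hom_XY (leqnn n)) -mulr_natr mulr_suml; apply: eq_bigr => p _.
  rewrite (bigD1 p) //= eqxx muln1 !rmorph_nat big1 ?addr0 // => q.
  by rewrite eq_sym => /negPf ->; rewrite muln0 !rmorph0 mulr0.
rewrite -[RHS](subrr (\sum_(g : 'S_n) inv_sum XY g)) {1}E1 E2 -sumrB.
apply: eq_bigr => p _; rewrite -sumrB; apply: eq_bigr => q _.
by rewrite -mulrBr !rmorphB.
Qed.

(* chi and psi agree because sum_g (chi_p(g) - psi_p(g))^2 = 0. *)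
Lemma frobenius_formula (chi : 'P_n -> 'S_n -> rat) :
  (forall p, \sum_g chi p g * chi p g = n`!%:R) ->
  (forall p, \sum_g chi p g * (psumX g)@_(pmon p) = n`!%:R) ->
  (forall p q, \sum_g chi p g * (psumX g)@_(pmon q) != 0 ->
     p = q \/ (dom_rank p < dom_rank q)%N) ->
  forall g, psumX g = \sum_p chi p g *: schur_basis rat p.
Proof.
move=> chi1 chid chit.
(* The unknowns are functions on S_n, so one unitriangular system defines psi for all g. *)
have [psi0 psiE] := tri_solve (@kostka_diag rat n) (@kostka_tri rat n)
  (fun q => [ffun g => (psumX g)@_(pmon q)] : {ffun 'S_n -> rat^o}).
pose psi p g : rat := psi0 p g.
have psiX g : psumX g = \sum_p psi p g *: schur_basis rat p.
  apply: (psumX_expand (psi := psi)) => {}g q; have := congr1 (fun u : {ffun 'S_n -> rat^o} => u g) (psiE q).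
  rewrite ffunE => ->; rewrite sum_ffunE; apply: eq_bigr => p _.
  by rewrite ffunE.
have psi1 := psi_orthonormal psiX.
suff e p g : chi p g = psi p g.
  by move=> g; rewrite psiX; apply: eq_bigr => p _; rewrite e.
pose Y q := \sum_g chi p g * psi q g.
have YE q : \sum_g chi p g * (psumX g)@_(pmon q) =
    Y q + \sum_(r | (dom_rank r < dom_rank q)%N) kostka rat r (pmon q) * Y r.
  rewrite -(tri_sum (@kostka_diag rat n) (@kostka_tri rat n) (V := rat^o)) /Y.
  under [RHS]eq_bigr do rewrite scaler_sumr.
  rewrite exchange_big /=; apply: eq_bigr => g' _.
  have := congr1 (fun u : {ffun 'S_n -> rat^o} => u g') (psiE q).
  rewrite ffunE => ->; rewrite sum_ffunE mulr_sumr; apply: eq_bigr => r _.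
  by rewrite ffunE /GRing.scale /= mulrCA.
(* Induction on the rank of q: the smaller terms in [YE] vanish, and a nonzero left side would force
   q = p or a rank of q above that of p. *)
have Y0 q : (dom_rank q < dom_rank p)%N -> Y q = 0.
  have [k] := ubnP (dom_rank q); elim: k q => // k IH q; rewrite ltnS => qk qp.
  have := YE q; rewrite [X in _ = _ + X]big1 => [|r rq]; last first.
    by rewrite (IH _ (leq_trans rq qk) (ltn_trans rq qp)) mulr0.
  rewrite addr0 => <-; apply/eqP; apply: contraTT qp => /chit[->|]; first by rewrite ltnn.
  by rewrite -leqNgt => /ltnW.
have Yp : Y p = n`!%:R.
  rewrite -(chid p) YE big1 ?addr0 // => r rp; by rewrite Y0 ?mulr0.
have : \sum_g (chi p g - psi p g) ^+ 2 = 0.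
  rewrite (eq_bigr (fun g => chi p g * chi p g + psi p g * psi p g
                             - (chi p g * psi p g) *+ 2)) => [|g' _]; last by ring.
  rewrite !big_split /= chi1 psi1 eqxx muln1 sumrN sumrMnl -/(Y p) Yp; ring.
move/eqP; rewrite psumr_eq0 => [|g' _]; last by rewrite sqr_ge0.
by move/allP/(_ g); rewrite mem_index_enum sqrf_eq0 subr_eq0 => /(_ isT) /eqP.
Qed.

Variable d : nat.

(** The character of P^d(V_(n,{k})): f is the exponent vector of a monomial of degree d in n
    variables. *)
Definition perm_char (g : 'S_n) : nat :=
  #|[pred f : {ffun 'I_n -> 'I_d.+1} | [forall k, f (g k) == f k]
       && (\sum_k f k == d)%N]|.

(* Both sides are the coefficient of t^d in the complete homogeneous symmetric
   function h_n evaluated at the products x_i y_j t^l, 0 <= l <= d. *)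
Lemma multiplicity_formula (chi : 'P_n -> 'S_n -> rat) (lam mu : 'P_n) :
  (forall g, psumX g = \sum_p chi p g *: schur_basis rat p) ->
  \sum_g chi lam g * chi mu g * (perm_char g)%:R =
  n`!%:R * (\sum_(alpha : {ffun 'I_d.+1 -> 'I_n.+1} |
           (\sum_(i < d.+1) i * alpha i == d)%N && (\sum_(i < d.+1) alpha i == n)%N)
      \sum_(tau : {dffun forall i : 'I_d.+1, 'P_(alpha i)})
         LR_coef (fun i => parts (tau i)) mu * LR_coef (fun i => parts (tau i)) lam)%:~R.
Proof.
move=> h; apply/eqP; rewrite -subr_eq0; apply/eqP; move: lam mu.
apply: schurx_XY_free.
(* The power sum p_g at the family t^l counts the g-invariant exponent vectors by their sum, so its
   coefficient of t^d is [perm_char]. *)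
pose w (l : 'I_d.+1) : {poly {mpoly {mpoly rat[n]}[n]}} := 'X^l.
pose z (p : ('I_n * 'I_n) * 'I_d.+1) := (XY p.1)%:P * w p.2.
have E1 : (\sum_(g : 'S_n) inv_sum z g)`_d =
   \sum_(p : 'P_n) \sum_(q : 'P_n)
    (schurx n (varX rat n) n (bp p) * schurx n (varY rat n) n (bp q)) *
    (\sum_g chi p g * chi q g * (perm_char g)%:R)%:MP%:MP.
  have perm_charE g : (inv_sum w g)`_d = (perm_char g)%:R.
    rewrite coef_sum -sumr_const /= [in RHS](eq_bigl (fun f : {ffun 'I_n -> 'I_d.+1} =>
      [forall k, f (g k) == f k] && (\sum_k f k == d)%N)) // [RHS]big_mkcondr /=.
    apply: eq_bigr => f _; rewrite prodrXr coefXn eq_sym; by case: eqP.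
  transitivity (\sum_(g : 'S_n) inv_sum XY g * (perm_char g)%:R).
    rewrite coef_sum; apply: eq_bigr => g _.
    rewrite (inv_sumM (fun ij => (XY ij)%:P) w).
    rewrite -(inv_sum_rmorph (@polyC _)) coefCM perm_charE //.
  rewrite (eq_bigr _ (fun g _ => congr1 (fun u => u * _) (inv_sum_XY g h))).
  under eq_bigr do rewrite big_distrl /=.
  rewrite exchange_big /=; apply: eq_bigr => p _.
  under eq_bigr do rewrite big_distrl /=.
  rewrite exchange_big /=; apply: eq_bigr => q _.
  rewrite !rmorph_sum mulr_sumr; apply: eq_bigr => g _.
  by rewrite -mulrA [in RHS]rmorphM [in RHS]rmorphM /= !rmorph_nat.
have E2 : (\sum_(g : 'S_n) inv_sum z g)`_d = n`!%:R * \sum_(alpha : {ffun 'I_d.+1 -> 'I_n.+1} |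
     (\sum_(i < d.+1) i * alpha i == d)%N && (\sum_(i < d.+1) alpha i == n)%N)
       \prod_l hom_fam XY (alpha l).
  rewrite burnside coefMn mulr_natl; congr (_ *+ _).
  rewrite (hom_famE _ (leqnn n)).
  (* Grouped by l, the generating product of h_n becomes a product over l; alpha_l records how much
     of the degree n comes from the factor l. *)
  rewrite -(pair_big xpredT xpredT (fun ij l => geo n ((XY ij)%:P * w l))) exchange_big /=.
  rewrite coef_prod coef_sum big_mkcondl [LHS]big_mkcond [RHS]big_mkcond.
  apply: eq_bigr => alpha _; case: (_ == n) => //.
  transitivity ((\prod_l ((hom_fam XY (alpha l))%:P * w l ^+ alpha l))`_d).
    congr (_`_ _); congr polyseq; apply: eq_bigr => l _.
    rewrite -hom_famE -1?ltnS // hom_famZ; congr (_ * _).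
    by rewrite /hom_fam rmorph_sum; apply: eq_bigr => m _; rewrite rmorph_prod;
      apply: eq_bigr => ij _; rewrite rmorphXn.
  rewrite big_split /= -rmorph_prod coefCM.
  under [X in _ * (_ X)`_d]eq_bigr do rewrite -exprM.
  rewrite prodrXr coefXn eq_sym; case: eqP => _; by rewrite ?mulr1 ?mulr0.
have E3 : n`!%:R * \sum_(alpha : {ffun 'I_d.+1 -> 'I_n.+1} |
     (\sum_(i < d.+1) i * alpha i == d)%N && (\sum_(i < d.+1) alpha i == n)%N)
       \prod_l hom_fam XY (alpha l) = \sum_(p : 'P_n) \sum_(q : 'P_n)
    (schurx n (varX rat n) n (bp p) * schurx n (varY rat n) n (bp q)) *
    (n`!%:R * (\sum_(alpha : {ffun 'I_d.+1 -> 'I_n.+1} |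
           (\sum_(i < d.+1) i * alpha i == d)%N && (\sum_(i < d.+1) alpha i == n)%N)
      \sum_(tau : {dffun forall i : 'I_d.+1, 'P_(alpha i)})
         LR_coef (fun i => parts (tau i)) q * LR_coef (fun i => parts (tau i)) p)%:~R)%:MP%:MP.
  rewrite mulr_sumr.
  under [RHS]eq_bigr do under eq_bigr do rewrite rmorph_sum mulr_sumr !rmorph_sum mulr_sumr /=.
  under [RHS]eq_bigr do rewrite exchange_big /=.
  rewrite [RHS]exchange_big /=; apply: eq_bigr => alpha /andP[_ /eqP sal].
  have aln l : (alpha l <= n)%N by rewrite -ltnS.
  rewrite (eq_bigr _ (fun l _ => hom_XY (aln l))) prod_sum_dffun mulr_sumr.
  under [RHS]eq_bigr do under eq_bigr do rewrite rmorph_sum mulr_sumr !rmorph_sum mulr_sumr /=.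
  under [RHS]eq_bigr do rewrite exchange_big /=.
  rewrite [RHS]exchange_big /=; apply: eq_bigr => tau _.
  (* The product over l of s_(tau_l)(X) s_(tau_l)(Y) separates into an X-product and a Y-product,
     each with its own Littlewood-Richardson expansion. *)
  rewrite big_split /= !(LR_schurx _ _ _ aln (leqnn n) sal) big_distrlr /= mulr_sumr.
  apply: eq_bigr => p _; rewrite mulr_sumr; apply: eq_bigr => q _.
  exact: (morph_scale cst).
rewrite -[RHS](subrr ((\sum_(g : 'S_n) inv_sum z g)`_d)) {2}E2 E3 E1 -sumrB.
apply: eq_bigr => p _; rewrite -sumrB; apply: eq_bigr => q _.
by rewrite -mulrBr !rmorphB.
Qed.

End Frobenius.

(** * Young symmetrizers *)

Lemma sum_leq_eq (I : finType) (a b : I -> nat) :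
  (forall i, a i <= b i)%N -> (\sum_i a i = \sum_i b i)%N -> forall i, a i = b i.
Proof.
move=> le e i; have := e; rewrite (bigD1 i) //= [RHS](bigD1 i) //=.
have := le i; have : (\sum_(j | j != i) a j <= \sum_(j | j != i) b j)%N.
  by apply: leq_sum => j _; apply: le.
lia.
Qed.

Section Tableau.
Variables (n : nat) (lam : 'P_n).
Local Notation row := (tab_row lam).
Local Notation col := (tab_col lam).
Implicit Types (i j : 'I_n) (f : 'I_n -> nat).

Let lt_sum i : (i < sumn lam)%N.
Proof. by rewrite sumn_part. Qed.

Lemma col_lt i : (col i < lam`_[row i])%N.
Proof. exact: reshape_offsetP. Qed.

Lemma row_lt i : (row i < n)%N.
Proof. exact: leq_trans (reshape_indexP (lt_sum i)) (size_part lam). Qed.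

Lemma row_col_inj i j : row i = row j -> col i = col j -> i = j.
Proof.
move=> er ec; apply/val_inj; rewrite /= -(reshape_indexK lam i) -(reshape_indexK lam j).
by move: er ec; rewrite /tab_row /tab_col => -> ->.
Qed.

Lemma tab_cell r c : (c < lam`_[r])%N -> exists i, row i = r /\ col i = c.
Proof.
move=> h; have lt : (flatten_index lam r c < n)%N.
  by rewrite -[X in (_ < X)%N](sumn_part lam) flatten_indexP.
exists (Ordinal lt); rewrite /tab_row /tab_col /=.
by rewrite flatten_indexKl // flatten_indexKr.
Qed.

Lemma card_row r : #|[pred i | row i == r]| = lam`_[r].
Proof.
rewrite -[RHS]card_ord.
have ex (c : 'I_(lam`_[r])) : exists i, row i = r /\ col i = c by apply: tab_cell.
have [h hP] := fin_all_exists ex.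
have hinj : injective h.
  by move=> c c' e; apply/val_inj => /=; have [_ <-] := hP c; have [_ <-] := hP c'; rewrite e.
rewrite -(card_codom hinj); apply: eq_card => i; rewrite !inE.
apply/eqP/codomP => [ri|[c ->]]; last by have [] := hP c.
have lt : (col i < lam`_[r])%N by rewrite -ri col_lt.
exists (Ordinal lt); have [e1 e2] := hP (Ordinal lt).
by apply: row_col_inj; rewrite ?e1 ?e2.
Qed.

Lemma col_bound i : (col i < n)%N.
Proof. by apply: leq_ltn_trans (ltn_ord i); apply: leq_subr. Qed.

Definition col_injective f := forall i j, col i = col j -> f i = f j -> i = j.

(** If column c has a cell outside the first k rows, it meets each of these rows, and injectivity
    bounds the left side by the k values below k. Otherwise the right side counts the whole
    column. *)
Lemma col_count f c k : col_injective f ->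
  (#|[pred i | (col i == c) && (f i < k)]| <= #|[pred i | (col i == c) && (row i < k)]|)%N.
Proof.
move=> finj; case: k => [|k]; first by rewrite [X in (X <= _)%N]eq_card0 // => i; rewrite inE ltn0 andbF.
have [/existsP[i0 /andP[/eqP c0 k0]]|none] := boolP [exists i, (col i == c) && (k < row i)%N].
  apply: (@leq_trans k.+1).
    rewrite -[X in (_ <= X)%N](card_ord k.+1).
    rewrite -(card_in_image (f := fun i => inord (f i) : 'I_k.+1)) ?max_card //.
    move=> i j; rewrite !inE => /andP[/eqP ci fi] /andP[/eqP cj fj].
    move/(congr1 val); rewrite /= !inordK // => e; apply: finj => //; by rewrite ci cj.
  have ex (r : 'I_k.+1) : exists i, row i = r /\ col i = c.
    apply: tab_cell; rewrite -c0; apply: leq_trans (col_lt i0) (part_noninc _ _).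
    by apply: ltnW; apply: leq_trans (ltn_ord r) k0.
  have [h hP] := fin_all_exists ex.
  have hinj : injective h.
    by move=> r r' e; apply/val_inj => /=; have [<- _] := hP r; have [<- _] := hP r'; rewrite e.
  rewrite -[X in (X <= _)%N](card_ord k.+1) -(card_codom hinj); apply: subset_leq_card.
  apply/subsetP => i /codomP[r ->]; rewrite inE; have [-> ->] := hP r.
  by rewrite eqxx ltn_ord.
apply: subset_leq_card; apply/subsetP => i; rewrite !inE => /andP[ci _].
rewrite ci /= ltnS leqNgt; apply: contra none => lt; apply/existsP; exists i.
by rewrite ci.
Qed.

Lemma card_by_col (P : pred 'I_n) :
  #|[pred i | P i]| = (\sum_(c < n) #|[pred i | (col i == c) && P i]|)%N.
Proof.
rewrite -sum1_card (partition_big (fun i => Ordinal (col_bound i)) xpredT) //=.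
by apply: eq_bigr => c _; rewrite -sum1_card; apply: eq_bigl => i; rewrite !inE andbC.
Qed.

(** Summed over columns, the counts show that lam dominates the content of f. *)
Lemma col_injective_dom f k : col_injective f ->
  (#|[pred i | f i < k]| <= #|[pred i | row i < k]|)%N.
Proof.
by move=> h; rewrite !card_by_col; apply: leq_sum => c _; apply: col_count.
Qed.

Lemma card_lt_sum f k :
  #|[pred i | (f i < k)%N]| = (\sum_(0 <= j < k) #|[pred i | f i == j]|)%N.
Proof.
elim: k => [|k IH]; first by rewrite big_geq // eq_card0 // => i; rewrite inE.
rewrite big_nat_recr //= -IH -!sum1_card (bigID (fun i => (f i < k)%N)) /=; congr (_ + _)%N.
  by apply: eq_bigl => i; rewrite !inE ltnS; case: ltnP => h; rewrite ?andbF // ltnW.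
by apply: eq_bigl => i; rewrite !inE ltnS -leqNgt eqn_leq.
Qed.

(** For content lam the dominance inequalities are equalities, hence so are those of the single
    columns. Then f and the row function take the same values on each column, and matching these
    values gives q. *)
Lemma col_injective_row f : col_injective f ->
  (forall r, #|[pred i | f i == r]| = lam`_[r]) ->
  exists2 q : 'S_n, q \in col_group lam & forall i, f i = row (q i).
Proof.
move=> finj fc.
have eqk k : #|[pred i | (f i < k)%N]| = #|[pred i | (row i < k)%N]|.
  by rewrite !card_lt_sum; apply: eq_bigr => j _; rewrite fc card_row.
have eqck (c : 'I_n) k : #|[pred i | (col i == c) && (f i < k)%N]| =
                #|[pred i | (col i == c) && (row i < k)%N]|.
  apply: (@sum_leq_eq _ (fun c : 'I_n => #|[pred i | (col i == c) && (f i < k)%N]|)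
    (fun c : 'I_n => #|[pred i | (col i == c) && (row i < k)%N]|)) => [c'|].
    exact: col_count.
  by rewrite -!card_by_col eqk.
have eqc c k : #|[pred i | (col i == c) && (f i == k)]| = #|[pred i | (col i == c) && (row i == k)]|.
  have [cn|nc] := ltnP c n; last first.
    rewrite !eq_card0 // => i; rewrite inE; apply/negbTE; rewrite negb_and neq_ltn;
      by rewrite (leq_trans (col_bound i) nc).
  have S u : #|[pred i | (col i == c) && (u i < k.+1)%N]| =
     (#|[pred i | (col i == c) && (u i < k)%N]| + #|[pred i | (col i == c) && (u i == k)]|)%N.
    rewrite -!sum1_card (bigID (fun i => (u i < k)%N)) /=; congr (_ + _)%N.
      by apply: eq_bigl => i; rewrite !inE; case: (col i == c) => //=; lia.
    by apply: eq_bigl => i; rewrite !inE; case: (col i == c) => //=; lia.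
  have e1 := eqck (Ordinal cn) k.+1; have e0 := eqck (Ordinal cn) k.
  by rewrite /= in e0 e1; rewrite !S e0 in e1; apply: addnI e1.
have ex i : exists j, row j = f i /\ col j = col i.
  have : (0 < #|[pred j | (col j == col i) && (row j == f i)]|)%N.
    rewrite -eqc; apply/card_gt0P; exists i; by rewrite inE !eqxx.
  by case/card_gt0P => j; rewrite inE => /andP[/eqP ? /eqP ?]; exists j.
have [h hP] := fin_all_exists ex.
have hinj : injective h.
  move=> i j e; have [ri ci] := hP i; have [rj cj] := hP j.
  by apply: finj; rewrite -?ci -?cj -?ri -?rj e.
exists (perm hinj) => [|i]; last by rewrite permE; have [] := hP i.
by rewrite inE; apply/forallP => i; rewrite permE; have [_ ->] := hP i.
Qed.

Lemma col_injectivePn f : col_injective f \/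
  exists i j, [/\ i != j, col i = col j & f i = f j].
Proof.
have [/existsP[i /existsP[j /and3P[ij /eqP c /eqP e]]]|none] :=
   boolP [exists i, exists j, [&& i != j, col i == col j & f i == f j]].
  by right; exists i, j.
left=> i j c e; apply/eqP; apply: contraNT none => ij.
by apply/existsP; exists i; apply/existsP; exists j; rewrite ij c e !eqxx.
Qed.

Lemma row_groupP (p : 'S_n) : reflect (forall i, row (p i) = row i) (p \in row_group lam).
Proof. by rewrite inE; apply: (iffP forallP) => h i; apply/eqP. Qed.

Lemma col_groupP (q : 'S_n) : reflect (forall i, col (q i) = col i) (q \in col_group lam).
Proof. by rewrite inE; apply: (iffP forallP) => h i; apply/eqP. Qed.

Lemma row_group1 : 1%g \in row_group lam.
Proof. by apply/row_groupP => i; rewrite perm1. Qed.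

Lemma col_group1 : 1%g \in col_group lam.
Proof. by apply/col_groupP => i; rewrite perm1. Qed.

Lemma row_groupM p p' : p \in row_group lam -> p' \in row_group lam -> (p * p')%g \in row_group lam.
Proof. by move=> /row_groupP h /row_groupP h'; apply/row_groupP => i; rewrite permM h' h. Qed.

Lemma col_groupM p p' : p \in col_group lam -> p' \in col_group lam -> (p * p')%g \in col_group lam.
Proof. by move=> /col_groupP h /col_groupP h'; apply/col_groupP => i; rewrite permM h' h. Qed.

Lemma row_groupV p : (p^-1%g \in row_group lam) = (p \in row_group lam).
Proof.
suff h u : u \in row_group lam -> u^-1%g \in row_group lam.
  by apply/idP/idP => [/h|/h //]; rewrite invgK.
by move/row_groupP => hu; apply/row_groupP => i; rewrite -{2}(permKV u i) hu.
Qed.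

Lemma col_groupV p : (p^-1%g \in col_group lam) = (p \in col_group lam).
Proof.
suff h u : u \in col_group lam -> u^-1%g \in col_group lam.
  by apply/idP/idP => [/h|/h //]; rewrite invgK.
by move/col_groupP => hu; apply/col_groupP => i; rewrite -{2}(permKV u i) hu.
Qed.

Lemma row_col_group1 g : g \in row_group lam -> g \in col_group lam -> g = 1%g.
Proof.
move=> /row_groupP hr /col_groupP hc; apply/permP => i; rewrite perm1.
exact: row_col_inj.
Qed.

Lemma tperm_col i j : col i = col j -> tperm i j \in col_group lam.
Proof. by move=> e; apply/col_groupP => k; case: tpermP => [->|->|]. Qed.

(* When g is not in C R, two entries of some column of the tableau lie in the same
   row after applying g, and their transposition t satisfies t g = g p. *)
Lemma col_row_factor (g : 'S_n) :
  (exists q p, [/\ q \in col_group lam, p \in row_group lam & g = (q * p)%g]) \/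
  (exists t p, [/\ t \in col_group lam, p \in row_group lam, odd_perm t & (t * g = g * p)%g]).
Proof.
have [inj|[i [j [ij cij e]]]] := col_injectivePn (fun i => row (g i)); [left|right].
  have [r|q qC qE] := col_injective_row inj.
    rewrite -(card_row r) -!sum1_card [RHS](reindex_inj (@perm_inj _ g)).
    by apply: eq_bigl => i; rewrite !inE.
  exists q, (q^-1 * g)%g; split=> //; last by rewrite mulKVg.
  by apply/row_groupP => i; rewrite permM qE permKV.
exists (tperm i j), (g^-1 * (tperm i j * g))%g; split.
- exact: tperm_col.
- apply/row_groupP => k; rewrite !permM.
  case: tpermP => [ki|kj|_ _]; last by rewrite permKV.
    by rewrite -e -ki permKV.
  by rewrite e -kj permKV.
- by rewrite odd_tperm.
- by rewrite mulKVg.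
Qed.

End Tableau.

(** In a rank factorization M = C R, the relation M M = k M forces R C = k%:M, which has the same
    trace as M. *)
Lemma mxtrace_quasi_idem (F : fieldType) m (k : F) (M : 'M[F]_m) :
  M *m M = k *: M -> \tr M = k * (\rank M)%:R.
Proof.
move=> MM; move: (col_base_full M) (row_base_free M) (mulmx_base M).
move: (col_base M) (row_base M) => C R Cfull Rfree CR.
have e : R *m C = k%:M.
  apply: (row_free_inj Rfree); apply: (row_full_inj Cfull) => /=.
  by rewrite !mulmxA CR -[LHS]mulmxA CR MM mul_mx_scalar -scalemxAl CR.
by rewrite -{1}CR mxtrace_mulC e mxtrace_scalar mulr_natr.
Qed.

(** * Convolution on S_n and the Young idempotents *)

Section GroupAlgebra.
Variables (F : fieldType) (n : nat).
Implicit Types (a b : 'S_n -> F).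

Definition conv a b (g : 'S_n) : F := \sum_h a h * b (h^-1 * g)%g.

Section Op.
Variables (m : nat) (rG : mx_representation F [set: 'S_n] m).

Definition op a : 'M[F]_m := \sum_g a g *: rG g.

Lemma op_conv a b : op (conv a b) = op a *m op b.
Proof.
rewrite /op /conv mulmx_suml; under eq_bigr do rewrite scaler_suml.
rewrite exchange_big /=; apply: eq_bigr => h _.
rewrite mulmx_sumr (reindex_inj (mulgI h)) /=; apply: eq_bigr => g _.
by rewrite mulKg repr_mxM ?inE // -scalemxAl -scalemxAr scalerA.
Qed.

Lemma opZ k a : op (fun g => k * a g) = k *: op a.
Proof. by rewrite scaler_sumr; apply: eq_bigr => g _; rewrite scalerA. Qed.

Lemma op_ext a b : a =1 b -> op a = op b.
Proof. by move=> e; apply: eq_bigr => g _; rewrite e. Qed.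

Lemma mxtrace_op a : \tr (op a) = \sum_g a g * \tr (rG g).
Proof. by rewrite raddf_sum; apply: eq_bigr => g _; rewrite /= mxtraceZ. Qed.

End Op.

Lemma mxtrace_regular (g : 'S_n) :
  \tr (regular_repr F [set: 'S_n] g) = (n`! * (g == 1%g))%N%:R.
Proof.
rewrite /mxtrace (eq_bigr (fun=> (g == 1%g)%:R)) => [|i _].
  by rewrite sumr_const card_ord /gcard cardsT card_Sn natrM mulr_natl.
rewrite /= /regular_mx !mxE eqxx /=; congr (nat_of_bool _)%:R.
rewrite -(inj_eq (@enum_val_inj _ _)) gring_indexK ?inE //.
by rewrite eq_sym -[X in (_ == X)]mulg1 (inj_eq (mulgI _)).
Qed.

End GroupAlgebra.

Section Young.
Variables (n : nat) (lam : 'P_n).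
Local Notation RG := (row_group lam).
Local Notation CG := (col_group lam).

(** The coefficient of g in the Young symmetrizer, kept integral so that it maps to every field. *)
Definition young (g : 'S_n) : int :=
  \sum_(p in RG) \sum_(q in CG) if (q * p)%g == g then (-1) ^+ odd_perm q else 0.

Lemma young_mull q g : q \in CG -> young (q * g)%g = (-1) ^+ odd_perm q * young g.
Proof.
move=> qC; rewrite mulr_sumr; apply: eq_bigr => p _.
rewrite (reindex_inj (mulgI q)) mulr_sumr /=; apply: eq_big => q'.
  by apply/idP/idP => h; [rewrite -(mulKg q q') col_groupM ?col_groupV | rewrite col_groupM].
by move=> _; rewrite -mulgA (inj_eq (mulgI q)) odd_permM signr_addb; case: eqP; rewrite ?mulr0.
Qed.

Lemma young_mulr p g : p \in RG -> young (g * p)%g = young g.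
Proof.
move=> pR; rewrite /young (reindex_inj (mulIg p)) /=; apply: eq_big => p'.
  by apply/idP/idP => h; [rewrite -(mulgK p p') row_groupM ?row_groupV | rewrite row_groupM].
by move=> _; apply: eq_bigr => q _; rewrite mulgA (inj_eq (mulIg p)).
Qed.

Lemma young1 : young 1%g = 1.
Proof.
rewrite /young (bigD1 1%g) ?row_group1 //= (bigD1 1%g) ?col_group1 //= mulg1 eqxx odd_perm1.
rewrite !big1 ?addr0 ?expr0 // => [p /andP[pR p1]|q /andP[_ q1]]; last first.
  by rewrite mulg1 (negPf q1).
rewrite big1 // => q qC; case: eqP => // qp; case/eqP: p1.
apply: (row_col_group1 pR); have -> : p = q^-1%g by apply/eqP; rewrite eq_sym eq_invg_mul qp.
by rewrite col_groupV.
Qed.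

Lemma young_inv g : young g^-1%g =
  \sum_(p in RG) \sum_(q in CG) if (p * q)%g == g then (-1) ^+ odd_perm q else 0.
Proof.
rewrite /young (reindex_inj invg_inj) /=; apply: eq_big => p; first by rewrite row_groupV.
move=> _; rewrite (reindex_inj invg_inj) /=; apply: eq_big => q; first by rewrite col_groupV.
by move=> _; rewrite -invMg (inj_eq invg_inj) odd_permV.
Qed.

Variable F : numFieldType.

Definition youngF (g : 'S_n) : F := (young g)%:~R.
Local Notation c := youngF.

Lemma youngF_mull q g : q \in CG -> c (q * g)%g = (-1) ^+ odd_perm q * c g.
Proof. by move=> qC; rewrite /youngF young_mull // rmorphM rmorph_sign. Qed.

Lemma youngF_mulr p g : p \in RG -> c (g * p)%g = c g.
Proof. by move=> pR; rewrite /youngF young_mulr. Qed.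

Lemma youngF1 : c 1%g = 1.
Proof. by rewrite /youngF young1. Qed.

Lemma youngF_sum (G : 'S_n -> F) :
  \sum_g c g * G g = \sum_(p in RG) \sum_(q in CG) (-1) ^+ odd_perm q * G (q * p)%g.
Proof.
rewrite (eq_bigr (fun g => \sum_(p in RG) \sum_(q in CG)
   if (q * p)%g == g then (-1) ^+ odd_perm q * G g else 0)) => [|g _]; last first.
  rewrite /youngF /young rmorph_sum mulr_suml; apply: eq_bigr => p _.
  rewrite rmorph_sum mulr_suml; apply: eq_bigr => q _.
  by case: eqP; rewrite ?rmorph_sign ?rmorph0 ?mul0r.
rewrite exchange_big /=; apply: eq_bigr => p _; rewrite exchange_big /=; apply: eq_bigr => q _.
by rewrite (bigD1 (q * p)%g) //= eqxx big1 ?addr0 // => g; rewrite eq_sym => /negPf ->.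
Qed.

(** By [col_row_factor], either g lies in C R, where the two rules determine y g, or t g = g p with
    t an odd column and p a row permutation, so that y g = - y g. *)
Lemma von_neumann (y : 'S_n -> F) :
  (forall q g, q \in CG -> y (q * g)%g = (-1) ^+ odd_perm q * y g) ->
  (forall p g, p \in RG -> y (g * p)%g = y g) ->
  forall g, y g = y 1%g * c g.
Proof.
move=> yl yr g; have [[q [p [qC pR ->]]]|[t [p [tC pR odt tg]]]] := col_row_factor lam g.
  by rewrite yr // youngF_mulr // -(mulg1 q) yl // youngF_mull // youngF1 mulr1 mulrC.
have zero (z : 'S_n -> F) : (forall q g, q \in CG -> z (q * g)%g = (-1) ^+ odd_perm q * z g) ->
    (forall p g, p \in RG -> z (g * p)%g = z g) -> z g = 0.
  move=> zl zr; have /eqP : z g + z g = 0.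
    by rewrite -[X in X + _](zr p) // -tg zl // odt expr1 mulN1r addNr.
  by rewrite -mulr2n mulrn_eq0 /= => /eqP.
by rewrite (zero y) // (zero c) ?mulr0 //; [apply: youngF_mull | apply: youngF_mulr].
Qed.

(** The classical constant n!/dim S^lam, obtained as the coefficient of 1 in c c. *)
Definition young_scalar : F := conv c c 1%g.
Local Notation kappa := young_scalar.

Lemma conv_young (x : 'S_n -> F) g : conv c (conv x c) g = conv c (conv x c) 1%g * c g.
Proof.
apply: von_neumann => [q {}g qC|p {}g pR]; last first.
  by apply: eq_bigr => h _; congr (_ * _); apply: eq_bigr => k _; rewrite !mulgA youngF_mulr.
rewrite /conv mulr_sumr (reindex_inj (mulgI q)) /=; apply: eq_bigr => h _.
by rewrite youngF_mull // -mulrA invMg -!mulgA mulKg.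
Qed.

Lemma conv_youngF g : conv c c g = kappa * c g.
Proof.
apply: von_neumann => [q {}g qC|p {}g pR]; last first.
  by apply: eq_bigr => h _; rewrite mulgA youngF_mulr.
rewrite /conv mulr_sumr (reindex_inj (mulgI q)) /=; apply: eq_bigr => h _.
by rewrite youngF_mull // -mulrA invMg -!mulgA mulKg.
Qed.

(** Right multiplication by c on the group algebra has trace n! c(1) = n!, whereas kappa = 0 would
    give trace 0. *)
Lemma young_scalar_neq0 : kappa != 0.
Proof.
pose M := op (regular_repr F [set: 'S_n]) c.
have MM : M *m M = kappa *: M.
  by rewrite -op_conv (op_ext _ conv_youngF) opZ.
have trM : \tr M = n`!%:R.
  rewrite mxtrace_op (bigD1 1%g) //= mxtrace_regular eqxx muln1 youngF1 mul1r.
  by rewrite big1 ?addr0 // => g /negPf g1; rewrite mxtrace_regular g1 muln0 mulr0.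
apply/eqP => k0; have := mxtrace_quasi_idem MM; rewrite trM k0 mul0r => /eqP.
by rewrite pnatr_eq0 eqn0Ngt fact_gt0.
Qed.

Definition young_idem (g : 'S_n) : F := kappa^-1 * c g.
Local Notation e := young_idem.

Lemma conv_idem : conv e e =1 e.
Proof.
move=> g; rewrite /conv /young_idem.
rewrite (eq_bigr (fun h => kappa^-1 * kappa^-1 * (c h * c (h^-1 * g)%g))) => [|h _]; last by ring.
rewrite -mulr_sumr -/(conv c c g) conv_youngF; field; exact: young_scalar_neq0.
Qed.

(** The sum of the conjugates of e; [mxtrace_specht] identifies it with the character of the Specht
    module. *)
Definition young_char (g : 'S_n) : F := \sum_x e (x * g * x^-1)%g.
Local Notation chi := young_char.

(** All conjugates of e pair equally with a class function. This exchanges inner products of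
    characters with traces of idempotents. *)
Lemma young_char_class (phi : 'S_n -> F) :
  (forall x g, phi (x * g * x^-1)%g = phi g) ->
  \sum_g chi g * phi g = n`!%:R * \sum_g e g * phi g.
Proof.
move=> cl; under eq_bigr do rewrite mulr_suml.
rewrite exchange_big /= (eq_bigr (fun=> \sum_g e g * phi g)) => [|x _]; last first.
  rewrite [RHS](reindex_inj (mulgI x)) /= [RHS](reindex_inj (mulIg x^-1%g)) /=.
  by apply: eq_bigr => g _; rewrite mulgA cl.
by rewrite sumr_const cardT -cardE card_Sn mulr_natl.
Qed.

Lemma young_charJ x g : chi (x * g * x^-1)%g = chi g.
Proof.
rewrite /young_char [RHS](reindex_inj (mulIg x)) /=; apply: eq_bigr => y _.
by rewrite invMg !mulgA.
Qed.

(* Inversion exchanges the factors of q p, and p q is conjugate to q p. *)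
Lemma young_charV g : chi g^-1%g = chi g.
Proof.
rewrite /young_char /young_idem -!mulr_sumr; congr (_ * _).
rewrite /youngF -!rmorph_sum; congr (_%:~R).
rewrite (eq_bigr (fun x => young (x * g * x^-1)^-1%g)) => [|x _]; last first.
  by rewrite !invMg invgK mulgA.
under eq_bigr do rewrite young_inv.
rewrite exchange_big [RHS]exchange_big /=; apply: eq_bigr => p _.
rewrite exchange_big [RHS]exchange_big /=; apply: eq_bigr => q _.
rewrite [RHS](reindex_inj (mulgI q)) /=; apply: eq_bigr => x _.
congr (if _ then _ else _).
rewrite invMg -!mulgA (inj_eq (mulgI q)) -(inj_eq (mulIg q)) -!mulgA.
by rewrite mulVg mulg1.
Qed.

Lemma young_char_idem : \sum_g e g * chi g = 1.
Proof.
under eq_bigr do rewrite -young_charV mulr_sumr.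
(* Up to scalars, the sum is the coefficient of x^-1 in c x^-1 c, a multiple of c by [conv_young].
   Summing over x then leaves the coefficient of 1 in e e c, which is c(1) = 1. *)
have E x : \sum_g e g * e (x * g^-1 * x^-1)%g =
           (\sum_g e g * e (x * g^-1)%g) * c x^-1%g.
  pose y g' := conv c (conv (fun k => (k == x^-1)%g%:R) c) g'.
  have yE g' : y g' = \sum_g c g * c (x * g^-1 * g')%g.
    apply: eq_bigr => g _; congr (_ * _).
    rewrite /conv (bigD1 x^-1%g) //= eqxx mul1r big1 ?addr0 => [|k /negPf ->].
      by rewrite invgK mulgA.
    by rewrite mul0r.
  have := conv_young (fun k => (k == x^-1)%g%:R) x^-1%g.
  rewrite -/(y _) -/(y _) !yE => h.
  rewrite /young_idem.
  rewrite (eq_bigr (fun g => kappa^-1 ^+ 2 * (c g * c (x * g^-1 * x^-1)%g))) => [|g _]; last by ring.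
  rewrite -mulr_sumr h.
  rewrite [in RHS](eq_bigr (fun g => kappa^-1 ^+ 2 * (c g * c (x * g^-1 * 1)%g))) => [|g _]; last first.
    by rewrite mulg1; ring.
  by rewrite -mulr_sumr mulrA.
rewrite exchange_big /=; under eq_bigr do rewrite E mulr_suml.
rewrite exchange_big /=.
rewrite (eq_bigr (fun g => \sum_u e g * e u * c (u * g)^-1%g)) => [|g _]; last first.
  by rewrite (reindex_inj (mulIg g)) /=; apply: eq_bigr => u _; rewrite mulgK.
rewrite exchange_big /=.
rewrite (eq_bigr (fun u => \sum_w e u * e (u^-1 * w)%g * c w^-1%g)) => [|u _]; last first.
  rewrite [RHS](reindex_inj (mulgI u)) /=; apply: eq_bigr => g _.
  by rewrite mulKg (mulrC (e u)).
rewrite exchange_big /=.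
under eq_bigr do rewrite -mulr_suml -/(conv _ _ _) conv_idem.
rewrite /young_idem (eq_bigr (fun w => kappa^-1 * (c w * c (w^-1 * 1)%g))) => [|w _]; last first.
  by rewrite mulg1 mulrA.
rewrite -mulr_sumr -/(conv c c 1%g) mulVf //; exact: young_scalar_neq0.
Qed.

Lemma young_char_norm : \sum_g chi g * chi g = n`!%:R.
Proof. by rewrite young_char_class ?young_char_idem ?mulr1 //; apply: young_charJ. Qed.

End Young.

Lemma inv_sumJ n (A : comNzRingType) (I : finType) (z : I -> A) (x g : 'S_n) :
  inv_sum z (x * g * x^-1)%g = inv_sum z g.
Proof.
rewrite /inv_sum; pose h (y : 'S_n) (f : {ffun 'I_n -> I}) := [ffun k => f (y k)].
rewrite (reindex (h x)) /=; last first.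
  by exists (h x^-1%g) => f _; apply/ffunP => k; rewrite !ffunE ?permK ?permKV.
apply: eq_big => [f|f _]; last first.
  rewrite [RHS](reindex_inj (@perm_inj _ x)); apply: eq_bigr => k _; by rewrite ffunE.
apply/forallP/forallP => H k.
  by have := H (x^-1%g k); rewrite !ffunE !permM !permKV.
by rewrite !ffunE !permM permKV; apply: H.
Qed.

Section StabSum.
Variables (n : nat) (lam : 'P_n).
Local Notation row := (tab_row lam).
Local Notation col := (tab_col lam).
Local Notation c := (youngF lam rat).
Local Notation CG := (col_group lam).
Local Notation RG := (row_group lam).
Implicit Type f : {ffun 'I_n -> 'I_n}.

Definition stab_sum f : rat := \sum_(g : 'S_n | [forall k, f (g k) == f k]) c g.

(** If f agrees on two entries of a column, their transposition preserves f and lies in the column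
    group, so translating by it reverses the sign of the sum. *)
Lemma stab_sum0 f : stab_sum f != 0 -> col_injective lam (fun i => f i).
Proof.
have [//|[i [j [ij cij e]]]] := col_injectivePn lam (fun i => f i).
move=> nz; case/negP: nz; set t := tperm i j.
have tf k : f (t k) = f k.
  by apply/val_inj; rewrite /t; case: tpermP => [->|->|].
have tC : t \in CG by apply: tperm_col.
have S : stab_sum f = - stab_sum f.
  rewrite {1}/stab_sum (reindex_inj (mulgI t)) /= -sumrN; apply: eq_big => g.
    apply/forallP/forallP => H k; have := H (t k); rewrite !permM ?tpermK ?tf //.
  by move=> _; rewrite youngF_mull // odd_tperm ij expr1 mulN1r.
have : stab_sum f + stab_sum f == 0 by rewrite {1}S addNr.
by rewrite -mulr2n mulrn_eq0.
Qed.

Lemma sum_idem_psumX m : \sum_g young_idem lam rat g * (psumX g)@_m =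
  (young_scalar lam rat)^-1 * \sum_(f : {ffun 'I_n -> 'I_n} | content_mon f == m) stab_sum f.
Proof.
rewrite mulr_sumr.
rewrite (eq_bigr (fun g : 'S_n => \sum_(f : {ffun 'I_n -> 'I_n} | [forall k, f (g k) == f k] && (content_mon f == m))
    (young_scalar lam rat)^-1 * c g)) => [|g _]; last first.
  by rewrite mcoeff_psumX sumr_const mulr_natr.
rewrite (exchange_big_dep (fun f : {ffun 'I_n -> 'I_n} => content_mon f == m)) /= => [|g f _ /andP[] //].
by apply: eq_bigr => f fm; rewrite mulr_sumr; apply: eq_bigl => g; rewrite fm andbT.
Qed.

Lemma content_monE f (mu : 'P_n) : content_mon f = pmon mu ->
  forall r, #|[pred i | f i == r :> nat]| = mu`_[r].
Proof.
move=> e r; have [rn|nr] := ltnP r n; last first.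
  rewrite nth_default ?(leq_trans (size_part mu)) // eq_card0 // => i; rewrite inE.
  by apply/negbTE; rewrite neq_ltn (leq_trans (ltn_ord _) nr).
have := congr1 (fun m : 'X_{1..n} => m (Ordinal rn)) e.
by rewrite /= !mnmE => <-.
Qed.

Lemma idem_psumX_tri (mu : 'P_n) :
  \sum_g young_idem lam rat g * (psumX g)@_(pmon mu) != 0 ->
  lam = mu \/ (dom_rank lam < dom_rank mu)%N.
Proof.
rewrite sum_idem_psumX mulf_eq0 negb_or => /andP[_ /eqP nz].
have [f /andP[/eqP fm /stab_sum0 inj]|none] :=
  pickP (fun f : {ffun 'I_n -> 'I_n} => (content_mon f == pmon mu) && (stab_sum f != 0)); last first.
  by case: nz; apply: big1 => f fm; have := none f; rewrite fm => /negbFE/eqP.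
apply: dom_rank_lt => k; have := col_injective_dom k inj.
rewrite (card_lt_sum (fun i => f i)) (card_lt_sum row).
rewrite (eq_bigr (fun j => mu`_[j])) => [|j _]; last exact: content_monE.
by rewrite [X in (_ <= X)%N -> _](eq_bigr (fun j => lam`_[j])) // => j _; apply: card_row.
Qed.

Definition row_fun (q : 'S_n) : {ffun 'I_n -> 'I_n} := [ffun k => Ordinal (row_lt lam (q k))].

Lemma row_fun_inj : {in CG &, injective row_fun}.
Proof.
move=> q q' /col_groupP qC /col_groupP qC' e; apply/permP => i; apply: (@row_col_inj _ lam).
  by have := congr1 (fun f : {ffun 'I_n -> 'I_n} => val (f i)) e; rewrite !ffunE.
by rewrite qC qC'.
Qed.

Lemma content_row_fun q : content_mon (row_fun q) = pmon lam.
Proof.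
apply/mnmP => r; rewrite !mnmE -card_row /content -!sum1_card.
by rewrite [RHS](reindex_inj (@perm_inj _ q)); apply: eq_bigl => i; rewrite !inE ffunE.
Qed.

(** The stabilizer of [row_fun q] is the conjugate q R q^-1, and its left factor q only contributes
    a sign. *)
Lemma stab_row_fun q : q \in CG ->
  stab_sum (row_fun q) = \sum_(p in RG) (-1) ^+ odd_perm q * c (p * q^-1)%g.
Proof.
move=> qC; rewrite /stab_sum (reindex_inj (mulgI q)) (reindex_inj (mulIg q^-1%g)) /=.
apply: eq_big => p; last by move=> _; rewrite (youngF_mull _ _ qC).
apply/forallP/row_groupP => H i.
  have := H (q^-1%g i); rewrite !ffunE !permM permKV => /eqP/(congr1 val) /=.
  by rewrite permKV.
by rewrite !ffunE -val_eqE /= !permM permKV H.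
Qed.

Lemma young_scalarE : young_scalar lam rat =
  \sum_(q in CG) \sum_(p in RG) (-1) ^+ odd_perm q * c (p * q^-1)%g.
Proof.
rewrite /young_scalar /conv youngF_sum exchange_big /=; apply: eq_bigr => q qC.
rewrite (reindex_inj invg_inj) /=; apply: eq_big => p; first by rewrite row_groupV.
by move=> _; rewrite invMg mulg1 invgK.
Qed.

(** Only the maps [row_fun q] with q in the column group contribute; they are distinct, and their
    contributions regroup to the coefficient of 1 in c c, which is kappa. *)
Lemma idem_psumX_diag : \sum_g young_idem lam rat g * (psumX g)@_(pmon lam) = 1.
Proof.
rewrite sum_idem_psumX (_ : \sum_(f | _) _ = young_scalar lam rat).
  by rewrite mulVf // young_scalar_neq0.
rewrite young_scalarE -(eq_bigr _ stab_row_fun) -(big_imset _ row_fun_inj) /=.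
rewrite (bigID (mem (row_fun @: CG))) /= [X in _ + X]big1 ?addr0.
  apply: eq_bigl => f; apply: andb_idl => /imsetP[q _ ->].
  by rewrite content_row_fun.
move=> f /andP[/eqP fm nim]; apply/eqP; apply: contraNT nim => /stab_sum0 inj.
have [q qC qE] := col_injective_row inj (content_monE fm).
apply/imsetP; exists q => //; apply/ffunP => k; apply/val_inj.
by rewrite ffunE /= -qE.
Qed.

End StabSum.

Lemma psumX_young n (g : 'S_n) : psumX g = \sum_p young_char p rat g *: schur_basis rat p.
Proof.
have cl q x (h : 'S_n) : (psumX (x * h * x^-1)%g)@_(pmon q) = (psumX h)@_(pmon q).
  by rewrite /psumX inv_sumJ.
apply: (frobenius_formula (chi := fun p => young_char p rat)) => {g} [p|p|p q].
- exact: young_char_norm.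
- by rewrite (young_char_class _ (cl p)) idem_psumX_diag mulr1.
by rewrite (young_char_class _ (cl q)) mulf_eq0 negb_or => /andP[_]; apply: idem_psumX_tri.
Qed.

(** * Homomorphisms from Specht modules *)

Section SpechtHom.
Variables (F : numFieldType) (n : nat) (lam : 'P_n).
Local Notation G := [set: 'S_n].
Local Notation aG := (regular_repr F G).
Local Notation y := (young_symmetrizer F lam).
Local Notation U := (cyclic_mx aG y).
Local Notation modU := (cyclic_mx_module aG y).
Local Notation sG := (specht F lam).
Local Notation c := (youngF lam F).
Local Notation e := (young_idem lam F).
Local Notation kappa := (young_scalar lam F).

Definition delta_row (g : 'S_n) : 'rV[F]_(#|G|) := delta_mx 0 (gring_index G g).

Definition alg_row (a : 'S_n -> F) : 'rV[F]_(#|G|) := \sum_g a g *: delta_row g.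

Lemma young_symmetrizerE : y = alg_row c.
Proof.
apply/rowP => j; rewrite /young_symmetrizer /alg_row !summxE.
transitivity (\sum_g c g * delta_row g 0 j); last first.
  by apply: eq_bigr => g _; rewrite [RHS]mxE.
rewrite youngF_sum; apply: eq_bigr => p _; rewrite summxE.
by apply: eq_bigr => q _; rewrite [LHS]mxE.
Qed.

Section Orbit.
Variables (m : nat) (rG : mx_representation F G m).

(** The morphism from the regular representation that sends the identity of the group to v. *)
Definition orbit_mx (v : 'rV[F]_m) : 'M[F]_(#|G|, m) := \matrix_i (v *m rG (enum_val i)).

Lemma delta_orbit_mx g v : delta_row g *m orbit_mx v = v *m rG g.
Proof. by rewrite -rowE rowK gring_indexK ?inE. Qed.

Lemma alg_orbit_mx a v : alg_row a *m orbit_mx v = v *m op rG a.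
Proof.
rewrite mulmx_suml mulmx_sumr; apply: eq_bigr => g _.
by rewrite -scalemxAl delta_orbit_mx -scalemxAr.
Qed.

Lemma orbit_mx_hom g v : aG g *m orbit_mx v = orbit_mx v *m rG g.
Proof.
apply/row_matrixP => i; rewrite !row_mul rowK [row i _]rowK delta_orbit_mx.
by rewrite repr_mxM ?inE // mulmxA.
Qed.

Lemma orbit_mx_is_linear : linear orbit_mx.
Proof. by move=> k u v; apply/row_matrixP => i; rewrite linearP /= !rowK mulmxDl -scalemxAl. Qed.

End Orbit.

Lemma delta_regular g h : delta_row g *m aG h = delta_row (g * h)%g.
Proof. by rewrite -rowE rowK gring_indexK ?inE. Qed.

Lemma alg_row_op a b : alg_row a *m op aG b = alg_row (conv a b).
Proof.
rewrite /alg_row /conv; under [RHS]eq_bigr do rewrite scaler_suml.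
rewrite exchange_big /= mulmx_suml; apply: eq_bigr => h _.
rewrite mulmx_sumr [RHS](reindex_inj (mulgI h)) /=; apply: eq_bigr => g _.
by rewrite mulKg -scalemxAl -scalemxAr delta_regular scalerA.
Qed.

Lemma conv_ec : conv e c =1 c.
Proof.
move=> g; rewrite /conv /young_idem.
under eq_bigr do rewrite -mulrA.
by rewrite -mulr_sumr -/(conv c c g) conv_youngF mulKf // young_scalar_neq0.
Qed.

Lemma conv_ce : conv c e =1 c.
Proof.
move=> g; rewrite /conv /young_idem.
under eq_bigr do rewrite mulrCA.
by rewrite -mulr_sumr -/(conv c c g) conv_youngF mulKf // young_scalar_neq0.
Qed.

Lemma alg_row_ext a b : a =1 b -> alg_row a = alg_row b.
Proof. by move=> ab; apply: eq_bigr => g _; rewrite ab. Qed.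

Lemma young_row_idem : y *m op aG e = y.
Proof. by rewrite young_symmetrizerE alg_row_op (alg_row_ext conv_ce). Qed.

Lemma val_sG (x : 'S_n) k (W : 'M_(k, \rank U)) :
  val_submod (W *m sG x) = val_submod W *m aG x.
Proof. by rewrite val_submodJ ?inE. Qed.

Lemma sG_gen (u : 'rV[F]_(\rank U)) : exists a, u = in_submod U y *m op sG a.
Proof.
have /cyclic_mxP[A /envelop_mxP[a ->] uE] : (val_submod u <= U)%MS by apply: val_submodP.
exists a; rewrite -[LHS]val_submodK uE mulmx_sumr; rewrite /op mulmx_sumr.
rewrite in_submodE mulmx_suml; apply: eq_big => [g|g _]; first by rewrite inE.
rewrite -!scalemxAr -scalemxAl -in_submodE in_submodJ ?cyclic_mx_id //.
exact: cyclic_mx_module.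
Qed.

Section Hom.
Variables (m : nat) (rG : mx_representation F G m).
Local Notation E := (op rG e).

Lemma op_idem : E *m E = E.
Proof. by rewrite -op_conv; apply: op_ext; apply: conv_idem. Qed.

(** A vector of the image of e is sent to its orbit map restricted to S^lam. Since y generates
    S^lam, a homomorphism is determined by the image of y, which lies in the image of e. *)
Definition specht_hom (w : 'rV[F]_(\rank E)) : 'M[F]_(\rank U, m) :=
  val_submod 1%:M *m orbit_mx rG (w *m row_base E).

Lemma specht_hom_linear : linear specht_hom.
Proof.
move=> k u v; rewrite /specht_hom mulmxDl -scalemxAl orbit_mx_is_linear.
by rewrite mulmxDr -scalemxAr.
Qed.
HB.instance Definition _ := GRing.isLinear.Build F _ _ _ specht_hom specht_hom_linear.

Lemma row_base_idem (w : 'rV[F]_(\rank E)) : w *m row_base E *m E = w *m row_base E.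
Proof.
have /submxP[X ->] : (w *m row_base E <= E)%MS.
  by rewrite (submx_trans (submxMl _ _)) ?eq_row_base.
by rewrite -mulmxA op_idem.
Qed.

Lemma young_orbit v : in_submod U y *m (val_submod 1%:M *m orbit_mx rG v) = v *m op rG c.
Proof.
rewrite mulmxA -val_submodE in_submodK ?cyclic_mx_id //.
by rewrite young_symmetrizerE alg_orbit_mx.
Qed.

Lemma op_young : op rG c = kappa *: E.
Proof.
rewrite -opZ; apply: op_ext => g; rewrite /young_idem mulVKf //.
exact: young_scalar_neq0.
Qed.

Lemma specht_homP w : specht_hom w \in homG sG rG.
Proof.
apply/mem_homG => g gG; rewrite /specht_hom mulmxA -[sG g]mul1mx -val_submodE val_sG.
by rewrite -mulmxA orbit_mx_hom mulmxA.
Qed.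

Lemma homG_op f a : f \in homG sG rG -> op sG a *m f = f *m op rG a.
Proof.
move/mem_homG => h; rewrite mulmx_suml mulmx_sumr; apply: eq_bigr => g _.
by rewrite -scalemxAl -scalemxAr h ?inE.
Qed.

Lemma homG_eq0 f : f \in homG sG rG -> in_submod U y *m f = 0 -> f = 0.
Proof.
move=> fH f0; apply/row_matrixP => i; rewrite row0 rowE.
have [a ->] := sG_gen (delta_mx 0 i).
by rewrite -mulmxA (homG_op _ fH) mulmxA f0 mul0mx.
Qed.

Lemma in_young_idem : in_submod U y *m op sG e = in_submod U y.
Proof.
rewrite -[RHS](congr1 (in_submod U) young_row_idem) /op !mulmx_sumr.
rewrite [RHS]in_submodE mulmx_suml.
apply: eq_bigr => g _; rewrite -!scalemxAr -scalemxAl -in_submodE.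
by rewrite in_submodJ ?cyclic_mx_id ?cyclic_mx_module.
Qed.

Lemma homG_spechtE : homG sG rG = limg (linfun specht_hom).
Proof.
apply/eqP; rewrite eqEsubv; apply/andP; split; apply/subvP => f; last first.
  by case/memv_imgP => w _ ->; rewrite lfunE specht_homP.
move=> fH; set v := in_submod U y *m f.
have vE : v *m E = v by rewrite /v -mulmxA -(homG_op _ fH) mulmxA in_young_idem.
have /submxP[w wE] : (v <= row_base E)%MS by rewrite eq_row_base -vE submxMl.
(* [specht_hom] sends the generator y to kappa times the given vector, hence the factor. *)
apply/memv_imgP; exists (kappa^-1 *: w); first exact: memvf.
rewrite lfunE /= linearZ /=; apply/eqP; rewrite -subr_eq0; apply/eqP/homG_eq0.
  by rewrite memvB // memvZ // specht_homP.
rewrite mulmxBr -scalemxAr /specht_hom young_orbit op_young -wE -/v -scalemxAr vE.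
by rewrite scalerA mulVf ?scale1r ?subrr // young_scalar_neq0.
Qed.

Lemma dim_homG_rank : \dim (homG sG rG) = \rank E.
Proof.
rewrite homG_spechtE limg_dim_eq; first by rewrite dimvf /dim /= mul1n.
apply/eqP; rewrite capfv -subv0; apply/subvP => w; rewrite memv_ker lfunE /= memv0 => /eqP h0.
have := young_orbit (w *m row_base E); rewrite -/(specht_hom w) h0 mulmx0 op_young.
rewrite -scalemxAr row_base_idem => /esym/eqP.
rewrite scaler_eq0 (negPf (young_scalar_neq0 lam F)) /= => /eqP h.
by apply/eqP; apply: (row_free_inj (row_base_free E)); rewrite h mul0mx.
Qed.

Lemma dim_homG_specht : (\dim (homG sG rG))%:R = \sum_g e g * \tr (rG g).
Proof.
rewrite dim_homG_rank -mxtrace_op -[LHS]mul1r; apply/esym.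
by apply: mxtrace_quasi_idem; rewrite op_idem scale1r.
Qed.

End Hom.

(** [L], left multiplication by e, projects the group algebra onto the Specht module and commutes
    with the action, so the trace of g on the module is that of [L] followed by g. The coefficient
    of x in e x g is e(x g^-1 x^-1), whence the inverse taken at the start. *)
Lemma mxtrace_specht (g : 'S_n) : \tr (sG g) = young_char lam F g.
Proof.
rewrite -young_charV; pose L := orbit_mx aG (alg_row e).
have yL : y *m L = y.
  by rewrite /L {1}young_symmetrizerE alg_orbit_mx alg_row_op (alg_row_ext conv_ec)
             -young_symmetrizerE.
have erow : alg_row e = kappa^-1 *: y.
  by rewrite young_symmetrizerE /alg_row scaler_sumr; apply: eq_bigr => h _; rewrite scalerA.
have LU : (L <= U)%MS.
  apply/row_subP => i; rewrite rowK erow -scalemxAl scalemx_sub //.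
  by rewrite mxmodule_trans ?inE // ?cyclic_mx_module // cyclic_mx_id.
have valL : val_submod 1%:M *m L = val_submod 1%:M :> 'M_(\rank U, _).
  apply/row_matrixP => i; rewrite row_mul.
  have : (row i (val_submod (1%:M : 'M_(\rank U))) <= U)%MS.
    by rewrite (submx_trans (row_sub _ _)) // val_submodP.
  case/cyclic_mxP => A /envelop_mxP[a ->] ->; rewrite -mulmxA.
  rewrite (_ : _ *m L = L *m \sum_(x in G) a x *: aG x); first by rewrite mulmxA yL.
  rewrite mulmx_suml mulmx_sumr; apply: eq_bigr => x _.
  by rewrite -scalemxAl -scalemxAr orbit_mx_hom.
pose w := in_submod U L.
have wv : w *m val_submod 1%:M = L by rewrite -val_submodE in_submodK.
have vw : val_submod 1%:M *m w = 1%:M.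
  by rewrite /w in_submodE mulmxA valL -in_submodE val_submodK.
rewrite -[sG g]mulmx1 -vw mulmxA -[sG g]mul1mx -val_submodE val_sG.
rewrite mxtrace_mulC mulmxA wv mxtrace_mulC /mxtrace.
rewrite (reindex (enum_rank_in (in_setT (1 : 'S_n)%g))) /=; last first.
  exists enum_val => [x _|i _]; first by rewrite enum_rankK_in ?inE.
  by rewrite enum_valK_in.
apply: eq_bigr => x _.
rewrite orbit_mx_hom.
have -> : (L *m aG g) (enum_rank_in (in_setT (1 : 'S_n)%g) x) (enum_rank_in (in_setT (1 : 'S_n)%g) x)
   = (row (enum_rank_in (in_setT (1 : 'S_n)%g) x) (L *m aG g)) 0 (enum_rank_in (in_setT (1 : 'S_n)%g) x).
  by rewrite [in RHS]mxE.
rewrite row_mul rowK enum_rankK_in ?inE // -mulmxA -repr_mxM ?inE //.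
rewrite mulmx_suml summxE (bigD1 (x * g^-1 * x^-1)%g) //= big1 ?addr0.
  rewrite -scalemxAl delta_regular.
  rewrite !mxE eqxx /= -(inj_eq (@enum_val_inj _ _)) enum_rankK_in ?inE // gring_indexK ?inE //.
  by rewrite mulgA mulgKV mulgKV eqxx mulr1.
move=> h hx; rewrite -scalemxAl delta_regular !mxE eqxx /=.
rewrite -(inj_eq (@enum_val_inj _ _)) enum_rankK_in ?inE // gring_indexK ?inE //.
case: eqP => [xE|]; last by rewrite mulr0.
by case/eqP: hx; rewrite -mulgA -invMg; apply: (canRL (mulgK (x * g)%g)); rewrite -xE.
Qed.

End SpechtHom.

(** * Multiplicities over a centralizer algebra *)

Lemma mxtrace_mul_delta (F : fieldType) m p (M : 'M[F]_(m, p)) i j :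
  \tr (M *m delta_mx j i) = M i j.
Proof.
rewrite -(mul_delta_mx (0 : 'I_1)) mulmxA mxtrace_mulC trace_mx11.
by rewrite -colE -rowE !mxE.
Qed.

Lemma homGM (F : fieldType) (gT : finGroupType) (G : {group gT}) n1 n2 n3
    (r1 : mx_representation F G n1) (r2 : mx_representation F G n2)
    (r3 : mx_representation F G n3) f g :
  f \in homG r1 r2 -> g \in homG r2 r3 -> f *m g \in homG r1 r3.
Proof.
move=> /mem_homG hf /mem_homG hg; apply/mem_homG => x xG.
by rewrite mulmxA hf // -!mulmxA hg.
Qed.

Lemma avg_homG (F : fieldType) (gT : finGroupType) (G : {group gT}) n1 n2
    (r1 : mx_representation F G n1) (r2 : mx_representation F G n2) f :
  \sum_(g in G) r1 g *m f *m r2 g^-1%g \in homG r1 r2.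
Proof.
apply/mem_homG => x xG; rewrite mulmx_sumr mulmx_suml.
rewrite [RHS](reindex_inj (mulgI x)) /=; apply: eq_big => [g|g gG].
  by rewrite groupMl.
have -> : ((x * g)^-1 = g^-1 * x^-1)%g by apply: invMg.
by rewrite !repr_mxM ?groupV // !mulmxA repr_mxKV.
Qed.

Section MultiplicityAbstract.
Variables (F : fieldType) (gT : finGroupType) (G : {group gT}).
Variables (s p : nat) (rS : mx_representation F G s) (rP : mx_representation F G p).
Hypothesis charG : #|G|%:R != 0 :> F.
Hypothesis endS : forall f, f \in homG rS rS -> exists a, f = a%:M.
Hypothesis s_gt0 : (0 < s)%N.

Local Notation W := (homG rS rP).
Local Notation W' := (homG rP rS).
Local Notation A := (homG rP rP).

Lemma endS_trace f : f \in homG rS rS -> \tr f != 0 -> exists a, a != 0 /\ f = a%:M.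
Proof.
move=> /endS[a ->]; rewrite mxtrace_scalar => nz; exists a; split=> //.
by apply: contraNneq nz => ->; rewrite mul0rn.
Qed.

Lemma scalarS_eq0 (a : F) : a%:M = 0 :> 'M_s -> a = 0.
Proof.
move=> h; have := congr1 (fun M : 'M_s => M (Ordinal s_gt0) (Ordinal s_gt0)) h.
by rewrite !mxE eqxx mulr1n.
Qed.

(* rho is obtained by averaging an elementary matrix chosen to give w rho a nonzero
   trace. *)
Lemma pairing_r w : w \in W -> w != 0 -> exists2 rho, rho \in W' & w *m rho = 1%:M.
Proof.
move=> wW /eqP w0; have [[i j] /= wij|none] := pickP (fun ij => w ij.1 ij.2 != 0); last first.
  by case: w0; apply/matrixP => i j; rewrite mxE; have /negbFE/eqP := none (i, j).
set rho := \sum_(g in G) rP g *m delta_mx j i *m rS g^-1%g.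
have rhoW : rho \in W' by apply: avg_homG.
have [|a [a0 aE]] := endS_trace (homGM wW rhoW).
  rewrite mulmx_sumr raddf_sum /= (eq_bigr (fun=> w i j)) => [|g gG].
    by rewrite sumr_const -mulr_natr mulf_neq0.
  rewrite !mulmxA -(mem_homG _ _ _ wW) // mxtrace_mulC !mulmxA.
  by rewrite -repr_mxM ?groupV // mulVg repr_mx1 mul1mx mxtrace_mul_delta.
exists (a^-1 *: rho); first exact: memvZ.
by rewrite -scalemxAr aE scale_scalar_mx mulVf.
Qed.

Lemma pairing_l rho : rho \in W' -> rho != 0 -> exists2 w, w \in W & w *m rho = 1%:M.
Proof.
move=> rW /eqP r0; have [[i j] /= rij|none] := pickP (fun ij => rho ij.1 ij.2 != 0); last first.
  by case: r0; apply/matrixP => i j; rewrite mxE; have /negbFE/eqP := none (i, j).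
set w := \sum_(g in G) rS g *m delta_mx j i *m rP g^-1%g.
have wW : w \in W by apply: avg_homG.
have [|a [a0 aE]] := endS_trace (homGM wW rW).
  rewrite mulmx_suml raddf_sum /= (eq_bigr (fun=> rho i j)) => [|g gG].
    by rewrite sumr_const -mulr_natr mulf_neq0.
  rewrite -(mulmxA _ (rP g^-1%g)) (mem_homG _ _ _ rW _ (groupVr gG)) mxtrace_mulC !mulmxA.
  by rewrite repr_mxKV // mxtrace_mul_delta.
exists (a^-1 *: w); first exact: memvZ.
by rewrite -scalemxAl aE scale_scalar_mx mulVf.
Qed.

Variables (w1 : 'M[F]_(s, p)) (rho1 : 'M[F]_(p, s)).
Hypothesis w1W : w1 \in W.
Hypothesis rho1W : rho1 \in W'.
Hypothesis w1rho1 : w1 *m rho1 = 1%:M.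
Let eps := rho1 *m w1.

Let w1eps : w1 *m eps = w1.
Proof. by rewrite mulmxA w1rho1 mul1mx. Qed.

Let w1_neq0 : w1 != 0.
Proof.
apply/eqP => w0; have := scalarS_eq0 (a := 1); rewrite -w1rho1 w0 mul0mx => /(_ erefl) /eqP.
by rewrite oner_eq0.
Qed.

Variables (V : vectType F) (U : {vspace V}) (act : 'M[F]_p -> V -> V).
Hypothesis act_linear : forall a, linear (act a).
Hypothesis act_linearl : forall u, linear (act^~ u).
Hypothesis act_mul : forall a b u, a \in A -> b \in A -> act (a *m b) u = act b (act a u).
Hypothesis act_U : forall a u, a \in A -> u \in U -> act a u \in U.
Variable D : {vspace V}.
Hypothesis memD : forall u, (u \in D) = (u \in U) && (act eps u == u).

Let actf a u := act a u.
HB.instance Definition _ a := GRing.isLinear.Build F _ _ _ (actf a) (act_linear a).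

(* For u = act eps u, the map of A-modules W -> V sending w1 to u. *)
Definition orbit_map u (w : 'M[F]_(s, p)) := act (rho1 *m w) u.
Lemma orbit_map_linear u : linear (orbit_map u).
Proof.
move=> a w w'; rewrite /orbit_map mulmxDr -scalemxAr; exact: act_linearl.
Qed.
HB.instance Definition _ u := GRing.isLinear.Build F _ _ _ (orbit_map u) (orbit_map_linear u).

Let omE u w : orbit_map u w = act (rho1 *m w) u. Proof. by []. Qed.

Let act0r a : act a 0 = 0. Proof. exact: (linear0 (actf a)). Qed.
Let actDr a u v : act a (u + v) = act a u + act a v. Proof. exact: (linearD (actf a)). Qed.
Let actZr a k u : act a (k *: u) = k *: act a u. Proof. exact: (linearZ_LR (actf a)). Qed.
Let act_sumr a (I : Type) (r : seq I) (P : pred I) (u : I -> V) :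
  act a (\sum_(i <- r | P i) u i) = \sum_(i <- r | P i) act a (u i).
Proof. exact: (linear_sum (actf a)). Qed.

Let actfl u a := act a u.
HB.instance Definition _ u := GRing.isLinear.Build F _ _ _ (actfl u) (act_linearl u).
Let actZl k a u : act (k *: a) u = k *: act a u. Proof. exact: (linearZ_LR (actfl u)). Qed.
Let act_suml u (I : Type) (r : seq I) (P : pred I) (a : I -> 'M[F]_p) :
  act (\sum_(i <- r | P i) a i) u = \sum_(i <- r | P i) act (a i) u.
Proof. exact: (linear_sum (actfl u)). Qed.

Let epsA : eps \in A. Proof. exact: homGM rho1W w1W. Qed.

Let rwA rho w : rho \in W' -> w \in W -> rho *m w \in A.
Proof. by move=> h h'; apply: homGM h h'. Qed.

Let pair_scalar w rho : w \in W -> rho \in W' -> exists a, w *m rho = a%:M.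
Proof. by move=> wW rW; apply: endS; apply: homGM wW rW. Qed.

Let act_pair rho w rho' w' u a : rho \in W' -> w \in W -> rho' \in W' -> w' \in W ->
  w *m rho' = a%:M -> act (rho' *m w') (act (rho *m w) u) = a *: act (rho *m w') u.
Proof.
move=> hr hw hr' hw' e; rewrite -act_mul ?rwA //.
have -> : rho *m w *m (rho' *m w') = a *: (rho *m w').
  by rewrite mulmxA -(mulmxA rho) e mul_mx_scalar -scalemxAl.
exact: actZl.
Qed.

Local Notation act1 := (fun a (f : 'M[F]_(s, p)) => f *m a).

(** Each X_i meets D in the line of the image of w1, Y meets it in 0, and D is the direct sum of
    these intersections because [eps] preserves the decomposition. *)
Lemma multiplicity_unique m : multiplicity_is A act1 act W U m -> m = \dim D.
Proof.
case=> X [Y [XYU dXY Xi Ysub Yno]].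
have [f fP] : exists f : 'I_m -> 'Hom('M[F]_(s, p), V), forall i,
    [/\ (f i @: W = X i)%VS, (lker (f i) :&: W = 0)%VS
      & forall a u, a \in A -> u \in W -> f i (u *m a) = act a (f i u)].
  by apply: (fin_all_exists (fun i => proj2 (Xi i))).
pose u i := f i w1.
have uX i : u i \in X i by have [<- _ _] := fP i; apply: memv_img.
have uE i : act eps (u i) = u i by have [_ _ h] := fP i; rewrite /u -h // w1eps.
have u0 i : u i != 0.
  apply/eqP => ui; have [_ k _] := fP i.
  have : w1 \in (lker (f i) :&: W)%VS by rewrite memv_cap memv_ker -/(u i) ui eqxx.
  by rewrite k memv0 (negPf w1_neq0).
have XU i : (X i <= U)%VS.
  by rewrite -XYU; apply: subv_trans (addvSl _ _); apply: (sumv_sup i).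
have YU : (Y <= U)%VS by rewrite -XYU addvSr.
move: (dXY); rewrite directv_addE /= => /and3P[dX _ /eqP XY0].
have dXP := directv_sum_independent dX.
(* A nonzero fixed y would give a copy of W inside Y through its orbit map. Injectivity holds since
   acting by rho w1, with w rho = 1, recovers y from the image of w. *)
have y0 y : y \in Y -> act eps y = y -> y = 0.
  move=> yY yE; apply/eqP/negPn/negP => yn0.
  apply: (Yno (linfun (orbit_map y) @: W)%VS).
  - apply/subvP => _ /memv_imgP[w wW ->]; rewrite lfunE /=.
    by apply: Ysub; rewrite ?rwA.
  - move=> a _ aA /memv_imgP[w wW ->]; rewrite lfunE /= ?omE -act_mul ?rwA //.
    apply/memv_imgP; exists (w *m a); first exact: homGM wW aA.
    by rewrite lfunE /= ?omE mulmxA.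
  exists (linfun (orbit_map y)); split=> //.
    apply/eqP; rewrite -subv0; apply/subvP => w; rewrite memv_cap memv_ker lfunE /= memv0.
    case/andP => /eqP e wW; apply/negPn/negP => w0; case/eqP: yn0.
    have [rho rW wr] := pairing_r wW w0.
    have := act_pair y rho1W wW rW w1W wr; rewrite scale1r -/eps yE => <-.
    by rewrite -omE e act0r.
  by move=> a w aA wW; rewrite !lfunE /= ?omE mulmxA act_mul ?rwA.
have DE : D = (\sum_i <[u i]>)%VS.
  apply/eqP; rewrite eqEsubv; apply/andP; split; last first.
    apply/subv_sumP => i _; rewrite -memvE memD uE eqxx andbT.
    exact: subvP (XU i) _ (uX i).
  apply/subvP => v; rewrite memD => /andP[vU /eqP vE].
  move: (vU); rewrite -XYU => /memv_addP[x xX [y yY vxy]].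
  have /memv_sumP[x_ x_X xE] := xX.
  have eX i : act eps (x_ i) \in X i by have [h _] := Xi i; apply: h; rewrite ?x_X.
  have eY : act eps y \in Y by apply: Ysub.
  have exX : act eps x \in (\sum_i X i)%VS.
    by rewrite xE act_sumr; apply/memv_sumP; exists (fun i => act eps (x_ i)).
  (* [eps] preserves both summands, so by directness it fixes each component of v. *)
  have yy : act eps y = y.
    have : act eps y - y \in ((\sum_i X i) :&: Y)%VS.
      rewrite memv_cap; apply/andP; split; last exact: memvB.
      have -> : act eps y - y = x - act eps x.
        by apply/eqP; rewrite subr_eq addrAC eq_sym subr_eq -actDr (addrC y) -vxy vE.
      exact: memvB.
    by rewrite XY0 memv0 subr_eq0 => /eqP.
  have yz := y0 y yY yy; rewrite yz addr0 in vxy.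
  have ex i : act eps (x_ i) = x_ i.
    have : \sum_i (act eps (x_ i) - x_ i) = 0.
      by rewrite sumrB -act_sumr -xE -vxy vE subrr.
    move/(dXP _ (fun i _ => memvB (eX i) (x_X i isT)))/(_ i isT)/eqP.
    by rewrite subr_eq0 => /eqP.
  rewrite vxy xE; apply: memv_sumr => i _.
  have [fX _ fh] := fP i; have : x_ i \in X i := x_X i isT.
  rewrite -fX => /memv_imgP[w wW xw].
  (* w eps = (w rho1) w1 is a multiple of w1, so a fixed vector of X_i lies on the line of u_i. *)
  have [a wa] := pair_scalar wW rho1W.
  rewrite -(ex i) xw -fh // mulmxA wa mul_scalar_mx linearZ /= memvZ // memv_line //.
rewrite DE.
have dU : directv (\sum_i <[u i]>).
  apply/directv_sum_independent => v vU sv i _.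
  apply: (dXP v) => // j _; have h : (<[u j]> <= X j)%VS by rewrite -memvE.
  exact: (subvP h) (vU j isT).
move: dU; rewrite directvE /= => /eqP ->.
rewrite (eq_bigr (fun=> 1%N)) => [|i _]; last by rewrite dim_vline u0.
by rewrite sum1_card card_ord.
Qed.

Let scal (f : 'M[F]_s) : F := f (Ordinal s_gt0) (Ordinal s_gt0).

Let scalE w rho : w \in W -> rho \in W' -> w *m rho = (scal (w *m rho))%:M.
Proof.
by move=> wW rW; have [a ->] := pair_scalar wW rW; rewrite /scal mxE eqxx mulr1n.
Qed.

(** Acting by rho w1 turns the sum into a combination of the u_j with the scalars w_j rho as
    coefficients; a rho dual to w_i isolates a nonzero one. *)
Lemma orbit_maps_free m (u : 'I_m -> V) (w : 'I_m -> 'M[F]_(s, p)) :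
  (forall i, act eps (u i) = u i) ->
  (forall a : 'I_m -> F, \sum_i a i *: u i = 0 -> forall i, a i = 0) ->
  (forall i, w i \in W) ->
  (forall rho, rho \in W' -> act (rho *m w1) (\sum_i orbit_map (u i) (w i)) = 0) ->
  forall i, w i = 0.
Proof.
move=> uE ufree wW h i; apply/eqP/negPn/negP => wi.
have [rho rW wr] := pairing_r (wW i) wi.
have := h rho rW; rewrite act_sumr (eq_bigr (fun j => scal (w j *m rho) *: u j)) => [|j _].
  move/ufree/(_ i); rewrite wr /scal mxE eqxx mulr1n => /eqP; by rewrite oner_eq0.
by rewrite omE (act_pair _ rho1W (wW j) rW w1W (scalE (wW j) rW)) -/eps uE.
Qed.

Let bW' := vbasis W'.
Let bW := vbasis W.

Let bW'_in (i : 'I_(\dim W')) : bW'`_i \in W'.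
Proof. by apply: vbasis_mem; rewrite mem_nth // size_tuple. Qed.

Let bW_in (i : 'I_(\dim W)) : bW`_i \in W.
Proof. by apply: vbasis_mem; rewrite mem_nth // size_tuple. Qed.

(* The projection of P onto its S-isotypic component. *)
Lemma isotypic_proj : exists Q : 'M[F]_(\dim W', \dim W), forall rho, rho \in W' ->
  (\sum_i \sum_j Q i j *: (bW'`_i *m bW`_j)) *m rho = rho.
Proof.
(* The Gram matrix of the pairing of W with W'. No nonzero rho is killed by all of W, so it has a
   left inverse, which is Q. *)
pose P : 'M[F]_(\dim W, \dim W') := \matrix_(j, i) scal (bW`_j *m bW'`_i).
have : row_full P.
  rewrite /row_full -mxrank_tr -/(row_free _); apply: inj_row_free => v vP.
  pose rho := \sum_i v 0 i *: bW'`_i.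
  have rW : rho \in W' by apply: memv_suml => i _; apply: memvZ.
  have b0 (j : 'I_(\dim W)) : bW`_j *m rho = 0 :> 'M_s.
    rewrite mulmx_sumr (eq_bigr (fun i => (v 0 i * P j i)%:M)) => [|i _].
      have := congr1 (fun M : 'rV_(\dim W) => M 0 j) vP; rewrite !mxE => e.
      rewrite -raddf_sum /= -[RHS](raddf0 (@scalar_mx _ s)); congr (_%:M).
      by rewrite -[RHS]e; apply: eq_bigr => i _; rewrite !mxE.
    by rewrite -scalemxAr scalE // mxE scale_scalar_mx.
  have rho0 : rho = 0.
    apply/eqP/negPn/negP => rn0; have [w wW wr] := pairing_l rW rn0.
    have := scalarS_eq0 (a := 1); rewrite -wr (coord_vbasis wW) mulmx_suml big1 => [|j _].
      by move/(_ erefl)/eqP; rewrite oner_eq0.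
    by rewrite -scalemxAl b0 scaler0.
  have /freeP fr := basis_free (vbasisP W').
  by apply/rowP => i; rewrite mxE; apply: (fr (fun i => v 0 i)).
case/row_fullP => Q QP; exists Q => rho rW; rewrite {1 2}(coord_vbasis rW).
rewrite mulmx_sumr; apply: eq_bigr => l _; rewrite -scalemxAr; congr (_ *: _).
rewrite mulmx_suml (eq_bigr (fun i => (Q *m P) i l *: bW'`_i)) => [|i _].
  rewrite QP (bigD1 l) //= mxE eqxx scale1r big1 ?addr0 // => i il.
  by rewrite mxE (negPf il) scale0r.
rewrite mulmx_suml mxE scaler_suml; apply: eq_bigr => j _.
by rewrite mxE -scalemxAl -mulmxA [X in _ *m X]scalE // mul_mx_scalar scalerA.
Qed.

(** The X_i are generated by a basis of D, and Y consists of the vectors killed by all rho w1, in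
    particular those on which A acts as zero. The isotypic projection E0 splits v into E0 v in the
    sum of the X_i and v - E0 v in Y. *)
Lemma multiplicity_exists : multiplicity_is A act1 act W U (\dim D).
Proof.
have [Q QE] := isotypic_proj.
pose b := vbasis D; pose u (i : 'I_(\dim D)) := b`_i.
have uD i : u i \in D by apply: vbasis_mem; rewrite mem_nth // size_tuple.
have uU i : u i \in U by have := uD i; rewrite memD => /andP[].
have uE i : act eps (u i) = u i by have := uD i; rewrite memD => /andP[_ /eqP].
have ufree (a : 'I_(\dim D) -> F) : \sum_i a i *: u i = 0 -> forall i, a i = 0.
  by have /freeP fr := basis_free (vbasisP D); apply: (fr a).
pose X i := (linfun (orbit_map (u i)) @: W)%VS.
have XP i v : reflect (exists2 w, w \in W & v = orbit_map (u i) w) (v \in X i).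
  by apply: (iffP memv_imgP) => -[w wW ->]; exists w; rewrite ?lfunE.
pose Y := (U :&: \bigcap_(i < \dim W') lker (linfun (actf (bW'`_i *m w1))))%VS.
have YP v : v \in Y <-> v \in U /\ forall rho, rho \in W' -> act (rho *m w1) v = 0.
  rewrite memv_cap; split=> [/andP[vU]|[vU h]]; last first.
    rewrite vU memvE; apply/subv_bigcapP => i _; rewrite -memvE memv_ker lfunE /=.
    by apply/eqP/h.
  rewrite memvE => /subv_bigcapP h; split=> // rho rW.
  rewrite (coord_vbasis rW) mulmx_suml act_suml big1 // => i _.
  rewrite -scalemxAl actZl; have := h i isT.
  by rewrite -memvE memv_ker lfunE /= => /eqP; rewrite /actf => ->; rewrite scaler0.
have XU i : (X i <= U)%VS.
  by apply/subvP => v /XP[w wW ->]; rewrite omE; apply: act_U; rewrite ?rwA.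
have sumX v : v \in (\sum_i X i)%VS -> exists2 w : 'I_(\dim D) -> 'M_(s, p),
    forall i, w i \in W & v = \sum_i orbit_map (u i) (w i).
  case/memv_sumP => x xX ->.
  have ex i : exists w, w \in W /\ x i = orbit_map (u i) w.
    by have /XP[w wW xw] := xX i isT; exists w.
  have [w wP] := fin_all_exists ex.
  by exists w => [i|]; [have [] := wP i | apply: eq_bigr => i _; have [] := wP i].
exists X, Y; split.
- apply/eqP; rewrite eqEsubv subv_add capvSl andbT; apply/andP; split.
    by apply/subv_sumP => i _.
  apply/subvP => v vU.
  pose E0 := \sum_i \sum_j Q i j *: (bW'`_i *m bW`_j).
  have E0A : E0 \in A.
    by apply: memv_suml => i _; apply: memv_suml => j _; apply/memvZ/rwA.
  rewrite -(subrK (act E0 v) v) addrC; apply: memv_add.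
    rewrite act_suml; apply: memv_suml => i _; rewrite act_suml; apply: memv_suml => j _.
    rewrite actZl; apply: memvZ.
    have vD : act (bW'`_i *m w1) v \in D.
      rewrite memD act_U ?rwA //=; apply/eqP.
      by rewrite -act_mul ?rwA // -mulmxA w1eps.
    have -> : act (bW'`_i *m bW`_j) v = act (rho1 *m bW`_j) (act (bW'`_i *m w1) v).
      by rewrite (act_pair _ _ _ _ _ w1rho1) ?scale1r.
    rewrite (coord_vbasis vD) act_sumr; apply: memv_sumr => l _.
    by rewrite actZr; apply: memvZ; apply/XP; exists bW`_j.
  apply/YP; split=> [|rho rW]; first by rewrite memvB // act_U.
  have -> : act (rho *m w1) (v - act E0 v) = act (rho *m w1) v - act (rho *m w1) (act E0 v).
    exact: (linearB (actf _)).
  by rewrite -[X in _ - X]act_mul ?rwA // mulmxA QE // subrr.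
- rewrite directv_addE /=; apply/and3P; split.
  + apply/directv_sum_independent => x xX sx i _.
    have ex j : exists w, w \in W /\ x j = orbit_map (u j) w.
      by have /XP[w wW xw] := xX j isT; exists w.
    have [w wP] := fin_all_exists ex.
    have -> : x i = orbit_map (u i) (w i) by have [] := wP i.
    rewrite (orbit_maps_free (w := w) uE ufree) ?linear0 // => [j|rho rW].
      by have [] := wP j.
    by rewrite -(eq_bigr _ (fun j _ => proj2 (wP j))) sx act0r.
  + by rewrite directv_trivial.
  rewrite -subv0; apply/subvP => v; rewrite memv_cap memv0 => /andP[/sumX[w wW ->] /YP[_ h]].
  by rewrite big1 // => i _; rewrite (orbit_maps_free uE ufree wW h) linear0.
- move=> i; split=> [a _ aA /XP[w wW ->]|].
    rewrite omE -act_mul ?rwA //; apply/XP; exists (w *m a); first exact: homGM wW aA.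
    by rewrite omE mulmxA.
  exists (linfun (orbit_map (u i))); split=> //.
    apply/eqP; rewrite -subv0; apply/subvP => w; rewrite memv_cap memv_ker lfunE /= memv0.
    case/andP => /eqP e wW; apply/eqP.
    have := @orbit_maps_free _ u (fun j => if j == i then w else 0) uE ufree.
    have h1 j : (if j == i then w else 0) \in W by case: ifP; rewrite ?mem0v.
    move/(_ h1) => h2; have := h2 _ i; rewrite eqxx; apply=> rho _.
    rewrite big1 ?act0r // => j _; case: eqP => [->//|_]; exact: linear0.
  by move=> a w aA wW; rewrite !lfunE /= !omE mulmxA act_mul ?rwA.
- move=> a v aA /YP[vU h]; apply/YP; split=> [|rho rW]; first exact: act_U.
  by rewrite -act_mul ?rwA // mulmxA h //; apply: homGM aA rW.
move=> Z ZY _ [f [fZ fk fa]].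
have : f w1 \in Y by apply: (subvP ZY); rewrite -fZ memv_img.
case/YP => _ /(_ rho1 rho1W); rewrite -/eps -fa // w1eps => f0.
have : w1 \in (lker f :&: W)%VS by rewrite memv_cap memv_ker f0 eqxx.
by rewrite fk memv0 (negPf w1_neq0).
Qed.

Lemma multiplicityE m : multiplicity_is A act1 act W U m <-> m = \dim D.
Proof.
by split=> [|->]; [apply: multiplicity_unique | apply: multiplicity_exists].
Qed.

End MultiplicityAbstract.

(** * Homomorphisms into the image of an equivariant idempotent *)

Section FixedHom.
Variables (F : fieldType) (gT : finGroupType) (G : {group gT}).
Variables (m : nat) (rG : mx_representation F G m) (N : 'M[F]_m).
Hypothesis N_idem : N *m N = N.
Hypothesis N_hom : N \in homG rG rG.

Lemma idem_mxmodule : mxmodule rG N.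
Proof. by apply/mxmoduleP => x xG; rewrite -(mem_homG _ _ _ N_hom) // submxMl. Qed.

Local Notation rN := (submod_repr idem_mxmodule).

Lemma idem_id k (u : 'M[F]_(k, m)) : (u <= N)%MS -> u *m N = u.
Proof. by case/submxP => X ->; rewrite -mulmxA N_idem. Qed.

(** The inclusion of the image and the coordinates [w] compose to N one way and to the identity the
    other way; the trace is moved around cyclically. *)
Lemma mxtrace_idem_repr x : x \in G -> \tr (rN x) = \tr (rG x *m N).
Proof.
move=> xG; pose w := in_submod N N.
have wv : w *m val_submod 1%:M = N by rewrite -val_submodE in_submodK.
have vw : val_submod 1%:M *m w = 1%:M.
  by rewrite /w in_submodE mulmxA idem_id ?val_submodP // -in_submodE val_submodK.
rewrite -[rN x]mulmx1 -vw mulmxA -[rN x]mul1mx -val_submodE val_submodJ //.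
by rewrite mxtrace_mulC mulmxA wv mxtrace_mulC.
Qed.

Definition fixed_hom s (rS : mx_representation F G s) : {vspace 'M[F]_(s, m)} :=
  (homG rS rG :&: lker (linfun (mulmxr N \- idfun)))%VS.

Lemma mem_fixed_hom s (rS : mx_representation F G s) u :
  (u \in fixed_hom rS) = (u \in homG rS rG) && (u *m N == u).
Proof. by rewrite memv_cap memv_ker lfunE /= subr_eq0. Qed.

Lemma dim_fixed_hom s (rS : mx_representation F G s) :
  \dim (fixed_hom rS) = \dim (homG rS rN).
Proof.
pose f := linfun (mulmxr (val_submod (1%:M : 'M_(\rank N))) : 'M[F]_(s, _) -> 'M_(s, m)).
have fE u : f u = val_submod u by rewrite lfunE /= -val_submodE.
have -> : fixed_hom rS = (f @: homG rS rN)%VS.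
  apply/eqP; rewrite eqEsubv; apply/andP; split; apply/subvP => u.
    rewrite mem_fixed_hom => /andP[/mem_homG uH /eqP uN].
    have uS : (u <= N)%MS by rewrite -uN submxMl.
    apply/memv_imgP; exists (in_submod N u); last by rewrite fE in_submodK.
    apply/mem_homG => x xG; rewrite -in_submodJ // -uH //.
    by rewrite in_submodE mulmxA -in_submodE.
  case/memv_imgP => v /mem_homG vH ->; rewrite fE mem_fixed_hom idem_id ?val_submodP // eqxx andbT.
  apply/mem_homG => x xG; rewrite -(val_submodJ idem_mxmodule) // -vH //.
  by rewrite val_submodE mulmxA -val_submodE.
apply: limg_dim_eq; apply/eqP; rewrite -subv0; apply/subvP => v.
rewrite memv_cap memv_ker fE memv0 => /andP[_ /eqP v0]; apply/eqP.
by apply: (@val_submod_inj _ _ N); rewrite v0 linear0.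
Qed.

End FixedHom.

(** * The inclusion [phi]: multiplicativity, equivariance and trace *)

Section Phi.
Variables (F : fieldType) (n k r d : nat).
Hypothesis ledr : (d <= r)%N.
Local Notation Pd := (pol_repr F n (colours_upto k k.-1) (r - d)).
Local Notation PR := (pol_repr F n (colours_upto k k) r).
Local Notation PQ := (pol_repr F n (colour k k) d).
Local Notation phi := (phi (F := F) (n := n) (k := k) r d).

Lemma mon_inj (S : {set 'I_k}) s : injective (@mon n k S s).
Proof. by move=> a b /val_inj/enum_val_inj. Qed.

Lemma mon_eq (S : {set 'I_k}) s (a b : 'I_#|monomials n S s|) : (mon a == mon b) = (a == b).
Proof. exact: (inj_eq (@mon_inj S s)). Qed.

Lemma pol_mxE (S : {set 'I_k}) s g (a b : 'I_#|monomials n S s|) :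
  pol_mx F S s g a b = (mon_act g (mon a) == mon b)%:R.
Proof. by rewrite mxE poly_actX mcoeffX. Qed.

Lemma mon_actK (g : 'S_n) : cancel (@mon_act n k g) (mon_act g^-1).
Proof.
move=> m; rewrite -mon_actM mulgV; apply/mnmP => t.
by rewrite mnmE invg1 var_act1.
Qed.

Lemma mon_actD (g : 'S_n) (m m' : 'X_{1..#|{: 'I_n * 'I_k}|}) :
  mon_act g (m + m')%MM = (mon_act g m + mon_act g m')%MM.
Proof. by apply/mnmP => t; rewrite !mnmE. Qed.

Lemma pol_mx_tr (S : {set 'I_k}) s g : (pol_mx F S s g)^T = pol_mx F S s g^-1%g :> 'M_#|monomials n S s|.
Proof.
apply/matrixP => a b; rewrite mxE !pol_mxE; congr (nat_of_bool _)%:R.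
by rewrite -(inj_eq (can_inj (mon_actK g^-1))) mon_actK eq_sym.
Qed.

Definition mon_move (g : 'S_n) (y : 'I_#|monomials n (colour k k) d|) :=
  sval (mon_actP g y).

Lemma mon_moveE g y : mon (mon_move g y) = mon_act g (mon y).
Proof. exact: (svalP (mon_actP g y)). Qed.

Lemma mon_move_inj g : injective (mon_move g).
Proof.
move=> y z /(congr1 (@mon _ _ _ _)); rewrite !mon_moveE => /(can_inj (mon_actK g)).
exact: mon_inj.
Qed.

Definition embed (y : 'I_#|monomials n (colour k k) d|) :=
  mulmon_mx F (colours_upto k k.-1) (colours_upto k k) (r - d) r (mon y).
Local Notation M := embed.

Lemma embedE y a b : M y a b = ((mon a + mon y)%MM == mon b)%:R.
Proof. by rewrite mxE -mpolyXD mcoeffX. Qed.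

Lemma embedK y z : M y *m (M z)^T = (y == z)%:R%:M.
Proof.
by rewrite /embed /mon mulmon_mxK ?enum_valP // (inj_eq enum_val_inj).
Qed.

Lemma phiE a : phi a = \sum_y (M y)^T *m a *m M y.
Proof. by rewrite /Defs.phi big_enum_val. Qed.

(** g acts on the first factor and permutes the summands, carrying that of y to that of g y. *)
Lemma embed_act g y : M y *m PR g = Pd g *m M (mon_move g y).
Proof.
apply/matrixP => a b; rewrite !mxE.
have [c cE] : exists c : 'I_#|monomials n (colours_upto k k) r|, mon c = (mon a + mon y)%MM.
  have lt : (mdeg (mon a + mon y)%MM < r.+1)%N.
    have := enum_valP a; have := enum_valP y; rewrite !inE mdegD => /andP[/eqP -> _] /andP[/eqP -> _].
    by rewrite subnK.
  have cT : BMultinom lt \in monomials n (colours_upto k k) r.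
    rewrite inE /= mdegD; have := enum_valP a; have := enum_valP y.
    rewrite !inE => /andP[/eqP -> _] /andP[/eqP -> _].
    by rewrite subnK // eqxx; apply/forallP => t; rewrite inE ltn_ord implybT.
  by exists (enum_rank_in cT (BMultinom lt)); rewrite /mon enum_rankK_in.
have [a' aE] := mon_actP g a.
rewrite (bigD1 c) //= [RHS](bigD1 a') //= !big1 ?addr0.
- by rewrite !embedE !pol_mxE cE aE !eqxx !mul1r mon_moveE mon_actD.
- by move=> i ia; rewrite pol_mxE -aE mon_eq eq_sym (negPf ia) mul0r.
- by move=> i ic; rewrite embedE -cE mon_eq eq_sym (negPf ic) mul0r.
Qed.

Lemma act_embed g y : PR g *m (M (mon_move g y))^T = (M y)^T *m Pd g.
Proof.
apply: trmx_inj; rewrite !trmx_mul !trmxK.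
have -> : (PR g)^T = PR g^-1%g by apply: pol_mx_tr.
have -> : (Pd g)^T = Pd g^-1%g by apply: pol_mx_tr.
rewrite embed_act; congr (_ *m M _); apply: mon_inj.
by rewrite !mon_moveE mon_actK.
Qed.

Lemma phi_hom a : a \in homG Pd Pd -> phi a \in homG PR PR.
Proof.
move/mem_homG => aH; apply/mem_homG => g gG; rewrite phiE mulmx_sumr mulmx_suml.
rewrite (reindex_inj (@mon_move_inj g)) /=; apply: eq_bigr => y _.
by rewrite !mulmxA act_embed -[RHS]mulmxA embed_act -(mulmxA _ (Pd g)) aH // !mulmxA.
Qed.

Lemma phiM a b : phi (a *m b) = phi a *m phi b.
Proof.
rewrite !phiE mulmx_suml; apply: eq_bigr => y _; rewrite mulmx_sumr (bigD1 y) //=.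
rewrite big1 ?addr0 => [|z zy]; rewrite !mulmxA -(mulmxA _ (M y)) embedK.
  by rewrite eqxx mulmx1 ?mulmxA.
by rewrite eq_sym (negPf zy) raddf0 mulmx0 !mul0mx.
Qed.

Lemma phi_linear : linear phi.
Proof.
move=> c a b; rewrite !phiE scaler_sumr -big_split /=; apply: eq_bigr => y _.
by rewrite mulmxDr mulmxDl -scalemxAr -scalemxAl.
Qed.

(** Only the summands with g y = y contribute, each by the trace of g a, and their number is the
    trace of g on Q. *)
Lemma mxtrace_phi a g : \tr (PR g *m phi a) = \tr (Pd g *m a) * \tr (PQ g).
Proof.
have -> : \tr (PQ g) = \sum_y (mon_move g y == y)%:R.
  by apply: eq_bigr => y _; rewrite /= pol_mxE -mon_moveE mon_eq.
rewrite mxtrace_mulC phiE mulmx_suml raddf_sum mulr_sumr; apply: eq_bigr => y _ /=.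
rewrite -(mulmxA _ (M y)) embed_act mulmxA mxtrace_mulC !mulmxA embedK.
by rewrite mul_scalar_mx -!scalemxAl mxtraceZ mulrC mxtrace_mulC.
Qed.

End Phi.

(** * The two sides of the theorem *)

Section PermChar.
Variables (F : fieldType) (n k d : nat).
Hypothesis k_gt0 : (0 < k)%N.
Local Notation mons := (monomials n (colour k k) d).

Let kmax_lt : (k.-1 < k)%N. Proof. by rewrite prednK. Qed.
Let kmax : 'I_k := Ordinal kmax_lt.

Let var (i : 'I_n) : 'I_#|{: 'I_n * 'I_k}| := enum_rank (i, kmax).

Let in_colour j : (j \in colour k k) = (j == kmax).
Proof. by rewrite inE -val_eqE /= -[RHS]eqSS prednK. Qed.

Lemma mdeg_colour (m : 'X_{1..#|{: 'I_n * 'I_k}|}) :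
  (forall t, m t != 0%N -> (enum_val t).2 = kmax) -> mdeg m = (\sum_i m (var i))%N.
Proof.
move=> supp; rewrite mdegE (reindex (@enum_rank _)) /=; last first.
  by exists enum_val => x _; rewrite ?enum_rankK ?enum_valK.
rewrite (eq_bigr (fun ij => m (enum_rank (ij.1, ij.2)))) => [|[i j] _ //].
rewrite -(pair_bigA _ (fun i j => m (enum_rank (i, j)))) /=; apply: eq_bigr => i _.
rewrite (bigD1 kmax) //= big1 ?addn0 // => j jk; apply/eqP.
by apply: contraNT jk => /supp; rewrite enum_rankK /= => ->.
Qed.

Let supp_mon (a : 'I_#|mons|) t : mon a t != 0%N -> (enum_val t).2 = kmax.
Proof.
have := enum_valP a; rewrite inE => /andP[_ /forallP /(_ t) /implyP h] /h.
by rewrite in_colour => /eqP.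
Qed.

Let deg_mon (a : 'I_#|mons|) : mdeg (mon a) = d.
Proof. by have := enum_valP a; rewrite inE => /andP[/eqP]. Qed.

Let val_mon (a : 'I_#|mons|) i : (mon a (var i) < d.+1)%N.
Proof.
rewrite ltnS -[X in (_ <= X)%N](deg_mon a) (mdeg_colour (@supp_mon a)).
by rewrite (bigD1 i) //= leq_addr.
Qed.

Let fun_of (a : 'I_#|mons|) : {ffun 'I_n -> 'I_d.+1} := [ffun i => inord (mon a (var i))].

Let fun_ofE a i : fun_of a i = mon a (var i) :> nat.
Proof. by rewrite ffunE inordK // val_mon. Qed.

Let monE (a : 'I_#|mons|) t :
  mon a t = if (enum_val t).2 == kmax then mon a (var (enum_val t).1) else 0%N.
Proof.
case: eqP => [e|ne].
  by congr (mon a _); rewrite /var -e -surjective_pairing enum_valK.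
by apply/eqP; apply: contra_notT ne; apply: supp_mon.
Qed.

Let fun_of_inj : injective fun_of.
Proof.
move=> a b e; apply: mon_inj; apply/mnmP => t; rewrite (monE a t) (monE b t); case: ifP => // _.
by rewrite -!fun_ofE e.
Qed.

(** Monomials of colour k are given by their exponents on 'I_n, and g fixes such a monomial exactly
    when these are constant on the cycles of g. *)
Lemma mxtrace_pol_colour g : \tr (pol_repr F n (colour k k) d g) = (perm_char d g)%:R.
Proof.
have varg (i : 'I_n) : var_act g^-1%g (var (g i)) = var i.
  by rewrite /var_act enum_rankK /= permK.
rewrite /mxtrace (eq_bigr (fun a => (mon_act g (mon a) == mon a)%:R)) => [|a _]; last first.
  by rewrite /= pol_mxE.
rewrite -natr_sum -big_mkcond sum1_card; congr (_%:R).
rewrite -[LHS](card_image fun_of_inj); apply: eq_card => f; rewrite inE.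
apply/imageP/andP => [[a ga0 ->]|[/forallP fg /eqP fd]].
  have ga : mon_act g (mon a) = mon a by apply/eqP; exact: ga0.
  split; last first.
    by rewrite (eq_bigr _ (fun i _ => fun_ofE a i)) -(mdeg_colour (@supp_mon a)) deg_mon.
  apply/forallP => i; rewrite -val_eqE /= !fun_ofE; apply/eqP.
  have := congr1 (fun m : 'X_{1..#|{: 'I_n * 'I_k}|} => m (var (g i))) ga.
  by rewrite /= mnmE varg => ->.
pose m : 'X_{1..#|{: 'I_n * 'I_k}|} :=
  [multinom if (enum_val t).2 == kmax then (f (enum_val t).1 : nat) else 0%N | t < _].
have mvar i : m (var i) = f i by rewrite mnmE enum_rankK eqxx.
have msupp t : m t != 0%N -> (enum_val t).2 = kmax.
  by rewrite mnmE; case: (eqVneq (enum_val t).2 kmax).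
have mdegd : mdeg m = d.
  by rewrite (mdeg_colour msupp) -[RHS]fd; apply: eq_bigr => i _; rewrite mvar.
have lt : (mdeg m < d.+1)%N by rewrite mdegd.
have mS : BMultinom lt \in mons.
  rewrite inE /= mdegd eqxx /=; apply/forallP => t; apply/implyP => /msupp ->.
  by rewrite in_colour.
have aE : mon (enum_rank_in mS (BMultinom lt)) = m by rewrite /mon enum_rankK_in.
exists (enum_rank_in mS (BMultinom lt)).
  have e : mon_act g m = m.
    apply/mnmP => t; rewrite !mnmE /var_act enum_rankK /=.
    by case: ifP => // _; rewrite -(eqP (fg (g^-1%g _))) permKV.
  have h : mon_act g (mon (enum_rank_in mS (BMultinom lt))) ==
    mon (enum_rank_in mS (BMultinom lt)) by rewrite aE e.
  exact: h.
by apply/ffunP => i; apply/val_inj; rewrite /= fun_ofE aE mvar.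
Qed.

End PermChar.

Section Transfer.
Variables (F : numFieldType) (n : nat) (lam : 'P_n).

Lemma young_char_ratr g : young_char lam F g = ratr (young_char lam rat g).
Proof.
have cE h : youngF lam F h = ratr (youngF lam rat h) by rewrite ratr_int.
have kE : young_scalar lam F = ratr (young_scalar lam rat).
  by rewrite rmorph_sum; apply: eq_bigr => h _; rewrite rmorphM !cE.
rewrite /young_char rmorph_sum; apply: eq_bigr => x _.
by rewrite /young_idem rmorphM fmorphV kE cE.
Qed.

(** By [mxtrace_specht] this is the pairing of e with chi, already computed to be 1. *)
Lemma dim_end_specht : \dim (homG (specht F lam) (specht F lam)) = 1%N.
Proof.
apply/eqP; rewrite -(eqr_nat F) dim_homG_specht; apply/eqP.
by rewrite -(young_char_idem lam F); apply: eq_bigr => g _; rewrite mxtrace_specht.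
Qed.

Lemma specht_gt0 : (0 < \rank (cyclic_mx (regular_repr F [set: 'S_n])
    (young_symmetrizer F lam)))%N.
Proof.
have := dimvS (subvf (homG (specht F lam) (specht F lam))).
rewrite dim_end_specht dimvf /dim /=; by case: (\rank _).
Qed.

Lemma end_specht f : f \in homG (specht F lam) (specht F lam) -> exists a, f = a%:M.
Proof.
have one : 1%:M \in homG (specht F lam) (specht F lam).
  by apply/mem_homG => g _; rewrite mulmx1 mul1mx.
have s0 := specht_gt0.
have one0 : (1%:M : 'M[F]_(\rank (cyclic_mx (regular_repr F [set: 'S_n])
    (young_symmetrizer F lam)))) != 0.
  by rewrite -mxrank_eq0 mxrank1 -lt0n.
have -> : homG (specht F lam) (specht F lam) = <[1%:M]>%VS.
  apply/esym/eqP; rewrite eqEdim dim_vline one0 dim_end_specht andbT.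
  by rewrite -memvE.
by case/vlineP => a ->; exists a; rewrite scalemx1.
Qed.

End Transfer.

Lemma dim_hom_prod (F : numFieldType) n k d (lam mu : 'P_n) : (0 < k)%N ->
  (\dim (homG (specht F lam) (prod_repr (specht F mu) (pol_repr F n (colour k k) d))))%:Z =
    \sum_(alpha : {ffun 'I_d.+1 -> 'I_n.+1} |
           (\sum_(i < d.+1) i * alpha i == d)%N && (\sum_(i < d.+1) alpha i == n)%N)
      \sum_(tau : {dffun forall i : 'I_d.+1, 'P_(alpha i)})
         LR_coef (fun i => parts (tau i)) mu * LR_coef (fun i => parts (tau i)) lam.
Proof.
move=> k0; set h := \dim _; set S := (X in _ = X).
have mf := multiplicity_formula d lam mu (@psumX_young n).
have E : h%:R = ratr (S%:~R) :> F.
  have perm_charJ (x g : 'S_n) : (perm_char d (x * g * x^-1)%g)%:R = (perm_char d g)%:R :> F.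
    rewrite -!(mxtrace_pol_colour F _ k0).
    rewrite !repr_mxM ?inE // mxtrace_mulC mulmxA -repr_mxM ?inE //.
    by rewrite mulVg repr_mx1 mul1mx.
  (* The factor n! replaces the idempotent of lam by its character, since the character of S^mu (x)
     Q is a class function; the rational formula then applies through [ratr]. *)
  have : n`!%:R * h%:R = n`!%:R * ratr S%:~R :> F.
    rewrite /h dim_homG_specht.
    rewrite (eq_bigr (fun g => young_idem lam F g * (young_char mu F g * (perm_char d g)%:R))).
      rewrite -young_char_class => [|x g]; last by rewrite young_charJ perm_charJ.
      rewrite -(rmorph_nat (@ratr F)) -rmorphM /= -mf rmorph_sum; apply: eq_bigr => g _.
      rewrite (young_char_ratr F lam) (young_char_ratr F mu).
      move: (young_char lam rat g) (young_char mu rat g) (perm_char d g) => a b p.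
      by rewrite [RHS]rmorphM [in RHS]rmorphM rmorph_nat mulrA.
    by move=> g _; rewrite /= mxtrace_prod mxtrace_specht (mxtrace_pol_colour F _ k0).
  by apply: mulfI; rewrite pnatr_eq0 -lt0n fact_gt0.
apply/eqP; rewrite -(eqr_int F) -pmulrn E ratr_int.
exact: eqxx.
Qed.

Section Multiplicity.
Variables (F : numFieldType) (r k n d : nat) (lam mu : 'P_n).
Hypothesis ledr : (d <= r)%N.
Local Notation Pd := (pol_repr F n (colours_upto k k.-1) (r - d)).
Local Notation PR := (pol_repr F n (colours_upto k k) r).
Local Notation PQ := (pol_repr F n (colour k k) d).

Lemma multiplicity_hom m : cent_module F (colours_upto k k.-1) (r - d) mu != 0%VS ->
  multiplicity_is (cent_alg F n (colours_upto k k.-1) (r - d))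
       (fun a f => post_comp a f)
       (fun a f => post_comp (phi r d a) f)
       (cent_module F (colours_upto k k.-1) (r - d) mu)
       (cent_module F (colours_upto k k) r lam) m
  <-> m = \dim (homG (specht F lam) (prod_repr (specht F mu) PQ)).
Proof.
move=> W0; have cG : #|[set: 'S_n]|%:R != 0 :> F.
  by rewrite cardsT card_Sn Num.Theory.pnatr_eq0 -lt0n fact_gt0.
pose w1 := vpick (homG (specht F mu) Pd).
have w1W : w1 \in homG (specht F mu) Pd by apply: memv_pick.
have w10 : w1 != 0 by rewrite vpick0.
have [rho1 rho1W w1rho1] := pairing_r cG (@end_specht F n mu) w1W w10.
pose eps := rho1 *m w1.
have epsA : eps \in homG Pd Pd by apply: homGM rho1W w1W.
have epsI : eps *m eps = eps by rewrite /eps mulmxA -(mulmxA rho1) w1rho1 mulmx1.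
pose N := phi r d eps.
have NH : N \in homG PR PR by apply: phi_hom.
have NI : N *m N = N by rewrite /N -phiM // epsI.
have -> : \dim (homG (specht F lam) (prod_repr (specht F mu) PQ)) = \dim (fixed_hom PR N (specht F lam)).
  apply/eqP; rewrite (dim_fixed_hom NI NH) -(Num.Theory.eqr_nat F) !dim_homG_specht; apply/eqP.
  apply: eq_bigr => g _; congr (_ * _).
  transitivity (\tr (specht F mu g) * \tr (PQ g)); first exact: mxtrace_prod.
  rewrite (mxtrace_idem_repr NI NH) ?inE // mxtrace_phi //; congr (_ * _).
  (* By cyclicity tr(g rho1 w1) becomes tr(w1 g rho1); w1 commutes with g, and w1 rho1 = 1 leaves
     the trace of g on S^mu. *)
  rewrite /eps mulmxA [RHS]mxtrace_mulC mulmxA -(mem_homG _ _ _ w1W) ?inE //.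
  by rewrite -mulmxA w1rho1 mulmx1.
apply: (multiplicityE cG (@end_specht F n mu) (specht_gt0 F mu) w1W rho1W w1rho1
  (act := fun a (f : 'M_(_, #|monomials n (colours_upto k k) r|)) => f *m phi r d a)).
- by move=> a c u v; rewrite mulmxDl -scalemxAl.
- by move=> u c a b; rewrite phi_linear mulmxDr -scalemxAr.
- by move=> a b u _ _; rewrite phiM // mulmxA.
- by move=> a u aA uU; apply: homGM uU _; apply: phi_hom.
- by move=> u; rewrite mem_fixed_hom.
Qed.

End Multiplicity.

Theorem theorem5p6 (R : realType) (r k n d : nat) (lam mu : 'P_n)
    (hr : (0 < r)%N) (hk : (0 < k)%N) (hn : (0 < n)%N) (hd : (d <= r)%N)
    (hmu : cent_module R[i] (colours_upto k k.-1) (r - d) mu != 0%VS) :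
  let h := \dim (homG (specht R[i] lam)
                  (prod_repr (specht R[i] mu) (pol_repr R[i] n (colour k k) d))) in
  (forall m : nat,
     multiplicity_is (cent_alg R[i] n (colours_upto k k.-1) (r - d))
       (fun a f => post_comp a f)
       (fun a f => post_comp (phi r d a) f)
       (cent_module R[i] (colours_upto k k.-1) (r - d) mu)
       (cent_module R[i] (colours_upto k k) r lam) m
     <-> m = h) /\
  h%:Z =
    \sum_(alpha : {ffun 'I_d.+1 -> 'I_n.+1} |
           (\sum_(i < d.+1) i * alpha i == d)%N && (\sum_(i < d.+1) alpha i == n)%N)
      \sum_(tau : {dffun forall i : 'I_d.+1, 'P_(alpha i)})
         LR_coef (fun i => parts (tau i)) mu * LR_coef (fun i => parts (tau i)) lam.
Proof.
move=> h; split=> [m|]; first exact: multiplicity_hom.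
exact: dim_hom_prod.
Qed.
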